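(* Let $\mathcal{A}$ be a central, essential hyperplane arrangement in $V=\mathbb{R}^d$ with faces $\mathcal{F}$, chambers $\mathcal{C}$, intersection lattice $\mathcal{L}$, and let $W\subseteq GL(V)$ be a finite group preserving $\mathcal{A}$. Let $\{p_x\}_{x\in\mathcal{F}}$ be nonnegative real numbers with $p_{wx}=p_x$ for all $w\in W$, $x\in\mathcal{F}$, and let $T$ act on $\mathbb{R}\mathcal{C}$ by left multiplication by $\sum_xp_xx$; put $\lambda_X=\sum_{x\subseteq X}p_x$ and $(\mathbb{R}\mathcal{C})_{\le\lambda}=\bigoplus_{\mu\le\lambda}\ker(T-\mu)$. Let $\mathbb{Z}_2=\{1,\tau\}$ act on $\mathbb{R}\mathcal{C}$ by $\tau(c)=-c$ (the chamber $\{-v:v\in c\}$). Then each $(\mathbb{R}\mathcal{C})_{\le\lambda}$ is $\mathbb{Z}_2$-stable, and in the Grothendieck group $\Gamma(\mathbb{R}[W\times\mathbb{Z}_2])$, $$(\mathbb{R}\mathcal{C})_{\le\lambda}=\sum_{X^W\in\mathcal{L}/W:\ \lambda_X\le\lambda}\Bigl(\mathrm{Ind}_{\mathrm{Stab}_W(X)}^W\widetilde H^*((V,X);\mathbb{R})\otimes\det{}_{V/X}\Bigr)\otimes(\chi^-)^{\otimes\dim_{\mathbb{R}}V/X}.$$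
   Context: Faces, the product $x\circ y$ (the face lying, for each $H\in\mathcal{A}$, on the side of $x$ if $x\not\subseteq H$, else on the side of $y$ if $y\not\subseteq H$, else in $H$), and chambers as usual; $\mathbb{R}\mathcal{C}$ is a left ideal in the semigroup algebra $\mathbb{R}\mathcal{F}$, and $T$ acts semisimply with real eigenvalues. $\mathcal{L}$ is ordered by reverse inclusion; $(V,X)=\{Y\in\mathcal{L}:X\subsetneq Y\subsetneq V\}$; $\widetilde H^*((V,X);\mathbb{R})=\bigoplus_i\widetilde H^i$ of the order complex, with action of the setwise stabilizer $\mathrm{Stab}_W(X)$; the empty complex has $\widetilde H^{-1}=\mathbb{R}$ (trivial), and for $X=V$ the term is the trivial one-dimensional representation. $\det_{V/X}$ is the determinant of $\mathrm{Stab}_W(X)$ on $V/X$. $\chi^-$ is the nontrivial character of $\mathbb{Z}_2$. *)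

(* Defs.v *)
From HB Require Import structures.
From mathcomp Require Import all_boot all_order all_algebra all_fingroup.
From mathcomp Require Import all_solvable all_field all_character.
From mathcomp Require Import finmap boolp reals polyrcf.
From mathcomp.multinomials Require Import freeg.

Set Implicit Arguments.
Unset Strict Implicit.
Unset Printing Implicit Defensive.

Import Order.TTheory GRing.Theory Num.Theory.
Local Open Scope ring_scope.

(* Modules follow the conventions of mxrepresentation: a representation acts
   on row vectors from the right.  A left module is read as a right module by
   v . g := g^-1 v; this is an isomorphism of categories that commutes with
   quotients, tensor products and induction and does not change stabilizers,
   orbits or invariant functions. *)

Section GrothendieckGroup.

Variables (F : fieldType) (gT : finGroupType) (G : {group gT}).
Local Notation rep := (representation F G).

HB.instance Definition _ := gen_eqMixin rep.
HB.instance Definition _ := gen_choiceMixin rep.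

Definition intertwines (M N : rep) (f : 'M[F]_(rdegree M, rdegree N)) :=
  {in G, forall g, M g *m f = f *m N g}.

Definition short_exact (M' M M'' : rep) :=
  exists (i : 'M[F]_(rdegree M', rdegree M)) (q : 'M[F]_(rdegree M, rdegree M'')),
    [/\ intertwines i, intertwines q, row_free i, row_full q & (i == kermx q)%MS].

(* The subgroup of the free abelian group on representations generated by the
   [M] - [M'] - [M''] for 0 -> M' -> M -> M'' -> 0 exact. *)
Definition short_exact_span : {pred {freeg rep}} := fun v =>
  `[< forall S : {pred {freeg rep}}, zmod_closed S ->
      (forall M' M M'', short_exact M' M M'' -> << M >> - << M' >> - << M'' >> \in S) ->
      v \in S >].

Fact short_exact_span_zmod : zmod_closed short_exact_span.
Proof.
split=> [|u v /asboolP Su /asboolP Sv]; apply/asboolP => S zS genS.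
  by have [] := zS.
by have [_] := zS; apply; [apply: Su | apply: Sv].
Qed.

HB.instance Definition _ :=
  GRing.isZmodClosed.Build {freeg rep} short_exact_span short_exact_span_zmod.

Definition grothendieck : zmodType := Quotient.quot short_exact_span.

Definition gclass (M : rep) : grothendieck :=
  \pi_(Quotient.quot short_exact_span)%qT << M >>.

End GrothendieckGroup.

Section Constructions.

Variables (F : fieldType) (gT : finGroupType).

Section Permutation.

Variables (D G : {group gT}) (T : finType) (to : action D T) (S : {set T}).
Hypothesis actS : [acts G, on S | to]%g.

Definition perm_repr_mx g : 'M[F]_#|S| :=
  \matrix_(i, j) (enum_val j == to (enum_val i) g)%:R.

Fact perm_mx_repr : mx_repr G perm_repr_mx.
Proof.
have sGD := acts_dom actS.
split=> [|g h Gg Gh]; apply/matrixP=> i j; rewrite !mxE.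
  by rewrite act1 (inj_eq enum_val_inj) eq_sym.
have Sg : to (enum_val i) g \in S.
  by rewrite (acts_act actS Gg); apply: enum_valP.
rewrite (bigD1 (enum_rank_in Sg (to (enum_val i) g))) //= !mxE.
rewrite enum_rankK_in // eqxx mul1r actMin ?(subsetP sGD) // big1 ?addr0 // => k.
by rewrite !mxE -(inj_eq enum_val_inj) enum_rankK_in // => /negbTE->; rewrite mul0r.
Qed.

Definition perm_repr := MxRepresentation perm_mx_repr.

End Permutation.

Section Subquotient.

Variables (G : {group gT}) (n : nat) (rG : mx_representation F G n).
Variables (B Z : 'M[F]_n) (modB : mxmodule rG B) (modZ : mxmodule rG Z).

Fact in_factmod_mxmodule : mxmodule (factmod_repr modB) <<in_factmod B Z>>%MS.
Proof.
apply/mxmoduleP=> g Gg; rewrite (eqmxMr _ (genmxE _)) genmxE.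
by rewrite -(in_factmodJ modB) // submxMr // (mxmoduleP modZ).
Qed.

(* The image of Z in the quotient by B, i.e. Z / B when B is contained in Z. *)
Definition subquotient_repr := submod_repr in_factmod_mxmodule.

End Subquotient.

Section Determinant.

Variables (G : {group gT}) (n : nat) (rG : mx_representation F G n).

Fact det_mx_repr : mx_repr G (fun g => (\det (rG g))%:M : 'M[F]_1).
Proof.
split=> [|g h Gg Gh]; first by rewrite repr_mx1 det1.
by rewrite repr_mxM // det_mulmx scalar_mxM.
Qed.

Definition det_repr := MxRepresentation det_mx_repr.

End Determinant.

Section TensorPower.

Variable G : {group gT}.

Fact triv_mx_repr : mx_repr G (fun=> 1%:M : 'M[F]_1).
Proof. by split=> // g h _ _; rewrite mulmx1. Qed.

Definition triv_grepr : representation F G :=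
  Representation (MxRepresentation triv_mx_repr).

Definition tensor_grepr (M N : representation F G) : representation F G :=
  Representation (prod_repr M N).

Definition tensor_power (M : representation F G) (k : nat) :=
  iter k (tensor_grepr M) triv_grepr.

End TensorPower.

Section Induction.

Variables (G H : {group gT}).
Hypothesis sHG : H \subset G.
Variable M : representation F H.

(* M (x)_FH FG is the direct sum of the M (x) t for t running through the
   representatives of the right cosets H t, and (m (x) t) g = m h (x) t'
   when t g = h t'. *)
Definition ind_index : finType := ('I_#|rcosets H G| * 'I_(rdegree M))%type.

Definition ind_mx g : 'M[F]_#|ind_index| :=
  \matrix_(i, j)
    let C := enum_val (enum_val i).1 in
    let C' := enum_val (enum_val j).1 in
    if C' == (C :* g)%g
    then M (repr C * g * (repr C')^-1)%g (enum_val i).2 (enum_val j).2 else 0.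

Fact ind_mx_repr : mx_repr G ind_mx.
Proof.
have cosP (C : {set gT}) : C \in rcosets H G -> C = (H :* repr C)%g /\ repr C \in G.
  case/rcosetsP=> x Gx ->; split; first by rewrite rcoset_repr.
  case/rcosetP: (mem_repr_rcoset H x) => h Hh ->.
  by apply: groupM => //; apply: (subsetP sHG).
have cosJ (C : {set gT}) g : C \in rcosets H G -> g \in G -> (C :* g)%g \in rcosets H G.
  by case/rcosetsP=> x Gx -> Gg; rewrite -rcosetM mem_rcosets (mulSGid sHG) groupM.
split=> [|g h Gg Gh]; apply/matrixP=> i j; rewrite !mxE /=.
  rewrite rcoset1 mulg1 -[in RHS](inj_eq enum_val_inj).
  case: (enum_val i) (enum_val j) => [c a] [c' a'] /=.
  rewrite (inj_eq enum_val_inj) xpair_eqE eq_sym.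
  by case: eqP => [->|_] //=; rewrite mulgV repr_mx1 mxE.
set c := (enum_val i).1; set a := (enum_val i).2.
set c' := (enum_val j).1; set a' := (enum_val j).2.
set C := enum_val c; set C' := enum_val c'.
have Cg : (C :* g)%g \in rcosets H G by apply: cosJ => //; apply: enum_valP.
pose k : 'I_#|rcosets H G| := enum_rank_in Cg (C :* g)%g.
have kE : enum_val k = (C :* g)%g by rewrite enum_rankK_in.
pose r (b : 'I_(rdegree M)) : 'I_#|ind_index| := enum_rank ((k, b) : ind_index).
transitivity (\sum_b ind_mx g i (r b) * ind_mx h (r b) j); last first.
  rewrite [RHS](bigID (fun l : 'I_#|ind_index| => (enum_val l).1 == k)) /=.
  rewrite [X in _ = _ + X]big1 ?addr0 => [|l nk]; last first.
    by rewrite !mxE /= -/c -/C -kE (inj_eq enum_val_inj) (negbTE nk) mul0r.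
  rewrite [RHS](reindex_onto r (fun l => (enum_val l).2)) /=; last first.
    move=> l /eqP El; apply: enum_val_inj; rewrite enum_rankK -El.
    by rewrite -surjective_pairing.
  by apply: eq_bigl => b; rewrite /r enum_rankK /= !eqxx.
under eq_bigr => b _ do rewrite !mxE /r !enum_rankK /= -/c -/c' -/C -/C' kE eqxx.
rewrite rcosetM; have [eC|nC] := eqVneq; last by rewrite big1 // => b _; rewrite mulr0.
have inH (c1 c2 : 'I_#|rcosets H G|) g1 : enum_val c2 = (enum_val c1 :* g1)%g ->
    (repr (enum_val c1) * g1 * (repr (enum_val c2))^-1)%g \in H.
  have [E1 _] := cosP _ (enum_valP c1); have [E2 _] := cosP _ (enum_valP c2).
  move=> e12; rewrite -mem_rcoset -E2 e12 {2}E1 -rcosetM mem_rcoset mulgV.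
  exact: group1.
have -> : (repr C * (g * h) * (repr C')^-1 = repr C * g * (repr (C :* g))^-1
   * (repr (C :* g) * h * (repr C')^-1))%g by rewrite !mulgA mulgKV.
rewrite repr_mxM ?mxE -?kE; first by [].
- exact: inH.
- by apply: inH; rewrite kE.
Qed.

Definition ind_grepr : representation F G :=
  Representation (MxRepresentation ind_mx_repr).

End Induction.

End Constructions.

Section OuterTensor.

Variables (F : fieldType) (gT1 gT2 : finGroupType).
Variables (G1 : {group gT1}) (G2 : {group gT2}).
Variables (M : representation F G1) (N : representation F G2).

Fact outer_tensor_mx_repr :
  mx_repr (setX G1 G2) (fun g => tprod (M g.1) (N g.2)).
Proof.
split=> [|g h]; first by rewrite !repr_mx1 tprod1.
rewrite !inE => /andP[G1g G2g] /andP[G1h G2h].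
by rewrite -tprodE -!repr_mxM.
Qed.

Definition outer_tensor : representation F (setX_group G1 G2) :=
  Representation (MxRepresentation outer_tensor_mx_repr).

End OuterTensor.

Section SignCharacter.

Variable F : fieldType.

Lemma sign_Z2M (y z : 'Z_2) : (-1) ^+ (y * z)%g = (-1) ^+ y * (-1) ^+ z :> F.
Proof.
rewrite -exprD -[LHS]signr_odd -[RHS]signr_odd.
by case: y z => [[|[|y]] Hy] [[|[|z]] Hz].
Qed.

Fact sign_mx_repr : mx_repr [set: 'Z_2] (fun z : 'Z_2 => ((-1) ^+ z)%:M : 'M[F]_1).
Proof.
split=> [|y z _ _]; first by rewrite expr0.
by rewrite sign_Z2M scalar_mxM.
Qed.

Definition chi_minus : representation F [set: 'Z_2] :=
  Representation (MxRepresentation sign_mx_repr).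

End SignCharacter.

Section Arrangement.

Variables (R : realType) (d : nat).
Local Notation V := 'rV[R]_d.

Record arrangement := Arrangement {
  hyperplanes :> {fset {vspace V}};
  hyperplanes_codim1 : forall H, H \in hyperplanes -> (\dim H).+1 = d
}.

Definition essential (A : arrangement) := (\bigcap_(H : A) val H)%VS = 0%VS.

Variable A : arrangement.

Definition subspace_mx (X : {vspace V}) : 'M[R]_d :=
  <<\matrix_(i < \dim X) (vbasis X)`_i>>%MS.

Lemma mem_subspace_mx (X : {vspace V}) (v : V) : (v \in X) = (v <= subspace_mx X)%MS.
Proof.
rewrite genmxE; apply/idP/submxP => [Xv|[u ->]].
  exists (\row_i coord (vbasis X) i v); rewrite {1}(coord_vbasis Xv).
  by rewrite mulmx_sum_row; apply: eq_bigr => i _; rewrite mxE rowK.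
rewrite mulmx_sum_row; apply: memv_suml => i _.
by rewrite rowK memvZ // vbasis_mem // mem_nth // size_tuple.
Qed.

Lemma mxrank_subspace_mx (X : {vspace V}) : (\rank (subspace_mx X) = \dim X)%N.
Proof.
rewrite genmxE; apply/eqP; rewrite -/(row_free _) -kermx_eq0.
apply/rowV0P => u /sub_kermxP; rewrite mulmx_sum_row => u0.
apply/rowP => i; rewrite mxE.
have /freeP := basis_free (vbasisP X); apply.
by rewrite -[RHS]u0; apply: eq_bigr => j _; rewrite rowK.
Qed.

Lemma equation_ex (H : A) :
  exists a : 'cV[R]_d, forall v : V, (v \in val H) = (v *m a == 0).
Proof.
set M := subspace_mx (val H).
have rM : (\rank M).+1 = d.
  by rewrite mxrank_subspace_mx; apply/hyperplanes_codim1/valP.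
have /rowV0Pn[b /sub_kermxP bM b0] : kermx M^T != 0.
  by rewrite -mxrank_eq0 mxrank_ker mxrank_tr -[X in (X - _)%N]rM subSnn.
exists b^T => v; rewrite mem_subspace_mx -/M.
have sMb : (M <= kermx b^T)%MS.
  by apply/sub_kermxP/trmx_inj; rewrite trmx_mul trmxK bM trmx0.
have rb : \rank b = 1%N by apply/eqP; rewrite eqn_leq rank_leq_row lt0n mxrank_eq0.
have /eqmxP eMb : (M == kermx b^T)%MS.
  by rewrite -(mxrank_leqif_eq sMb) mxrank_ker mxrank_tr rb -[X in (X - 1)%N]rM subn1.
by rewrite eMb; apply/sub_kermxP/eqP.
Qed.

(* An equation of H, chosen once and for all; it orients H. *)
Definition equation (H : A) : 'cV[R]_d := projT1 (cid (equation_ex H)).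

Lemma equationP (H : A) (v : V) : (v \in val H) = (v *m equation H == 0).
Proof. exact: projT2 (cid (equation_ex H)) v. Qed.

(* None on H, Some true and Some false on its two sides. *)
Definition side (H : A) (v : V) : option bool :=
  if v \in val H then None else Some (0 < (v *m equation H) 0 0).

Definition sides (v : V) : {ffun A -> option bool} := [ffun H => side H v].

Record face := Face {
  face_sides :> {ffun A -> option bool};
  face_sidesP : `[< exists v, face_sides = sides v >]
}.

HB.instance Definition _ := [isSub for face_sides].
HB.instance Definition _ := [Finite of face by <:].

Definition face_of (v : V) : face := Face (asboolT (ex_intro _ v erefl)).

Definition face_point (x : face) : V := projT1 (cid (asboolW (face_sidesP x))).

Lemma face_pointK x : face_of (face_point x) = x.
Proof. by apply: val_inj; rewrite /= -(projT2 (cid (asboolW (face_sidesP x)))). Qed.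

Definition face_mul_sides (x y : face) : {ffun A -> option bool} :=
  [ffun H => if x H is Some s then Some s else y H].

Lemma small_pos (I : Type) (s : seq I) (f g : I -> R) :
  exists2 e : R, 0 < e & forall e', 0 < e' <= e ->
    all (fun i => (f i != 0) ==> (e' * `|g i| < `|f i|)) s.
Proof.
elim: s => [|i s [e e0 IH]]; first by exists 1.
have [fi0|fi0] := eqVneq (f i) 0.
  by exists e => // e' /IH /= ->; rewrite fi0 eqxx.
have g1 : 0 < 1 + `|g i| by rewrite ltr_pwDl.
have nf : 0 < `|f i| / (1 + `|g i|) by rewrite divr_gt0 ?normr_gt0.
exists (Num.min e (`|f i| / (1 + `|g i|))); first by rewrite lt_min e0.
move=> e' /andP[e'0]; rewrite le_min => /andP[le1 le2] /=.
rewrite IH ?e'0 // andbT fi0 /=.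
apply: (@lt_le_trans _ _ (e' * (1 + `|g i|))); last by rewrite -ler_pdivlMr.
by rewrite ltr_pM2l // ltrDr.
Qed.

Lemma sgr_perturb (a b e : R) : a != 0 -> 0 < e -> e * `|b| < `|a| ->
  (a + e * b != 0) /\ (0 < a + e * b) = (0 < a).
Proof.
move=> a0 e0 lt.
have : `|e * b| < `|a| by rewrite normrM (gtr0_norm e0).
rewrite ltr_norml => /andP[l1 l2].
have [ap|an|a00] := ltgtP 0 a; last by rewrite -a00 eqxx in a0.
- rewrite gtr0_norm // in l1 l2; have h : 0 < a + e * b by rewrite addrC -ltrBlDr sub0r.
  by rewrite h lt0r_neq0.
- rewrite ltr0_norm // in l1 l2; have h : a + e * b < 0 by rewrite addrC -ltrBrDr sub0r.
  by rewrite ltr0_neq0 // ltNge ltW.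
Qed.

Fact face_mul_subproof x y : `[< exists v, face_mul_sides x y = sides v >].
Proof.
set u := face_point x; set w := face_point y.
pose f H := (u *m equation H) 0 0; pose g H := (w *m equation H) 0 0.
have mem0 (H : A) (v : V) : (v \in val H) = ((v *m equation H) 0 0 == 0).
  rewrite equationP; apply/eqP/eqP => [->|v0]; first by rewrite mxE.
  by apply/matrixP => i j; rewrite !ord1 v0 mxE.
have [e e0 /(_ e)] := small_pos (enum {: A}) f g.
rewrite e0 lexx => /(_ isT)/allP small; apply/asboolP; exists (u + e *: w).
apply/ffunP => H; rewrite !ffunE -(face_pointK x) -(face_pointK y) /= -/u -/w.
have lin : ((u + e *: w) *m equation H) 0 0 = f H + e * g H.
  by rewrite mulmxDl -scalemxAl mxE [X in _ + X]mxE.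
rewrite !ffunE /side !mem0 lin.
have /implyP := small H (mem_enum _ H); rewrite -/(f H) -/(g H).
have [f0 _|f0 /(_ isT) lt] := eqVneq (f H) 0.
  by rewrite f0 add0r mulf_eq0 (gt_eqF e0) pmulr_rgt0.
by have [/negbTE -> ->] := sgr_perturb f0 e0 lt.
Qed.

Definition face_mul x y : face := Face (face_mul_subproof x y).

(* The face {- v : v in x}. *)
Definition face_opp x : face := face_of (- face_point x).

Definition chambers : {set face} := [set c : face | [forall H, c H != None]].

(* The lattice of all intersections of hyperplanes, V included. *)
Definition flats : seq {vspace V} :=
  [seq (\bigcap_(H in B) val H)%VS | B : {set A}].

Definition flat := seq_sub flats.

Implicit Types X Y : flat.

(* X strictly contains Y, i.e. X < Y in the order by reverse inclusion. *)
Definition flat_lt X Y := (val Y <= val X)%VS && (Y != X).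

Definition interval X : {set flat} := [set Y | flat_lt Y X & val Y != fullv].

(* The simplices of dimension k - 1 of the order complex of (V, X); the empty
   simplex, for k = 0, is the augmentation. *)
Definition simplices X (k : nat) : {set {set flat}} :=
  [set s : {set flat} | [&& #|s| == k, s \subset interval X &
     [forall Y in s, forall Z in s, [|| Y == Z, flat_lt Y Z | flat_lt Z Y]]]].

(* The simplicial coboundary, simplices being oriented by the order:
   (delta f)(t) = \sum_(Y in t) (-1) ^ (position of Y in t) f(t \ Y). *)
Definition coboundary X (k : nat) : 'M[R]_(#|simplices X k|, #|simplices X k.+1|) :=
  \matrix_(i, j) let s : {set flat} := enum_val i in let t : {set flat} := enum_val j in
    \sum_(Y in t | t :\ Y == s) (-1) ^+ #|[set Z in t | flat_lt Z Y]|.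

Definition cocycles X k : 'M[R]_#|simplices X k| := kermx (coboundary X k).

Definition coboundaries X k : 'M[R]_#|simplices X k| :=
  match k with 0 => 0 | k'.+1 => <<coboundary X k'>>%MS end.

Section Walk.

Variable p : face -> R.

(* Row c of the matrix is (\sum_x p_x x) c. *)
Definition walk_mx : 'M[R]_#|chambers| :=
  \matrix_(i, j) \sum_(x | face_mul x (enum_val i) == enum_val j) p x.

Definition walk_eigenvalue X : R :=
  \sum_(x : face | `[< forall v, face_of v = x -> v \in val X >]) p x.

Definition walk_le (lam : R) : 'M[R]_#|chambers| :=
  (\sum_(mu <- rootsR (char_poly walk_mx) | (mu <= lam)%R) eigenspace walk_mx mu)%MS.

End Walk.

Definition tau_mx : 'M[R]_#|chambers| :=
  \matrix_(i, j) (enum_val j == face_opp (enum_val i))%:R.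

Section Group.

Variables (gT : finGroupType) (W : {group gT}) (rW : mx_representation R W d).
Local Notation WZ := (setX_group W [set: 'Z_2]%G).

Definition subspace_image (M : 'M[R]_d) (X : {vspace V}) : {vspace V} :=
  (linfun (mulmxr M) @: X)%VS.

Definition preserves :=
  {in W, forall w, forall H, H \in hyperplanes A ->
     subspace_image (rW w) H \in hyperplanes A}.

Definition face_image (M : 'M[R]_d) (x : face) : face := face_of (face_point x *m M).

Hypothesis presA : preserves.

Lemma mem_subspace_image (M : 'M[R]_d) (X : {vspace V}) (v : V) : M \in unitmx ->
  (v *m M \in subspace_image M X) = (v \in X).
Proof.
move=> uM; have -> : v *m M = linfun (mulmxr M) v by rewrite lfunE.
apply/idP/idP => [/memv_imgP[u Xu]|]; last exact: memv_img.
by rewrite !lfunE /= => /(can_inj (mulmxK uM)) ->.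
Qed.

Lemma subspace_imageM w1 w2 (X : {vspace V}) : w1 \in W -> w2 \in W ->
  subspace_image (rW (w1 * w2)%g) X
  = subspace_image (rW w2) (subspace_image (rW w1) X).
Proof.
move=> W1 W2; rewrite /subspace_image -limg_comp; congr (_ @: _)%VS.
by apply/lfunP => v; rewrite comp_lfunE !lfunE /= repr_mxM // mulmxA.
Qed.

Lemma subspace_image1 (X : {vspace V}) : subspace_image (rW 1%g) X = X.
Proof.
rewrite /subspace_image repr_mx1 -[RHS]lim1g; congr (_ @: _)%VS.
by apply/lfunP => v; rewrite !lfunE /= mulmx1.
Qed.

Lemma subspace_imageK w (X : {vspace V}) : w \in W ->
  subspace_image (rW w) (subspace_image (rW w^-1%g) X) = X.
Proof.
by move=> Ww; rewrite -subspace_imageM ?groupV // mulVg subspace_image1.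
Qed.

Lemma subspace_imageVK w (X : {vspace V}) : w \in W ->
  subspace_image (rW w^-1%g) (subspace_image (rW w) X) = X.
Proof.
by move=> Ww; rewrite -subspace_imageM ?groupV // mulgV subspace_image1.
Qed.

(* W x Z_2 acts on V, tau acting as -1. *)
Definition wz_mx (g : gT * 'Z_2) : 'M[R]_d := (-1) ^+ g.2 *: rW g.1.

Lemma wz_mxM g h : g \in WZ -> h \in WZ ->
  wz_mx (g * h)%g = wz_mx g *m wz_mx h.
Proof.
rewrite !inE !andbT => Wg Wh; rewrite /wz_mx repr_mxM //.
rewrite -scalemxAl -scalemxAr scalerA; congr (_ *: _).
by rewrite -sign_Z2M.
Qed.

Lemma wz_mx1 : wz_mx 1%g = 1%:M.
Proof. by rewrite /wz_mx repr_mx1 scale1r. Qed.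

Lemma side_eqP (H : A) u v : reflect
  (exists2 k : R, 0 < k & (u *m equation H) 0 0 = k * (v *m equation H) 0 0)
  (side H u == side H v).
Proof.
have mem0 (w : V) : (w \in val H) = ((w *m equation H) 0 0 == 0).
  rewrite equationP; apply/eqP/eqP => [->|v0]; first by rewrite mxE.
  by apply/matrixP => i j; rewrite !ord1 v0 mxE.
rewrite /side !mem0; set a := (u *m _) 0 0; set b := (v *m _) 0 0.
have [a0|a0] := eqVneq a 0; have [b0|b0] := eqVneq b 0.
- by apply: ReflectT; exists 1; rewrite ?a0 ?b0 ?mulr0.
- apply: ReflectF => -[k k0]; rewrite a0 => /esym/eqP.
  by rewrite mulf_eq0 (negbTE b0) gt_eqF.
- by apply: ReflectF => -[k k0]; rewrite b0 mulr0 => /eqP; rewrite (negbTE a0).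
apply: (iffP eqP) => [[e]|[k k0 ->]]; last by rewrite pmulr_rgt0.
exists (a / b); last by rewrite divfK.
have [bp|bn|b00] := ltgtP 0 b; last by rewrite -b00 eqxx in b0.
  by rewrite divr_gt0 // e.
have an : a < 0 by rewrite lt_neqAle a0 leNgt e -leNgt ltW.
by rewrite -divrNN divr_gt0 ?oppr_gt0.
Qed.

Lemma proportional (a b : 'cV[R]_d) :
  (forall v : V, (v *m b == 0) = (v *m a == 0)) -> exists2 k : R, k != 0 & b = k *: a.
Proof.
move=> ab; have [a0|a0] := eqVneq a 0.
  exists 1; rewrite ?oner_eq0 // scale1r a0; apply/row_matrixP => i.
  by rewrite row0 rowE; apply/eqP; rewrite ab a0 mulmx0.
have [i ai] : exists i, a i 0 != 0.
  apply/existsP; apply: contraNT a0 => /existsPn a0; apply/eqP/matrixP => i j.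
  by rewrite ord1 mxE; apply/eqP; rewrite -[_ == _]negbK a0.
have ei (c : 'cV[R]_d) : delta_mx 0 i *m c = (c i 0)%:M.
  by rewrite -rowE; apply/matrixP => m n; rewrite !ord1 !mxE eqxx mulr1n.
have bi : b i 0 != 0.
  have s0 (c : R) : (c%:M == 0 :> 'M_1) = (c == 0).
    by rewrite -scalemx1 scaler_eq0 oner_eq0 orbF.
  by rewrite -s0 -ei ab ei s0.
exists (b i 0 / a i 0); first by rewrite mulf_neq0 ?invr_neq0.
apply/row_matrixP => j; rewrite rowE [RHS]rowE.
pose e := (a j 0 / a i 0) *: delta_mx 0 i : V.
have ej (c : 'cV[R]_d) : delta_mx 0 j *m c = (c j 0)%:M.
  by rewrite -rowE; apply/matrixP => m n; rewrite !ord1 !mxE eqxx mulr1n.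
have : (delta_mx 0 j - e) *m b == 0.
  rewrite ab mulmxBl -scalemxAl ei ej scale_scalar_mx.
  by rewrite divfK // subrr.
rewrite mulmxBl subr_eq0 => /eqP ->; rewrite -scalemxAl -scalemxAr ei ej.
by rewrite !scale_scalar_mx mulrAC [in RHS]mulrAC [X in X / _]mulrC.
Qed.

Lemma equation_image g (H : A) : g \in WZ -> exists (K : A) (k : R),
  k != 0 /\ wz_mx g *m equation H = k *: equation K.
Proof.
rewrite !inE andbT => Wg; have WV := groupVr Wg.
pose K : A := FSetSub (presA WV (valP H)).
have KE : subspace_image (rW g.1) (val K) = val H by rewrite /= subspace_imageK.
have [v|k k0 E] := @proportional (equation K) (wz_mx g *m equation H).
  rewrite mulmxA -!equationP -(mem_subspace_image (val K) v (repr_mx_unit rW Wg)) KE.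
  by rewrite -scalemxAr rpredZeq signr_eq0.
by exists K, k.
Qed.

Lemma face_image_of g v : g \in WZ ->
  face_image (wz_mx g) (face_of v) = face_of (v *m wz_mx g).
Proof.
move=> Wg; apply: val_inj; apply/ffunP => H; rewrite !ffunE.
have [K [k [k0 E]]] := equation_image H Wg.
have : face_of (face_point (face_of v)) = face_of v by apply: face_pointK.
move/(congr1 face_sides)/ffunP/(_ K); rewrite !ffunE => /eqP/side_eqP[c c0 Ec].
apply/eqP/side_eqP; exists c => //.
by rewrite -!mulmxA E -!scalemxAr [LHS]mxE [in RHS]mxE Ec mulrCA.
Qed.

(* c . (w, tau^z) is the face containing (-1)^z v w for v in c. *)
Definition wz_act (x : face) (g : gT * 'Z_2) : face :=
  if g \in WZ then face_image (wz_mx g) x else x.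

Fact wz_is_action : is_action (WZ) wz_act.
Proof.
have actM : forall x, {in WZ &, act_morph wz_act x}.
  move=> x g h Wg Wh; rewrite /wz_act Wg Wh (groupM Wg Wh).
  rewrite -[x]face_pointK !face_image_of ?(groupM Wg Wh) //.
  by rewrite -mulmxA -wz_mxM // face_pointK.
split=> // g x y; have [Wg|nWg] := boolP (g \in WZ); last first.
  by rewrite /wz_act (negbTE nWg).
have act1 z : wz_act z 1%g = z.
  by rewrite /wz_act group1 /face_image wz_mx1 mulmx1 face_pointK.
move=> /(congr1 (wz_act^~ g^-1%g)).
by rewrite -!actM ?groupV // mulgV !act1.
Qed.

Definition wz_action := Action wz_is_action.

Fact chambers_acts : [acts WZ, on chambers | wz_action]%g.
Proof.
apply/subsetP => g Wg; rewrite inE Wg inE; apply/subsetP => c; rewrite !inE.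
move=> /forallP Cc; apply/forallP => H.
have [K [k [k0 E]]] := equation_image H Wg.
have := Cc K; rewrite -[c]face_pointK; set u := face_point c.
rewrite /= /wz_act Wg face_image_of // !ffunE /side !equationP -mulmxA E -scalemxAr.
by rewrite scaler_eq0 (negbTE k0) /=; case: ifP.
Qed.

Definition chamber_repr := perm_repr R chambers_acts.

Lemma subspace_image_flat w X : w \in W -> subspace_image (rW w) (val X) \in flats.
Proof.
move=> Ww; have /imageP[S _ ->] := valP X.
have inj : lker (linfun (mulmxr (rW w)) : 'End(V)) == 0%VS.
  apply/lker0P => u v; rewrite !lfunE /=.
  exact: (can_inj (mulmxK (repr_mx_unit rW Ww))).
have imH (H : A) : subspace_image (rW w) (val H) \in hyperplanes A.
  by apply: presA => //; apply: valP.
pose f (H : A) : A := FSetSub (imH H).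
have fI : injective f.
  move=> H K /(congr1 val) /= e; apply: val_inj.
  by rewrite -[LHS](subspace_imageVK _ Ww) e subspace_imageVK.
apply/imageP; exists (f @: S) => //.
rewrite big_imset /=; last by move=> ? ? _ _; apply: fI.
rewrite /subspace_image; elim/big_rec2: _ => [|H U1 U2 _ <-].
  exact: lker0_limgf.
exact: lker0_img_cap.
Qed.

Definition flat_act X (w : gT) : flat :=
  if w \in W then insubd X (subspace_image (rW w) (val X)) else X.

Lemma val_flat_act X w : w \in W -> val (flat_act X w) = subspace_image (rW w) (val X).
Proof. by move=> Ww; rewrite /flat_act Ww insubdK // subspace_image_flat. Qed.

Fact flat_is_action : is_action W flat_act.
Proof.
have actM : forall X, {in W &, act_morph flat_act X}.
  move=> X g h Wg Wh; apply: val_inj.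
  by rewrite !val_flat_act ?groupM // subspace_imageM.
split=> // g X Y; have [Wg|nWg] := boolP (g \in W); last first.
  by rewrite /flat_act (negbTE nWg).
have act1 Z : flat_act Z 1%g = Z.
  by apply: val_inj; rewrite val_flat_act // subspace_image1.
move=> /(congr1 (flat_act^~ g^-1%g)).
by rewrite -!actM ?groupV // mulgV !act1.
Qed.

Definition flat_action := Action flat_is_action.

Definition stab X : {group gT} := 'C_W[X | flat_action]%G.

Fact stab_sub X : stab X \subset W. Proof. exact: subsetIl. Qed.

Lemma stabP X w : w \in stab X -> w \in W /\ flat_act X w = X.
Proof. by case/setIP=> Ww Sw; split=> //; apply: (astab_act Sw); rewrite inE. Qed.

Fact subspace_mx_mxmodule X :
  mxmodule (subg_repr rW (stab_sub X)) (subspace_mx (val X)).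
Proof.
apply/mxmoduleP => w /stabP[Ww Xw]; apply/row_subP => i /=.
rewrite row_mul -mem_subspace_mx -[in X in _ \in X]Xw val_flat_act //.
by rewrite mem_subspace_image ?(repr_mx_unit rW) // mem_subspace_mx row_sub.
Qed.

Definition det_quotient X : representation R (stab X) :=
  Representation (det_repr (factmod_repr (subspace_mx_mxmodule X))).

Lemma flat_lt_act X Y w : w \in W ->
  flat_lt (flat_act X w) (flat_act Y w) = flat_lt X Y.
Proof.
move=> Ww; rewrite /flat_lt (inj_eq (act_inj flat_action w)) !val_flat_act //.
rewrite limg_ker0 //; apply/lker0P => u v; rewrite !lfunE /=.
exact: (can_inj (mulmxK (repr_mx_unit rW Ww))).
Qed.

Fact simplices_acts X k : [acts stab X, on simplices X k | flat_action^*]%g.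
Proof.
apply/subsetP => w Sw; have [Ww Xw] := stabP Sw.
rewrite inE Ww inE; apply/subsetP => s; rewrite !inE /= => /and3P[sk sI /forall_inP sC].
apply/and3P; split.
- by rewrite card_imset //; apply: (act_inj flat_action).
- apply/subsetP => _ /imsetP[Y sY ->]; have := subsetP sI _ sY.
  rewrite !inE => /andP[XY YV]; rewrite -[U in flat_lt _ U]Xw [flat_lt _ _]flat_lt_act // XY /=.
  rewrite val_flat_act //; apply: contraNneq YV => YV.
  have := subspace_imageVK (val Y) Ww; rewrite YV => <-; apply/eqP.
  apply: lker0_limgf; apply/lker0P => u v; rewrite !lfunE /=.
  by apply: (can_inj (mulmxK (repr_mx_unit rW _))); rewrite groupV.
- apply/forall_inP => _ /imsetP[Y sY ->]; apply/forall_inP => _ /imsetP[Z sZ ->].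
  by rewrite (inj_eq (act_inj flat_action w)) !flat_lt_act //; apply: (forall_inP (sC _ sY)).
Qed.

Definition cochain_repr X k := perm_repr R (simplices_acts X k).

Lemma coboundary_hom X k w : w \in stab X ->
  cochain_repr X k w *m coboundary X k = coboundary X k *m cochain_repr X k.+1 w.
Proof.
move=> Sw; have [Ww Xw] := stabP Sw.
have inj := act_inj flat_action w.
apply/matrixP => i j; rewrite !mxE.
have actsE n (s : {set flat}) : (flat_action^* s w \in simplices X n)%act = (s \in simplices X n).
  exact: (acts_act (simplices_acts X n)).
have Ii : (flat_action^* (enum_val i) w \in simplices X k)%act.
  by rewrite actsE; apply: enum_valP.
rewrite (bigD1 (enum_rank_in Ii (flat_action^* (enum_val i) w)%act)) //=.
rewrite !mxE enum_rankK_in // eqxx mul1r big1 ?addr0; last first.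
  move=> l nl; rewrite !mxE; case: eqP => [e|_]; last by rewrite mul0r.
  by case/eqP: nl; apply: enum_val_inj; rewrite enum_rankK_in.
set s := enum_val i.
have [t St jE] : exists2 t, t \in simplices X k.+1 & enum_val j = (flat_action^* t w)%act.
  exists (flat_action^* (enum_val j) w^-1%g)%act; last by rewrite actKVin.
  by rewrite (acts_act (simplices_acts X k.+1)) ?groupV //; apply: enum_valP.
rewrite [RHS](bigD1 (enum_rank_in St t)) //= [X in _ = _ + X]big1 ?addr0; last first.
  move=> l nl; rewrite !mxE; case: eqP => [e|_]; last by rewrite mulr0.
  rewrite jE in e; have {}e := act_inj (flat_action^*) w e.
  by case/eqP: nl; apply: enum_val_inj; rewrite enum_rankK_in.
rewrite !mxE enum_rankK_in // jE eqxx mulr1 /= /setact.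
rewrite [LHS](reindex_inj inj) /=; apply: eq_big => [Y|Y _].
  rewrite (mem_imset _ _ inj); congr (_ && _).
  rewrite -/s -[RHS](inj_eq (imset_inj inj)); congr (_ == _); apply/setP => Z.
  apply/setD1P/imsetP => [[nZ /imsetP[Z' tZ eZ]]|[Z' /setD1P[nZ tZ] ->]].
    by exists Z' => //; rewrite !inE tZ andbT; apply: contraNneq nZ => <-; rewrite eZ.
  by split; [rewrite (inj_eq inj) | apply: imset_f].
congr (_ ^+ _).
rewrite -[RHS](card_imset _ inj); apply: eq_card => Z; rewrite !inE.
apply/andP/imsetP => [[/imsetP[Z' tZ ->]]|[Z' + ->]].
  by rewrite flat_lt_act // => lt; exists Z'; rewrite // inE tZ.
by rewrite inE flat_lt_act // => /andP[tZ ->]; split=> //; apply: imset_f.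
Qed.

Fact cocycles_mxmodule X k : mxmodule (cochain_repr X k) (cocycles X k).
Proof.
apply/mxmoduleP => w Sw; apply/sub_kermxP.
by rewrite -mulmxA coboundary_hom // mulmxA mulmx_ker mul0mx.
Qed.

Fact coboundaries_mxmodule X k : mxmodule (cochain_repr X k) (coboundaries X k).
Proof.
case: k => [|k]; first exact: mxmodule0.
apply/mxmoduleP => w Sw; rewrite (eqmxMr _ (genmxE _)) genmxE.
by rewrite -coboundary_hom // submxMl.
Qed.

(* Reduced cohomology of (V, X) in degree k - 1. *)
Definition cohomology_repr X k : representation R (stab X) :=
  Representation
    (subquotient_repr (coboundaries_mxmodule X k) (cocycles_mxmodule X k)).

(* A simplex is a set of flats, hence has at most #|flat| vertices. *)
Definition total_cohomology X : representation R (stab X) :=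
  \big[@dadd_grepr R gT (stab X)/@grepr0 R gT (stab X)]_(k < #|{: flat}|.+1) cohomology_repr X k.

Definition flat_summand X : representation R WZ :=
  outer_tensor
    (ind_grepr (stab_sub X) (tensor_grepr (total_cohomology X) (det_quotient X)))
    (tensor_power (chi_minus R) (d - \dim (val X))).


End Group.
End Arrangement.

(* Main.v *)
(* In characteristic 0 a representation is determined in the Grothendieck group
   by its character, so both sides are compared through their traces at
   g = (w, tau^z), which acts on V as (-1)^z w.

   Left side: since y (T - lam_Y) is a combination of faces y x with larger
   support, a face y of support Y kills ker (T - mu) for all mu < lam_Y.  Hence
   the sum of the ker (T - mu), mu <= c, is the space killed by all the y with
   lam_Y > c; this is stable under W x Z_2 (although T does not commute with tau)
   and is the image of a polynomial f(T) = sum_x q_x x.  The trace of g on it is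
   sum_x q_x #{c : (x c) g = c}.  The faces y with (x y) g = y correspond to
   the faces of an arrangement in the fixed space U of g, so their Euler characteristic and
   Moebius inversion in the poset of g-fixed flats give
     #{c : (x c) g = c} = sum_(X >= x) (-1)^(dim U - dim (X :&: U)) mu_g(X, V),
   where the q_x with x in X sum up to f(lam_X), which is 1 or 0.

   Right side: by Folkman's theorem the cohomology of (V, X) is concentrated in
   one degree, where the Hopf trace formula and Philip Hall's theorem identify
   its character with (-1)^(codim X) mu_g(X, V); and det (- h) = (-1)^(dim ker (h - 1))
   for a real matrix h of finite order accounts for det_(V/X). *)
Require Import Defs.
From mathcomp Require Import all_boot all_order all_algebra all_fingroup.
From mathcomp Require Import all_solvable all_field all_character.
From mathcomp Require Import finmap boolp reals polyrcf zify ring.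

Set Implicit Arguments.
Unset Strict Implicit.
Unset Printing Implicit Defensive.

Import Order.TTheory GRing.Theory Num.Theory.
Local Open Scope ring_scope.

(** * Traces and the Grothendieck group *)

(** Over the reals a simple module need not be absolutely simple, so equality of classes is not
    derived from an orthonormal basis of characters: it only uses that the pairing of two characters
    detects intertwiners, which lets a simple submodule of one side be found inside the other and
    split off from both. On the left, the projector onto the stable subspace need not be equivariant
    to compute traces; f comes from a Bezout relation between the linear factors with roots up to
    lam and those beyond. The q_x enter only through f(lam_X) because containment in X is
    multiplicative on faces. Different flats may share an eigenvalue, so every product of factors T
    - mu runs over distinct values and every induction compares values, not flats. For g = (w,
    tau^z) the space U is the fixed space of (-1)^z w; thus tau is absorbed into U, and both sides
    reduce to one function [flat_term] of g and a flat. The sum over orbits opens up into a sum over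
    all g-fixed flats because the cosets on the diagonal of an induced module are the fixed points
    of the orbit. *)

Section MatrixTrace.

Variable F : fieldType.

Lemma idempotent_base n (e : 'M[F]_n) : e *m e = e -> row_base e *m col_base e = 1%:M.
Proof.
move=> ee; apply: (@row_full_inj _ _ _ _ (col_base e)); first exact: col_base_full.
apply: (@row_free_inj _ _ _ _ (row_base e)); first exact: row_base_free.
by rewrite /= mulmx1 [in RHS]mulmx_base mulmxA mulmx_base -mulmxA mulmx_base.
Qed.

Lemma mxtrace_idempotent n (e : 'M[F]_n) : e *m e = e -> \tr e = (\rank e)%:R.
Proof.
by move=> ee; rewrite -[in LHS](mulmx_base e) mxtrace_mulC idempotent_base // mxtrace1.
Qed.

(** Summed over a group, this expresses a pairing of characters through averaged matrix units, so a
    nonzero pairing forces one of them to be nonzero. *)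
Lemma mxtrace_mulE m n (A : 'M[F]_m) (B : 'M[F]_n) :
  \tr A * \tr B = \sum_i \sum_j (A *m delta_mx i j *m B) i j.
Proof.
rewrite /mxtrace big_distrl /=; apply: eq_bigr => i _; rewrite big_distrr /=.
apply: eq_bigr => j _; rewrite mxE (bigD1 j) //= big1 ?addr0 => [|k kj].
  rewrite mxE (bigD1 i) //= big1 ?addr0 => [|k ki]; first by rewrite mxE !eqxx mulr1.
  by rewrite mxE (negPf ki) mulr0.
rewrite mxE big1 ?mul0r // => l _.
by rewrite mxE (negPf kj) andbF mulr0.
Qed.

Lemma mxtrace_lin_mulmx m n (A : 'M[F]_m) (B : 'M[F]_n) :
  \tr (lin_mx (mulmx A \o mulmxr B)) = \tr A * \tr B.
Proof.
rewrite mxtrace_mulE pair_big /mxtrace (reindex (uncurry (@mxvec_index m n))) /=.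
  by apply: eq_bigr => -[i j] _; rewrite mxE /= vec_mx_delta mxvecE mulmxA.
exact: curry_mxvec_bij.
Qed.

(** Sylvester's identity: one block matrix, multiplied by the same unipotent matrix on either side,
    becomes block triangular in two ways. It reduces the determinant of [1 - 2 e] to a scalar matrix
    of size the rank of e. *)
Lemma det_add1_mulC m n (A : 'M[F]_(m, n)) (B : 'M[F]_(n, m)) :
  \det (1%:M + A *m B) = \det (1%:M + B *m A).
Proof.
have E1 : block_mx 1%:M (- A) B 1%:M *m block_mx 1%:M A 0 1%:M
    = block_mx 1%:M 0 B (1%:M + B *m A).
  by rewrite mulmx_block !(mulmx1, mul1mx, mulmx0, mul0mx, addr0, add0r) subrr addrC.
have E2 : block_mx 1%:M A 0 1%:M *m block_mx 1%:M (- A) B 1%:M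
    = block_mx (1%:M + A *m B) 0 B 1%:M.
  by rewrite mulmx_block !(mulmx1, mul1mx, mulmx0, mul0mx, addr0, add0r) addNr.
have := congr1 determinant E1; have := congr1 determinant E2.
rewrite !det_mulmx !det_lblock !det_ublock !det1 !mul1r !mulr1.
by move=> -> ->.
Qed.

(* A projector onto U computes traces on U even if it does not commute with g. *)
Lemma mxtrace_submod (gT : finGroupType) (G : {group gT}) n
    (rG : mx_representation F G n) (U Pr : 'M[F]_n) (modU : mxmodule rG U) g :
    (Pr <= U)%MS -> U *m Pr = U -> g \in G ->
  \tr (submod_repr modU g) = \tr (Pr *m rG g).
Proof.
move=> PU UP Gg; pose B := val_submod (1%:M : 'M_(\rank U)).
have eB : (B :=: U)%MS by apply: val_submod1.
have freeB : row_free B by rewrite /row_free eB.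
have gB : B *m rG g = submod_repr modU g *m B.
  by rewrite -[RHS]val_submodE -[X in val_submod X]mul1mx val_submodJ.
have [s Es] : exists s, Pr = s *m B by apply/submxP; rewrite eB.
have BP : B *m Pr = B.
  have /submxP[D ->] : (B <= U)%MS by rewrite eB.
  by rewrite -mulmxA UP.
have Bs : B *m s = 1%:M.
  by apply: (row_free_inj freeB); rewrite mul1mx -mulmxA -Es.
by rewrite Es -mulmxA gB mulmxA [RHS]mxtrace_mulC mulmxA Bs mul1mx.
Qed.

End MatrixTrace.

(** * Matrices of finite order *)

Section FiniteOrder.

Variable R : rcfType.

(** The Reynolds projector of the cyclic group generated by h; N may be any positive multiple of the
    order of h. *)
Definition average_pow n (h : 'M[R]_n) N := N%:R^-1 *: \sum_(i < N) h ^+ i.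

Lemma average_powP n (h : 'M[R]_n) N (e := average_pow h N) : (0 < N)%N -> h ^+ N = 1 ->
  [/\ e *m h = e, h *m e = e, e *m e = e & (e == kermx (h - 1))%MS].
Proof.
move=> N0 hN.
have N0' : (N%:R : R) != 0 by rewrite pnatr_eq0 -lt0n.
have shift : \sum_(i < N) h ^+ i.+1 = \sum_(i < N) h ^+ i.
  case: N N0 hN @e N0' => // N _ hN _ _.
  by rewrite big_ord_recr big_ord_recl /= hN expr0 addrC.
have eh : e *m h = e.
  rewrite /e /average_pow -scalemxAl mulmx_suml -[in RHS]shift; congr (_ *: _).
  by apply: eq_bigr => i _; rewrite exprSr.
have he : h *m e = e.
  rewrite /e /average_pow -scalemxAr mulmx_sumr -[in RHS]shift; congr (_ *: _).
  by apply: eq_bigr => i _; rewrite exprS.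
have fixe m (v : 'M_(m, n)) : v *m h = v -> v *m e = v.
  move=> vh; have vhi i : v *m h ^+ i = v.
    elim: i => [|i IH]; first by rewrite expr0 mulmx1.
    by rewrite exprS mulmxA vh.
  rewrite /e /average_pow -scalemxAr mulmx_sumr.
  under eq_bigr do rewrite vhi.
  by rewrite sumr_const card_ord -scaler_nat scalerA mulVf // scale1r.
split=> //; first exact: fixe.
apply/andP; split.
  by apply/sub_kermxP; rewrite mulmxBr eh mulmx1 subrr.
rewrite -[X in (X <= _)%MS](fixe _ (kermx (h - 1))) ?submxMl //.
by apply/eqP; rewrite -subr_eq0 -[X in _ - X]mulmx1 -mulmxBr mulmx_ker.
Qed.

Lemma mxrank_fixed n (h : 'M[R]_n) N : (0 < N)%N -> h ^+ N = 1 ->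
  (\rank (kermx (h - 1)))%:R = N%:R^-1 * \sum_(i < N) \tr (h ^+ i).
Proof.
move=> N0 hN; have [_ _ ee /eqmxP ke] := average_powP N0 hN.
by rewrite -ke -mxtrace_idempotent // mxtraceZ raddf_sum.
Qed.

(** Non-real eigenvalues pair off with modulus one, but they are avoided here: with e the projector
    onto the fixed space, - h is deformed to [1 - 2 e]. The determinant is a polynomial along the
    segment without zeros on it, so by the intermediate value theorem its signs at the ends agree,
    and both end values are 1 or -1. *)
Lemma det_opp_finite_order n (h : 'M[R]_n) N : (0 < N)%N -> h ^+ N = 1 ->
  \det (- h) = (-1) ^+ \rank (kermx (h - 1)).
Proof.
move=> N0 hN; have [] := average_powP N0 hN; move: (average_pow h N) => e eh he ee /eqmxP ke.
(* The doubled exponent makes the sign in - h disappear when N is odd. *)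
have detN : (\det (- h)) ^+ (N + N) = 1.
  have detX m : \det ((- h) ^+ m) = \det (- h) ^+ m.
    by elim: m => [|m IH]; rewrite ?det1 // !exprS det_mulmx IH.
  by rewrite -detX addnn -mul2n exprM sqrrN -exprM mulnC exprM hN expr1n det1.
have det2 : \det (1%:M - 2%:R *: e) = (-1) ^+ \rank e.
  rewrite -[X in 2%:R *: X](mulmx_base e) scalemxAl -scaleN1r scalemxAl det_add1_mulC.
  rewrite -!scalemxAr idempotent_base // -det_scalar; congr (\det _).
  by rewrite scaleN1r scaler_nat mulr2n opprD addrA subrr add0r raddfN.
(* On the complement of the fixed space h has no positive eigenvalue, hence
   the segment from - h to 1 - 2 e avoids singular matrices. *)
pose A (s : R) := s *: (1%:M - e) - (1 - s) *: (h *m (1%:M - e)) - e.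
have A0 : A 0 = - h.
  by rewrite /A scale0r sub0r subr0 scale1r mulmxBr mulmx1 he opprB addrAC subrr add0r.
have A1 : A 1 = 1%:M - 2%:R *: e.
  by rewrite /A subrr scale0r subr0 scale1r scaler_nat mulr2n opprD addrA.
have Aunit s : 0 <= s <= 1 -> \det (A s) != 0.
  move=> /andP[s0 s1]; rewrite -unitfE -[_ \is a _]/(A s \in unitmx) -row_free_unit.
  rewrite -kermx_eq0; apply/rowV0P => v /sub_kermxP vA.
  have e1 : (1%:M - e) *m e = 0 by rewrite mulmxBl mul1mx ee subrr.
  have ve : v *m e = 0.
    have := congr1 (mulmx^~ e) vA; rewrite mul0mx -mulmxA /A !mulmxBl -!scalemxAl.
    by rewrite -mulmxA e1 mulmx0 !scaler0 subr0 sub0r ee mulmxN => /eqP; rewrite oppr_eq0 => /eqP.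
  have vhh : s *: v = (1 - s) *: (v *m h).
    have hE : h *m (1%:M - e) = h - e by rewrite mulmxBr mulmx1 he.
    move: vA; rewrite /A hE mulmxBr ve subr0 mulmxBr -!scalemxAr !mulmxBr mulmx1 ve !subr0.
    by move/eqP; rewrite subr_eq0 => /eqP.
  have vhi i : s ^+ i *: v = (1 - s) ^+ i *: (v *m h ^+ i).
    elim: i => [|i IH]; first by rewrite !expr0 !scale1r mulmx1.
    rewrite exprS -scalerA IH !scalerA mulrC -!scalerA.
    rewrite scalemxAl vhh -scalemxAl !scalerA -mulmxA -[h *m _]/(h * _) -exprS.
    by rewrite -exprSr.
  (* Now s^N v = (1 - s)^N v. As s and 1 - s are nonnegative, a nonzero v forces s = 1 - s; then v
     is fixed by h, so it equals [v *m e], which is 0. *)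
  have := vhi N; rewrite hN mulmx1 => /eqP; rewrite -subr_eq0 -scalerBl scaler_eq0.
  case/orP => [|/eqP //]; rewrite subr_eq0 eqrXn2 ?subr_ge0 // => /eqP s12.
  have s00 : s != 0.
    by apply: contra_eq_neq s12 => ->; rewrite subr0 eq_sym oner_eq0.
  have vh : v *m h = v by apply: (scalerI s00); rewrite vhh -s12.
  suff : v *m e = v by rewrite ve.
  have : (v <= e)%MS by rewrite ke; apply/sub_kermxP; rewrite mulmxBr vh mulmx1 subrr.
  by case/submxP=> D ->; rewrite -mulmxA ee.
pose Ap : 'M[{poly R}]_n := 'X *: map_mx polyC (1%:M - e)
   - (1 - 'X) *: map_mx polyC (h *m (1%:M - e)) - map_mx polyC e.
have ApE s : (\det Ap).[s] = \det (A s).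
  rewrite -[(\det Ap).[s]]/(horner_eval s (\det Ap)) -det_map_mx; congr (\det _).
  by apply/matrixP => i j; rewrite !mxE /= /horner_eval !(hornerD, hornerN, hornerM, hornerX, hornerC).
have pos : 0 < \det (- h) * \det (1%:M - 2%:R *: e).
  rewrite ltNge; apply/negP; rewrite -A0 -A1 -!ApE => le0.
  have [x x01] := polyrcf.poly_ivt ler01 le0.
  by rewrite rootE ApE; apply/negP/Aunit; rewrite in_itv /= in x01.
rewrite -ke -det2.
have [a1|a1] : \det (- h) = 1 \/ \det (- h) = -1.
  have /eqP : `|\det (- h)| ^+ (N + N) = 1 by rewrite -normrX detN normr1.
  rewrite -[X in _ == X](expr1n _ (N + N)) eqrXn2 // ?addn_gt0 ?N0 //.
  rewrite eqr_norml ler01 andbT => /orP[/eqP|/eqP]; by [left | right].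
- move: pos; rewrite a1 mul1r det2 -signr_odd; case: odd => //=.
  by rewrite oppr_gt0 ltr10.
- move: pos; rewrite a1 mulN1r det2 -signr_odd; case: odd => //=.
  by rewrite oppr_gt0 ltr10.
Qed.

End FiniteOrder.

Section ShortExact.

Variables (F : fieldType) (gT : finGroupType) (G : {group gT}).
Local Notation rep := (representation F G).
Implicit Types M N : rep.

Lemma gclass_short_exact M' M M'' :
  short_exact M' M M'' -> gclass M = gclass M' + gclass M''.
Proof.
move=> ex; apply/eqP; rewrite /gclass -raddfD /= -Quotient.idealrBE opprD addrA.
by apply/asboolP => S _; apply.
Qed.

(** A linear splitting suffices, equivariant or not: 1 = s i + q t decomposes the identity, and
    cyclicity of the trace moves the action to the two ends. *)
Lemma mxtrace_short_exact M' M M'' g : short_exact M' M M'' -> g \in G ->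
  \tr (M g) = \tr (M' g) + \tr (M'' g).
Proof.
case=> i [q [iM qM freei fullq /eqmxP ei]] Gg.
have [t tq] := row_fullP fullq.
have [s Es] : exists s, 1%:M - q *m t = s *m i.
  by apply/submxP; rewrite ei; apply/sub_kermxP; rewrite mulmxBl mul1mx -mulmxA tq mulmx1 subrr.
have iq : i *m q = 0 by apply/sub_kermxP; rewrite -ei.
have is1 : i *m s = 1%:M.
  apply: (row_free_inj freei) => /=; rewrite -mulmxA -Es mulmxBr mulmxA iq.
  by rewrite mul0mx subr0 mulmx1 mul1mx.
rewrite -[M g]mulmx1 -(subrK (q *m t) 1%:M) Es mulmxDr mxtraceD; congr (_ + _).
  by rewrite mxtrace_mulC -mulmxA -iM // mxtrace_mulC -mulmxA is1 mulmx1.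
by rewrite mulmxA qM // mxtrace_mulC mulmxA tq mul1mx.
Qed.

Lemma short_exact_submod M (U : 'M_(rdegree M)) (modU : mxmodule M U) :
  short_exact (Representation (submod_repr modU)) M
    (Representation (factmod_repr modU)).
Proof.
exists (val_submod 1%:M), (in_factmod U 1%:M); split.
- by move=> g Gg /=; rewrite -val_submodE -[submod_mx _ _]mul1mx val_submodJ // mul1mx.
- by move=> g Gg /=; rewrite -in_factmodE -in_factmodJ // mul1mx.
- by rewrite /row_free val_submod1.
- have r1 : \rank (U + (1%:M : 'M[F]_(rdegree M)))%MS = rdegree M.
    by apply/eqP; rewrite -[_ == _]/(row_full _) -sub1mx addsmxSr.
  have E := mxrank_in_factmod U (1%:M : 'M[F]_(rdegree M)); rewrite r1 in E.
  by apply/eqP/(@addIn (\rank U)); rewrite E /= mxrank_coker subnK ?rank_leq_row.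
- rewrite val_submod1; apply/andP; split.
    by apply/sub_kermxP/eqP; rewrite -in_factmodE in_factmod_eq0.
  by rewrite val_submod1 -in_factmod_eq0 in_factmodE mulmx_ker.
Qed.

Lemma mulmx_row_block m n (A : 'M[F]_m) (B : 'M[F]_n) :
  A *m row_mx 1%:M 0 = row_mx 1%:M 0 *m block_mx A 0 0 B.
Proof. by rewrite mul_mx_row mul_row_block !(mul1mx, mulmx1, mul0mx, mulmx0, addr0). Qed.

Lemma mulmx_col_block m n (A : 'M[F]_m) (B : 'M[F]_n) :
  block_mx A 0 0 B *m col_mx 0 1%:M = col_mx 0 1%:M *m B.
Proof. by rewrite mul_block_col mul_col_mx !(mul1mx, mulmx1, mul0mx, mulmx0, addr0, add0r). Qed.

Lemma short_exact_dadd M N : short_exact M (dadd_grepr M N) N.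
Proof.
exists (row_mx 1%:M 0), (col_mx 0 1%:M); split.
- by move=> g Gg; apply: mulmx_row_block.
- by move=> g Gg; apply: mulmx_col_block.
- by apply/row_freeP; exists (col_mx 1%:M 0); rewrite mul_row_col mulmx1 mulmx0 addr0.
- by apply/row_fullP; exists (row_mx 0 1%:M); rewrite mul_row_col mulmx1 mulmx0 add0r.
apply/andP; split.
  by apply/sub_kermxP; rewrite mul_row_col mulmx0 mul0mx addr0.
apply/rV_subP => v /sub_kermxP; rewrite -[v]hsubmxK mul_row_col mulmx0 mulmx1 add0r => ->.
by apply/submxP; exists (lsubmx v); rewrite mul_mx_row mulmx1 mulmx0.
Qed.

Lemma gclass_dadd M N : gclass (dadd_grepr M N) = gclass M + gclass N.
Proof. exact/gclass_short_exact/short_exact_dadd. Qed.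

Lemma short_exact_rdegree0 M M' M'' :
  rdegree M = 0 -> rdegree M' = 0 -> rdegree M'' = 0 -> short_exact M' M M''.
Proof.
move=> d0 d1 d2; exists 0, 0; split.
- by move=> g _; rewrite mulmx0 mul0mx.
- by move=> g _; rewrite mulmx0 mul0mx.
- by rewrite /row_free mxrank0 d1.
- by rewrite /row_full mxrank0 d2.
- by rewrite sub0mx; apply/row_subP => i; have := ltn_ord i; rewrite {2}d0.
Qed.

Lemma gclass_rdegree0 M : rdegree M = 0 -> gclass M = 0.
Proof.
move=> d0; have := gclass_short_exact (short_exact_rdegree0 d0 d0 d0).
by move/(congr1 (fun u => u - gclass M)); rewrite addrK subrr.
Qed.

Lemma gclass0 : gclass (@grepr0 F gT G) = 0.
Proof. exact: gclass_rdegree0. Qed.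

Lemma gclass_bigdadd I (r : seq I) (P : pred I) (N : I -> rep) :
  gclass (\big[@dadd_grepr F gT G/@grepr0 F gT G]_(i <- r | P i) N i)
  = \sum_(i <- r | P i) gclass (N i).
Proof. exact: (big_morph _ gclass_dadd gclass0). Qed.

Lemma mxtrace_bigdadd I (r : seq I) (P : pred I) (N : I -> rep) g :
  \tr ((\big[@dadd_grepr F gT G/@grepr0 F gT G]_(i <- r | P i) N i) g)
  = \sum_(i <- r | P i) \tr (N i g).
Proof.
apply: (big_morph (fun M : rep => \tr (M g))) => [M N'|]; last exact: mxtrace1.
exact: mxtrace_block.
Qed.

End ShortExact.

Section CharacterDeterminesClass.

Variables (F : numFieldType) (gT : finGroupType) (G : {group gT}).
Local Notation rep := (representation F G).
Implicit Types M N S : rep.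

Definition average S N (f : 'M[F]_(rdegree S, rdegree N)) :=
  \sum_(g in G) S g^-1%g *m f *m N g.

Lemma average_intertwines S N f : intertwines (@average S N f).
Proof.
move=> h Gh; rewrite mulmx_sumr mulmx_suml (reindex_inj (mulIg h)) /=.
apply: eq_big => [g|g]; rewrite groupMr // => Gg.
by rewrite invMg !repr_mxM ?groupV // !mulmxA -repr_mxM ?groupV // mulgV repr_mx1 mul1mx.
Qed.

Lemma intertwines_average S N f : intertwines f -> @average S N f = #|G|%:R *: f.
Proof.
move=> fM; rewrite /average (eq_bigr (fun=> f)) => [|g Gg].
  by rewrite sumr_const scaler_nat.
by rewrite -mulmxA -fM // mulmxA -repr_mxM ?groupV // mulVg repr_mx1 mul1mx.
Qed.

Lemma intertwiner_exists S N :
  \sum_(g in G) \tr (S g^-1%g) * \tr (N g) != 0 ->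
  exists2 f : 'M_(rdegree S, rdegree N), f != 0 & intertwines f.
Proof.
move=> sn0; have [[i j] nz|z] := pickP (fun ij : 'I_(rdegree S) * 'I_(rdegree N) =>
    @average S N (delta_mx ij.1 ij.2) != 0).
  by exists (@average S N (delta_mx i j)) => //; apply: average_intertwines.
case/eqP: sn0; under eq_bigr do rewrite mxtrace_mulE.
rewrite exchange_big big1 //= => i _; rewrite exchange_big big1 //= => j _.
have /negbFE/eqP/matrixP/(_ i j) := z (i, j).
by rewrite /average summxE => ->; rewrite mxE.
Qed.

(** Averaging is an idempotent E on the matrices from S to M, with the intertwiners as image. Its
    trace is its rank, nonzero because of i, and also the pairing of the characters divided by the
    order of G. *)
Lemma sum_mxtrace_neq0 S M (i : 'M_(rdegree S, rdegree M)) :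
  i != 0 -> intertwines i -> \sum_(g in G) \tr (S g^-1%g) * \tr (M g) != 0.
Proof.
move=> i0 iM; have G0 : (#|G|%:R : F) != 0 by rewrite pnatr_eq0 -lt0n cardG_gt0.
pose E := #|G|%:R^-1 *: \sum_(g in G) lin_mx (mulmx (S g^-1%g) \o mulmxr (M g)).
have EE f : mxvec f *m E = mxvec (#|G|%:R^-1 *: @average S M f).
  rewrite /E /average -scalemxAr mulmx_sumr [RHS]linearZ [in RHS]linear_sum /=; congr (_ *: _).
  by apply: eq_bigr => g _; rewrite mul_vec_lin /= mulmxA.
have idE : E *m E = E.
  apply/row_matrixP => k; rewrite row_mul rowE -[delta_mx 0 k]vec_mxK !EE; congr mxvec.
  rewrite [X in _ *: X]intertwines_average ?scalerA ?mulVf ?mul1r // => g Gg.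
  by rewrite -scalemxAr -scalemxAl average_intertwines.
have : \tr E != 0.
  rewrite mxtrace_idempotent // pnatr_eq0 mxrank_eq0; apply: contraNneq i0 => E0.
  have := EE i; rewrite E0 mulmx0 intertwines_average // scalerA mulVf // scale1r.
  by move/esym/eqP; rewrite mxvec_eq0.
rewrite mxtraceZ mulf_eq0 invr_eq0 (negPf G0) /= raddf_sum /=.
by under eq_bigr do rewrite mxtrace_lin_mulmx.
Qed.

Lemma gclass_iso M N (f : 'M_(rdegree M, rdegree N)) :
  intertwines f -> row_free f -> row_full f -> gclass M = gclass N.
Proof.
move=> fM freef fullf; rewrite (@gclass_short_exact _ _ _ (@grepr0 F gT G) M N).
  by rewrite gclass0 add0r.
exists 0, f; split=> //; first by move=> g _; rewrite mulmx0 mul0mx.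
  by rewrite /row_free mxrank0.
by rewrite (eqP (etrans (kermx_eq0 f) freef)) -!mxrank_leqif_eq ?sub0mx // !mxrank0.
Qed.

(** Induction on the degree. A simple submodule of M pairs nontrivially with M, hence with N, hence
    maps nontrivially to N; by simplicity this map is injective, and the two quotients again have
    equal characters. *)
Lemma gclass_eq_mxtrace M N :
  {in G, forall g, \tr (M g) = \tr (N g)} -> gclass M = gclass N.
Proof.
have [n] := ubnP (rdegree M); elim: n M N => // n IH M N ltn trMN.
have degMN : rdegree M = rdegree N.
  apply/eqP; rewrite -(eqr_nat F) -(mxtrace1 F (rdegree M)) -(mxtrace1 F (rdegree N)).
  by rewrite -(repr_mx1 M) -(repr_mx1 N) trMN.
have [d0|dpos] := posnP (rdegree M).
  by rewrite !gclass_rdegree0 // -degMN.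
have [U simU] : exists U, mxsimple M U.
  have n1 : (1%:M : 'M[F]_(rdegree M)) != 0 by rewrite -mxrank_eq0 mxrank1 -lt0n.
  apply/asboolP; apply: (mxsimple_exists (mxmodule1 M) n1) => -[U simU _].
  by apply/asboolP; exists U.
have [modU U0 minU] := simU; pose S := Representation (submod_repr modU).
have exM := short_exact_submod modU.
have S_M : val_submod (1%:M : 'M_(\rank U)) != 0.
  by rewrite -mxrank_eq0 val_submod1 mxrank_eq0.
have iM : @intertwines _ _ _ S M (val_submod 1%:M).
  by move=> g Gg /=; rewrite -val_submodE -[submod_mx _ _]mul1mx val_submodJ // mul1mx.
have [f f0 fM] : exists2 f : 'M_(rdegree S, rdegree N), f != 0 & intertwines f.
  apply: intertwiner_exists.
  have := @sum_mxtrace_neq0 S M _ S_M iM.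
  by under eq_bigr do rewrite trMN //.
have freef : row_free f.
  pose K : 'M_(rdegree M) := <<val_submod (kermx f)>>%MS.
  have modK : mxmodule M K.
    apply/mxmoduleP => g Gg; rewrite (eqmxMr _ (genmxE _)) genmxE -(val_submodJ modU) // val_submodS.
    by apply/sub_kermxP; rewrite -mulmxA (fM g Gg) mulmxA mulmx_ker mul0mx.
  rewrite -kermx_eq0 -val_submod_eq0; apply: contraNT f0 => K0.
  have : (U <= K)%MS by apply: minU => //; rewrite ?genmxE ?val_submodP // -submx0 genmxE submx0.
  rewrite -{1}(val_submod1 U) genmxE val_submodS => /sub_kermxP.
  by rewrite mul1mx => ->.
have modV : mxmodule N <<f>>%MS.
  by apply/mxmoduleP => g Gg; rewrite (eqmxMr _ (genmxE _)) genmxE -fM // submxMl.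
have exN := short_exact_submod modV.
pose h := in_submod <<f>>%MS f.
have sf : (f <= <<f>>)%MS by rewrite genmxE.
have hK : val_submod h = f by rewrite in_submodK.
have hM : @intertwines _ _ _ S (Representation (submod_repr modV)) h.
  by move=> g Gg /=; rewrite -in_submodJ // -fM // in_submodE mulmxA -in_submodE.
have rkh : \rank h = \rank U.
  by rewrite -(mxrankMfree h (_ : row_free (val_submod 1%:M))) -?val_submodE ?hK ?(eqP freef) // /row_free val_submod1.
have rkV : \rank <<f>>%MS = \rank U by rewrite genmxE (eqP freef).
have clS : gclass S = gclass (Representation (submod_repr modV)).
  by apply: (gclass_iso hM); rewrite /row_free /row_full rkh //; apply/eqP/esym.
rewrite (gclass_short_exact exM) (gclass_short_exact exN) -/S clS; congr (_ + _).
apply: IH => [|g Gg] /=.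
  have := mxrank_coker U; rewrite /= => ->; rewrite -ltnS (leq_trans _ ltn) // ltnS.
  by rewrite -subSn ?rank_leq_row // leq_subLR -add1n leq_add2r lt0n mxrank_eq0.
have := trMN g Gg; rewrite (mxtrace_short_exact exM Gg) (mxtrace_short_exact exN Gg).
have -> : \tr (submod_repr modV g) = \tr (S g).
  have [u uh] : exists u, u *m h = 1%:M.
    by apply/row_fullP; apply/eqP; rewrite rkh.
  have hu : h *m u = 1%:M.
    by apply: (@row_free_inj _ _ _ _ h); rewrite /= ?/row_free ?rkh // -mulmxA uh mulmx1 mul1mx.
  by rewrite -[submod_repr modV g]mul1mx -uh -mulmxA -hM // mxtrace_mulC -mulmxA hu mulmx1.
by move/addrI.
Qed.

End CharacterDeterminesClass.

(** * Order complexes of posets *)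

Section OrderComplex.

Variables (R : numDomainType) (T : finType) (lt : rel T).
Hypotheses (lt_irr : irreflexive lt) (lt_trans : transitive lt).
Implicit Types (s t S : {set T}) (f g : {set T} -> R) (x y z : T).

Definition comparable_elts x y := [|| x == y, lt x y | lt y x].

Definition is_chain s := [forall x in s, forall y in s, comparable_elts x y].

Definition chains S k := [set s : {set T} | [&& #|s| == k, s \subset S & is_chain s]].

Definition position s x := #|[set z in s | lt z x]|.

Definition sgn_position x s : R := (-1) ^+ position s x.

(** Cochains are functions on all subsets, of which only the values on chains matter; the same
    function can thus be restricted to S or to a link without changing type. *)
Definition coboundary_fun f t : R := \sum_(x in t) sgn_position x t * f (t :\ x).

(* The index k counts vertices: k = 0 is the empty simplex of reduced cohomology. *)
Definition acyclic S k := forall f,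
  {in chains S k.+1, forall t, coboundary_fun f t = 0} ->
  exists g, {in chains S k, forall t, f t = coboundary_fun g t}.

Definition acyclic_below S n := forall k, (k < n)%N -> acyclic S k.

Definition link S x := [set y in S | lt x y || lt y x].

Lemma comparable_eltsC x y : comparable_elts x y = comparable_elts y x.
Proof. by rewrite /comparable_elts eq_sym [lt x y || _]orbC. Qed.

Lemma is_chainP s : reflect {in s &, forall x y, comparable_elts x y} (is_chain s).
Proof.
apply: (iffP forall_inP) => [h x y sx sy|h x sx]; first exact: (forall_inP (h x sx)).
by apply/forall_inP => y sy; apply: h.
Qed.

Lemma is_chainS s t : s \subset t -> is_chain t -> is_chain s.
Proof. by move=> /subsetP st /is_chainP h; apply/is_chainP => x y /st tx /st; apply: h. Qed.

Lemma lt_asym x y : lt x y -> lt y x = false.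
Proof. by move=> xy; apply/negP => /(lt_trans xy); rewrite lt_irr. Qed.

Lemma chain_compare s x y : is_chain s -> x \in s -> y \in s -> x != y ->
  lt x y = ~~ lt y x.
Proof.
move=> /is_chainP h sx sy xy; have := h _ _ sx sy; rewrite /comparable_elts (negPf xy) /=.
by case/orP => h'; rewrite h' ?(lt_asym h').
Qed.

Lemma positionU1 s x y : x \notin s -> position (x |: s) y = (lt x y + position s y)%N.
Proof.
move=> sx; rewrite /position; case: (boolP (lt x y)) => xy.
  rewrite -(_ : x |: [set z in s | lt z y] = [set z in x |: s | lt z y]).
    by rewrite cardsU1 inE (negPf sx).
  by apply/setP => z; rewrite !inE; case: eqP => [->|].
rewrite add0n; apply: eq_card => z; rewrite !inE.
by case: eqP => [->|] //=; rewrite (negPf xy) andbF.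
Qed.

Lemma positionU1_self s x : x \notin s -> position (x |: s) x = position s x.
Proof. by move=> sx; rewrite positionU1 // lt_irr. Qed.

(** Of x and y exactly one precedes the other: either inserting x shifts y, or deleting y shifts x,
    never both. This is the origin of the minus sign. *)
Lemma sgn_positionU1 s x y : is_chain (x |: s) -> x \notin s -> y \in s ->
  sgn_position y (x |: s) = - (sgn_position x s * sgn_position x (s :\ y)) * sgn_position y s.
Proof.
move=> ch sx sy; rewrite /sgn_position positionU1 //.
have xy : x != y by apply: contraNneq sx => ->.
have -> : position s x = (lt y x + position (s :\ y) x)%N.
  by rewrite -{1}(setD1K sy) positionU1 // !inE eqxx.
rewrite (chain_compare ch _ _ xy) ?setU11 ?setU1r // !exprD; congr (_ * _).
rewrite -[X in _ = - X]mulrA -expr2 sqrr_sign mulr1.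
by case: (lt y x); rewrite /= ?expr0 ?expr1 ?opprK.
Qed.

Definition rest x f s : R := sgn_position x s * f (x |: s).

(** Separates the term that deletes x from those that keep it, the latter through the contraction
    [rest x f]. The vanishing of the squared coboundary, the cone homotopy and the gluing along a
    link all get their signs from this recursion. *)
Lemma coboundaryU1 f s x : is_chain (x |: s) -> x \notin s ->
  coboundary_fun f (x |: s) = sgn_position x s * (f s - coboundary_fun (rest x f) s).
Proof.
move=> ch sx; rewrite /coboundary_fun big_setU1 //= setU1K //.
rewrite {1}/sgn_position positionU1_self // mulrBr; congr (_ + _).
rewrite -mulrN -sumrN big_distrr /=; apply: eq_bigr => y sy.
rewrite sgn_positionU1 // /rest !mulNr mulrN; congr (- _).
have -> : (x |: s) :\ y = x |: (s :\ y).
  have xy : x != y by apply: contraNneq sx => ->.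
  by apply/setP => z; rewrite !inE; case: (eqVneq z x) => [->|]; rewrite ?xy ?orbF.
by rewrite -!mulrA; congr (_ * _); rewrite mulrCA.
Qed.

Lemma coboundary_eq f g t : {in t, forall x, f (t :\ x) = g (t :\ x)} ->
  coboundary_fun f t = coboundary_fun g t.
Proof. by move=> fg; apply: eq_bigr => x tx; rewrite fg. Qed.

Lemma coboundaryB f g t :
  coboundary_fun (fun s => f s - g s) t = coboundary_fun f t - coboundary_fun g t.
Proof. by rewrite /coboundary_fun -sumrB; apply: eq_bigr => x _; rewrite mulrBr. Qed.

Lemma coboundaryD f g t :
  coboundary_fun (fun s => f s + g s) t = coboundary_fun f t + coboundary_fun g t.
Proof. by rewrite /coboundary_fun -big_split; apply: eq_bigr => x _; rewrite /= mulrDr. Qed.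

Lemma coboundary0 t : coboundary_fun (fun=> 0) t = 0.
Proof. by rewrite /coboundary_fun big1 // => x _; rewrite mulr0. Qed.

Lemma coboundaryN f t : coboundary_fun (fun s => - f s) t = - coboundary_fun f t.
Proof. by rewrite /coboundary_fun -sumrN; apply: eq_bigr => x _; rewrite mulrN. Qed.

Lemma sgn_position_sq x s : sgn_position x s * sgn_position x s = 1.
Proof. by rewrite -expr2 sqrr_sign. Qed.

Lemma coboundary_coboundary f t : is_chain t -> coboundary_fun (coboundary_fun f) t = 0.
Proof.
have [n] := ubnP #|t|; elim: n t f => // n IH t f; rewrite ltnS => tn ch.
have [->|/set0Pn[x tx]] := eqVneq t set0; first by rewrite /coboundary_fun big_set0.
rewrite -(setD1K tx) in ch *; set s := t :\ x in ch *.
have sx : x \notin s by rewrite !inE eqxx.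
rewrite coboundaryU1 //; apply/eqP; rewrite mulf_eq0; apply/orP; right.
have chs : is_chain s by apply: is_chainS ch; apply: subsetU1.
rewrite (@coboundary_eq (rest x (coboundary_fun f))
  (fun u => f u - coboundary_fun (rest x f) u)) => [|y sy].
  rewrite coboundaryB opprB addrCA subrr addr0 IH //.
  by apply: leq_trans tn; rewrite [X in (_ < X)%N](cardsD1 x) tx.
rewrite /rest coboundaryU1 ?mulrA ?sgn_position_sq ?mul1r //.
  by apply: is_chainS ch; apply: setUS; apply: subD1set.
by apply: contra sx; rewrite inE => /andP[].
Qed.

Lemma chainsP S k t :
  reflect [/\ #|t| = k, t \subset S & is_chain t] (t \in chains S k).
Proof. by rewrite inE; apply: (iffP and3P) => [[/eqP]|[/eqP]]. Qed.

(** On [a |: t] the cocycle condition says exactly that f and the coboundary of [rest a f] agree at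
    t, so contraction with the apex is a homotopy; the value 0 on chains through a makes the formula
    hold there too. *)
Lemma acyclic_cone S a k :
  a \in S -> {in S, forall x, comparable_elts a x} -> acyclic S k.
Proof.
move=> Sa cmp f fcc; exists (fun t => if a \in t then 0 else rest a f t) => t /chainsP[tk tS ch].
have [ta|ta] := boolP (a \in t).
  rewrite -(setD1K ta) in ch *; set s := t :\ a in ch *.
  have sa : a \notin s by rewrite !inE eqxx.
  rewrite coboundaryU1 // (negPf sa) (@coboundary_eq _ (fun=> 0)) => [|x sx].
    by rewrite coboundary0 subr0 mulrA sgn_position_sq mul1r.
  by rewrite /rest setU11 mulr0.
have chU : is_chain (a |: t).
  apply/is_chainP => x y /setU1P[->|tx] /setU1P[->|ty].
  - by rewrite /comparable_elts eqxx.
  - exact/cmp/(subsetP tS).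
  - by rewrite comparable_eltsC; apply/cmp/(subsetP tS).
  - exact: (is_chainP _ ch).
rewrite (@coboundary_eq _ (rest a f)) => [|x tx]; last by rewrite !inE (negPf ta) andbF.
have := fcc (a |: t); rewrite coboundaryU1 // => h.
have : sgn_position a t * (f t - coboundary_fun (rest a f) t) == 0.
  apply/eqP/h/chainsP; split=> //; first by rewrite cardsU1 ta tk.
  by rewrite subUset sub1set Sa.
by rewrite mulf_eq0 signr_eq0 subr_eq0 => /eqP.
Qed.

Lemma acyclic_setU1_0 S x : acyclic S 0 -> acyclic (x |: S) 0.
Proof.
move=> acS f fcc; have [|g Hg] := acS f.
  move=> t /chainsP[tk tS ch]; apply: fcc; apply/chainsP; split=> //.
  exact: subset_trans tS (subsetU1 _ _).
exists g => t /chainsP[/cards0_eq-> _ ch]; apply: Hg; apply/chainsP.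
by rewrite cards0 sub0set.
Qed.

Lemma chain_link S x s : is_chain (x |: s) -> x \notin s -> s \subset x |: S -> s \subset link S x.
Proof.
move=> ch sx sS; apply/subsetP => y sy; rewrite inE.
have xy : y != x by apply: contraNneq sx => <-.
have := subsetP sS y sy; rewrite !inE (negPf xy) /= => -> /=.
by rewrite (chain_compare ch _ _ xy) ?setU11 ?setU1r // orbN.
Qed.

Lemma link_chain S x s : s \subset link S x -> is_chain s -> is_chain (x |: s).
Proof.
move=> /subsetP sl /is_chainP ch; apply/is_chainP => y z /setU1P[->|sy] /setU1P[->|sz].
- by rewrite /comparable_elts eqxx.
- by have := sl z sz; rewrite /comparable_elts !inE => /andP[_ ->]; rewrite orbT.
- by have := sl y sy; rewrite /comparable_elts !inE orbC => /andP[_]; rewrite orbC => ->; rewrite orbT.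
- exact: ch.
Qed.

(** Mayer-Vietoris by hand: [x |: S] is S with a cone over the link of x attached. Subtracting a
    primitive found on S, extended by 0, leaves a cocycle supported on chains through x, whose
    contraction is a cocycle of one degree less on the link. *)
Lemma acyclic_setU1 S x k : x \notin S ->
  acyclic S k.+1 -> acyclic (link S x) k -> acyclic (x |: S) k.+1.
Proof.
move=> Sx acS acL f fcc.
have subU s : s \subset S -> s \subset x |: S by move/subset_trans; apply; apply: subsetU1.
have notin s : s \subset S -> x \notin s by move/subsetP=> sS; apply: contra Sx; apply: sS.
have [|g0 Hg0] := acS f.
  by move=> t /chainsP[tk tS ch]; apply/fcc/chainsP; split=> //; apply: subU.
pose g0' s := if x \in s then 0 else g0 s.
pose f1 s := f s - coboundary_fun g0' s.
have f1S t : t \in chains S k.+1 -> f1 t = 0.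
  move=> tc; have /chainsP[tk tS ch] := tc; rewrite /f1 Hg0 //; apply/eqP; rewrite subr_eq0; apply/eqP.
  by apply: coboundary_eq => y ty; rewrite /g0' !inE (negPf (notin _ tS)) andbF.
have f1c t : t \in chains (x |: S) k.+2 -> coboundary_fun f1 t = 0.
  move=> tc; have /chainsP[tk tS ch] := tc.
  by rewrite coboundaryB fcc // coboundary_coboundary // subrr.
have linkS s : s \subset link S x -> s \subset S.
  by move/subset_trans; apply; apply/subsetP => y; rewrite inE => /andP[].
have [|g1 Hg1] := acL (rest x f1).
  move=> s /chainsP[sk sL ch].
  have sS := linkS _ sL; have sx := notin _ sS.
  have chU := link_chain sL ch.
  have : coboundary_fun f1 (x |: s) = 0.
    apply/f1c/chainsP; split=> //; first by rewrite cardsU1 sx sk.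
    by rewrite setUS.
  rewrite coboundaryU1 // f1S; last exact/chainsP.
  by move/eqP; rewrite mulf_eq0 signr_eq0 sub0r oppr_eq0 => /eqP.
(* Chosen so that [rest x g1'] is - g1, which [coboundaryU1] then subtracts. *)
pose g1' t := if x \in t then - (sgn_position x (t :\ x) * g1 (t :\ x)) else 0.
exists (fun s => g0' s + g1' s) => t /chainsP[tk tS ch].
suff E : f1 t = coboundary_fun g1' t by rewrite coboundaryD -E /f1 addrC subrK.
have [tx|tx] := boolP (x \in t); last first.
  rewrite f1S; last first.
    apply/chainsP; split=> //; apply/subsetP => y ty; have := subsetP tS y ty.
    by case/setU1P => // yx; rewrite -yx ty in tx.
  by rewrite (@coboundary_eq _ (fun=> 0)) ?coboundary0 // => y ty; rewrite /g1' !inE (negPf tx) andbF.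
rewrite -(setD1K tx) in ch tk tS *; set s := t :\ x in ch tk tS *.
have sx : x \notin s by rewrite !inE eqxx.
have sxS : s \subset x |: S by apply: subset_trans tS; apply: subsetU1.
have sL := chain_link ch sx sxS.
rewrite coboundaryU1 // {1}/g1' (negPf sx) sub0r.
rewrite (@coboundary_eq _ (fun s => - g1 s)) => [|y sy].
  rewrite coboundaryN opprK -Hg1.
    by rewrite /rest mulrA sgn_position_sq mul1r.
  apply/chainsP; split=> //; last by apply: is_chainS ch; apply: subsetU1.
  by apply/eqP; rewrite -eqSS -tk cardsU1 sx.
rewrite /rest /g1' setU11 setU1K; last by apply: contra sx; rewrite inE => /andP[].
by rewrite mulrN mulrA sgn_position_sq mul1r.
Qed.

Lemma acyclic_below_setU1 S x n : x \notin S ->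
  acyclic_below S n -> acyclic_below (link S x) n.-1 -> acyclic_below (x |: S) n.
Proof.
move=> Sx acS acL [|k] kn; first exact/acyclic_setU1_0/acS.
by apply: acyclic_setU1 => //; [apply: acS | apply: acL; move: kn; case: (n)].
Qed.

(** Elements outside B are removed by increasing r, hence glued back by decreasing r: when x is
    attached, everything present outside B has rank at least [r x]. Passing to the link costs one
    degree. *)
Lemma acyclic_below_extend (r : T -> nat) (B S : {set T}) n : B \subset S ->
  acyclic_below B n ->
  (forall x (S' : {set T}), x \in S :\: B -> B \subset S' -> S' \subset S :\ x ->
    {in S' :\: B, forall y, r x <= r y}%N -> acyclic_below (link S' x) n.-1) ->
  acyclic_below S n.
Proof.
move=> BS acB; have [m] := ubnP #|S :\: B|; elim: m S BS => // m IH S BS; rewrite ltnS => mS acL.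
have [e|/set0Pn[x0 Sx0]] := eqVneq (S :\: B) set0.
  suff -> : S = B by [].
  by apply/eqP; rewrite eqEsubset BS andbT -setD_eq0 e.
case: (@arg_minnP _ x0 (mem (S :\: B)) r) => //= x Sx minx.
have [Bx xS] : x \notin B /\ x \in S by move: Sx; rewrite inE => /andP.
have BS' : B \subset S :\ x by rewrite subsetD1 BS.
rewrite -(setD1K xS); apply: acyclic_below_setU1; first by rewrite !inE eqxx.
  apply: IH => //.
    apply: leq_trans mS; rewrite [X in (_ < X)%N](cardsD1 x) Sx add1n ltnS.
    apply: subset_leq_card; apply/subsetP => y; rewrite !inE.
    by case/and3P=> -> -> ->.
  move=> y S'; rewrite !inE => /and3P[By yx Sy] BS'' S'S min; apply: acL => //.
    by rewrite !inE By.
  apply: subset_trans S'S _; apply/subsetP => z; rewrite !inE.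
  by case/and3P=> -> _ ->.
apply: acL => // y; rewrite !inE => /and3P[By _ Sy]; apply: minx.
by rewrite /= !inE By.
Qed.

End OrderComplex.

Section ConstructionTraces.

Variables (F : fieldType) (gT : finGroupType).

Lemma mxtrace_kernel_image (G : {group gT}) (M N : representation F G)
    (f : 'M_(rdegree M, rdegree N)) (modK : mxmodule M (kermx f))
    (modI : mxmodule N <<f>>%MS) g :
    intertwines f -> g \in G ->
  \tr (M g) = \tr (submod_repr modK g) + \tr (submod_repr modI g).
Proof.
move=> fM Gg; have sf : (f <= <<f>>)%MS by rewrite genmxE.
apply: (@mxtrace_short_exact _ _ _ (Representation (submod_repr modK)) M
  (Representation (submod_repr modI))) => //.
exists (val_submod 1%:M), (in_submod <<f>>%MS f); split.
- by move=> h Gh /=; rewrite -val_submodE -[submod_mx _ _]mul1mx val_submodJ // mul1mx.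
- by move=> h Gh /=; rewrite -in_submodJ // -fM // in_submodE mulmxA -in_submodE.
- by rewrite /row_free val_submod1.
- by apply/eqP; rewrite /= mxrank_in_submod // genmxE.
apply/andP; split.
  rewrite val_submod1; apply/sub_kermxP; rewrite in_submodE mulmxA mulmx_ker mul0mx //.
rewrite val_submod1; apply/sub_kermxP; rewrite -[f in _ *m f](in_submodK sf).
by rewrite val_submodE mulmxA mulmx_ker mul0mx.
Qed.

Lemma mxtrace_subquotient (G : {group gT}) n (rG : mx_representation F G n)
    (B Z : 'M_n) (modB : mxmodule rG B) (modZ : mxmodule rG Z) g :
    (B <= Z)%MS -> g \in G ->
  \tr (submod_repr modZ g) = \tr (submod_repr modB g) + \tr (subquotient_repr modB modZ g).
Proof.
move=> BZ Gg; pose vB := val_submod (1%:M : 'M_(\rank B)).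
pose vZ := val_submod (1%:M : 'M_(\rank Z)).
have vBZ : (vB <= Z)%MS by rewrite val_submod1.
pose V := <<in_factmod B Z>>%MS.
have fV : (in_factmod B vZ <= V)%MS by rewrite genmxE submxMr // val_submod1.
apply: (@mxtrace_short_exact _ _ _ (Representation (submod_repr modB))
  (Representation (submod_repr modZ)) (Representation (subquotient_repr modB modZ))) => //.
have rkq : \rank (in_submod V (in_factmod B vZ)) = \rank V.
  by rewrite mxrank_in_submod // genmxE in_factmodE (eqmxMr _ (val_submod1 Z)) -in_factmodE.
exists (in_submod Z vB), (in_submod V (in_factmod B vZ)); split.
- move=> h Gh /=; rewrite -in_submodJ // [vB *m _](_ : _ = submod_mx modB h *m vB).
    by rewrite [RHS]in_submodE -mulmxA -in_submodE.
  by rewrite -val_submodE -[submod_mx _ _ in RHS]mul1mx val_submodJ.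
- move=> h Gh /=; rewrite -in_submodJ // -in_factmodJ // [vZ *m _](_ : _ = submod_mx modZ h *m vZ).
    rewrite [LHS](_ : _ = submod_mx modZ h *m (in_factmod B vZ *m in_submod V 1%:M)).
      by rewrite [RHS]in_submodE mulmxA; congr (_ *m _); apply: mulmxA.
    by rewrite -in_submodE.
  by rewrite -val_submodE -[submod_mx _ _ in RHS]mul1mx val_submodJ.
- by rewrite /row_free mxrank_in_submod // val_submod1.
- by apply/eqP; rewrite rkq.
have sK : (in_submod Z vB <= kermx (in_submod V (in_factmod B vZ)))%MS.
  apply/sub_kermxP; rewrite [in_submod V _]in_submodE mulmxA.
  rewrite [X in X *m _](_ : _ = in_factmod B (in_submod Z vB *m vZ)); last exact: mulmxA.
  rewrite -val_submodE in_submodK // [in_factmod B vB](_ : _ = 0) ?mul0mx //.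
  by apply/eqP; rewrite in_factmod_eq0 val_submod1.
rewrite -(mxrank_leqif_eq sK) mxrank_ker rkq mxrank_in_submod // val_submod1.
rewrite genmxE /= -[X in (X - _)%N](_ : \rank (B + Z)%MS = _); last first.
  by apply: eqmx_rank; rewrite addsmx_sub BZ submx_refl addsmxSr.
by rewrite -mxrank_in_factmod addKn.
Qed.

Lemma mxtrace_perm_repr (D G : {group gT}) (T : finType) (to : action D T) (S : {set T})
    (actS : [acts G, on S | to]%g) g :
  \tr (perm_repr F actS g) = #|[set x in S | to x g == x]|%:R.
Proof.
rewrite /mxtrace; under eq_bigr do rewrite mxE eq_sym.
transitivity (\sum_(x in S) (to x g == x)%:R : F); first by rewrite [RHS]big_enum_val.
rewrite -sum1_card natr_sum.
under [LHS]eq_bigr do rewrite mulrb.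
by rewrite -big_mkcondr /=; apply: eq_bigl => x; rewrite inE.
Qed.

Lemma mxtrace_ind_grepr (G H : {group gT}) (sHG : H \subset G) (M : representation F H) g :
  \tr (ind_grepr sHG M g)
  = \sum_(C in rcosets H G | C == (C :* g)%g) \tr (M (repr C * g * (repr C)^-1)%g).
Proof.
rewrite /mxtrace /=; under eq_bigr do rewrite mxE /=.
transitivity (\sum_(ca : ind_index G M)
  if enum_val ca.1 == (enum_val ca.1 :* g)%g
  then M (repr (enum_val ca.1) * g * (repr (enum_val ca.1))^-1)%g ca.2 ca.2 else 0).
  by rewrite [RHS](reindex (@enum_val (ind_index G M) predT)) //; apply: onW_bij; apply: enum_val_bij.
transitivity (\sum_(c < #|rcosets H G|) \sum_(a < rdegree M)
  if enum_val c == (enum_val c :* g)%g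
  then M (repr (enum_val c) * g * (repr (enum_val c))^-1)%g a a else 0).
  by rewrite pair_big.
rewrite [RHS]big_mkcondr [RHS]big_enum_val; apply: eq_bigr => c _.
by case: ifP => // _; rewrite big1.
Qed.

Lemma mxtrace_tensor_power (G : {group gT}) (M : representation F G) k g :
  \tr (tensor_power M k g) = \tr (M g) ^+ k.
Proof. by elim: k => [|k IH]; rewrite ?mxtrace1 //= mxtrace_prod IH exprS. Qed.

End ConstructionTraces.

(** * Cohomology of intervals of flats *)

Section Flats.

Variables (R : realType) (d : nat) (A : arrangement R d).
Local Notation V := 'rV[R]_d.
Implicit Types (X Y Z : flat A) (v : V).

Lemma mem_bigcapv (I : finType) (P : pred I) (U : I -> {vspace V}) v :
  reflect (forall i, P i -> v \in U i) (v \in (\bigcap_(i | P i) U i)%VS).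
Proof.
rewrite memvE; apply: (iffP subv_bigcapP) => h i Pi; first by rewrite memvE h.
by rewrite -memvE h.
Qed.

Lemma flat_of_set (B : {set A}) : (\bigcap_(H in B) val H)%VS \in flats A.
Proof. by apply/imageP; exists B. Qed.

Lemma flat_eqP X : {B : {set A} | val X = (\bigcap_(H in B) val H)%VS}.
Proof.
have /imageP/cid2[B _ ->] := valP X.
by exists B.
Qed.

Lemma flat_cap_mem X Y : (val X :&: val Y)%VS \in flats A.
Proof.
have [B ->] := flat_eqP X; have [C ->] := flat_eqP Y.
suff -> : (\bigcap_(H in B) val H :&: \bigcap_(H in C) val H)%VS
   = (\bigcap_(H in B :|: C) val H)%VS by apply: flat_of_set.
apply/vspaceP => v; rewrite memv_cap; apply/andP/mem_bigcapv.
  by move=> [/mem_bigcapv hB /mem_bigcapv hC] H /setUP[/hB|/hC].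
by move=> h; split; apply/mem_bigcapv => H HB; apply: h; rewrite inE HB ?orbT.
Qed.

Definition flat_cap X Y : flat A := SeqSub (flat_cap_mem X Y).

Lemma fullv_flat : (fullv : {vspace V}) \in flats A.
Proof.
suff -> : fullv = (\bigcap_(H in (set0 : {set A})) val H)%VS by apply: flat_of_set.
by rewrite big_set0.
Qed.

Definition flat_full : flat A := SeqSub fullv_flat.

Lemma hyperplane_flat (H : A) : val H \in flats A.
Proof.
suff -> : val H = (\bigcap_(K in [set H]) val K)%VS by apply: flat_of_set.
by rewrite big_set1.
Qed.

Definition flat_hyperplane (H : A) : flat A := SeqSub (hyperplane_flat H).

Lemma flat_lt_irr : irreflexive (@flat_lt R d A).
Proof. by move=> X; rewrite /flat_lt eqxx andbF. Qed.

Lemma flat_lt_dim X Y : flat_lt X Y -> (\dim (val Y) < \dim (val X))%N.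
Proof.
case/andP=> YX nYX; rewrite ltn_neqAle dimvS // andbT.
by apply: contra nYX => e; rewrite -val_eqE -(eq_leqif (dimv_leqif_eq YX)) e.
Qed.

Lemma flat_ltE X Y : flat_lt X Y = (val Y <= val X)%VS && (\dim (val Y) < \dim (val X))%N.
Proof.
apply/idP/andP => [h|[h1 h2]]; first by rewrite flat_lt_dim //; case/andP: h.
by rewrite /flat_lt h1; apply: contraTneq h2 => ->; rewrite ltnn.
Qed.

Lemma flat_lt_trans : transitive (@flat_lt R d A).
Proof.
move=> Y X Z; rewrite !flat_ltE => /andP[YX dYX] /andP[ZY dZY].
by rewrite (subv_trans ZY YX) (ltn_trans dZY dYX).
Qed.

Lemma dim_flat_full : \dim (val flat_full) = d.
Proof. by rewrite /= dimvf /dim /= mul1n. Qed.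

Lemma dim_flat_le X : (\dim (val X) <= d)%N.
Proof. by rewrite -[X in (_ <= X)%N]dim_flat_full dimvS // subvf. Qed.

Lemma in_interval X Y : (Y \in Defs.interval X) =
  [&& (val X <= val Y)%VS, (\dim (val X) < \dim (val Y))%N & (\dim (val Y) < d)%N].
Proof.
rewrite inE flat_ltE -andbA; congr [&& _, _ & _].
by rewrite ltn_neqAle dim_flat_le andbT -(eq_leqif (dimv_leqif_eq (subvf (val Y)))) dim_flat_full.
Qed.

Lemma dim_cap_hyperplane (U : {vspace V}) (H : A) : (\dim U <= (\dim (U :&: val H)%VS).+1)%N.
Proof.
have := dimv_sum_cap U (val H); have := hyperplanes_codim1 (valP H) => dH.
have : (\dim (U + val H)%VS <= d)%N.
  by rewrite -[X in (_ <= X)%N]dim_flat_full dimvS // subvf.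
by move: dH; move: (\dim _) (\dim _) (\dim _) (\dim _) => a b c e; lia.
Qed.

Lemma flat_in_hyperplane X : (\dim (val X) < d)%N -> exists H : A, (val X <= val H)%VS.
Proof.
have [B eB] := flat_eqP X; have [B0|/set0Pn[H BH] _] := eqVneq B set0.
  by rewrite eB B0 big_set0 dim_flat_full ltnn.
by exists H; rewrite eB; apply: bigcapv_inf BH _.
Qed.

(* Folkman's theorem.  For a hyperplane H containing X, the Y with Y :&: H <> X
   form a contractible poset because of Y >= Y :&: H <= H; the remaining Y are
   coatoms, and their links are intervals (V, Y). *)
Lemma interval_acyclic X :
  acyclic_below R (@flat_lt R d A) (Defs.interval X) (d - \dim (val X)).-1.
Proof.
have irr := flat_lt_irr; have tr := flat_lt_trans.
have [m] := ubnP (d - \dim (val X))%N; elim: m X => // m IH X; rewrite ltnS => Xm.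
have [d1|d1] := leqP (d - \dim (val X))%N 1; first by case: (d - _)%N d1 => [|[]].
have [|H XH] := @flat_in_hyperplane X; first by lia.
have dH := hyperplanes_codim1 (valP H).
pose P := Defs.interval X; pose Q := [set Y in P | flat_cap Y (flat_hyperplane H) != X].
pose C := [set Y in P | (val Y <= val H)%VS].
have inP Y : (Y \in P) = [&& (val X <= val Y)%VS, (\dim (val X) < \dim (val Y))%N & (\dim (val Y) < d)%N].
  exact: in_interval.
have inQ Y : (Y \in Q) = (Y \in P) && (flat_cap Y (flat_hyperplane H) != X) by rewrite in_set.
have inC Y : (Y \in C) = (Y \in P) && (val Y <= val H)%VS by rewrite in_set.
have CQ : C \subset Q.
  apply/subsetP => Y; rewrite inQ inC => /andP[PY YH]; rewrite PY /=.
  have -> : flat_cap Y (flat_hyperplane H) = Y by apply: val_inj; apply/capv_idPl.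
  by move: PY; rewrite inP => /and3P[_ + _]; apply: contraTneq => ->; rewrite ltnn.
have QP : Q \subset P by apply/subsetP => Y; rewrite inQ => /andP[].
have HC : flat_hyperplane H \in C.
  have [h1 h2] : (\dim (val X) < \dim (val H))%N /\ (\dim (val H) < d)%N by lia.
  by rewrite inC inP XH h1 h2 subvv.
have cone (S : {set flat A}) a : a \in S -> {in S, forall Y, comparable_elts (@flat_lt R d A) a Y} ->
    forall n, acyclic_below R (@flat_lt R d A) S n.
  by move=> Sa cmp n k _; apply: acyclic_cone Sa cmp.
have cmpE Y Z : (val Y <= val Z)%VS -> comparable_elts (@flat_lt R d A) Y Z.
  by move=> h; rewrite /comparable_elts /flat_lt h; case: (eqVneq Y Z) => [|_] /=; rewrite ?orbT.
(* When Y outside C is attached, the members of S strictly inside Y have smaller dimension, so they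
   lie in C, hence in [Y :&: H]; those containing Y contain [Y :&: H] as well. The link is a cone
   with this apex. *)
have acQ n : acyclic_below R (@flat_lt R d A) Q n.
  apply: (acyclic_below_extend irr tr (r := fun Y => \dim (val Y)) CQ).
    apply: (cone _ _ HC) => Y; rewrite inC => /andP[_ YH].
    by rewrite comparable_eltsC; apply: cmpE.
  move=> Y S QCY CS SQ minY.
  have /andP[CY QY] : (Y \notin C) && (Y \in Q) by rewrite -in_setD.
  have [PY YHX] : Y \in P /\ flat_cap Y (flat_hyperplane H) != X.
    by apply/andP; rewrite -inQ.
  have := PY; rewrite inP => /and3P[XY dXY dYd].
  have YH : ~~ (val Y <= val H)%VS by apply: contra CY; rewrite inC PY.
  have KY : flat_lt Y (flat_cap Y (flat_hyperplane H)).
    rewrite /flat_lt capvSl /=; apply: contra YH => /eqP/(congr1 val)/= <-; exact: capvSr.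
  have KC : flat_cap Y (flat_hyperplane H) \in C.
    rewrite inC inP /= capvSr andbT subv_cap XY XH /=.
    rewrite (leq_ltn_trans _ dYd) ?dimvS ?capvSl // andbT.
    rewrite ltn_neqAle dimvS ?subv_cap ?XY // andbT; apply: contra YHX => e.
    by rewrite eq_sym -val_eqE /= -(eq_leqif (dimv_leqif_eq _)) // subv_cap XY.
  apply: (cone _ (flat_cap Y (flat_hyperplane H))).
    by rewrite in_set (subsetP CS) //= KY.
  move=> Z; rewrite in_set => /andP[SZ /orP[YZ|ZY]]; last first.
    by apply: cmpE; apply: subv_trans (capvSl _ _) _; case/andP: ZY.
  have CZ : Z \in C.
    apply: contraTT (flat_lt_dim YZ) => CZ; rewrite -leqNgt; apply: minY.
    by rewrite in_setD CZ.
  rewrite comparable_eltsC; apply: cmpE; rewrite subv_cap.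
  by case/andP: YZ => -> _; move: CZ; rewrite inC => /andP[_ ->].
apply: (acyclic_below_extend irr tr (r := fun=> 0%N) QP) => // Y S QPY QS SP _.
have /andP[QY PY] : (Y \notin Q) && (Y \in P) by rewrite -in_setD.
have KX : flat_cap Y (flat_hyperplane H) = X.
  by apply/eqP; move: QY; rewrite inQ PY /= negbK.
have := PY; rewrite inP => /and3P[XY dXY dYd].
have dY : \dim (val Y) = (\dim (val X)).+1.
  apply/eqP; rewrite eqn_leq dXY andbT -KX; exact: dim_cap_hyperplane.
(* No flat lies strictly between X and Y, and a Z strictly containing Y is too large for [Z :&: H]
   to be X; so the whole interval (V, Y) is already in Q. *)
have -> : link (@flat_lt R d A) S Y = Defs.interval Y.
  apply/setP => Z; rewrite in_interval in_set; apply/andP/and3P => [[SZ]|[YZ dYZ dZd]].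
    have := subsetP SP Z SZ; rewrite in_setD inP => /andP[_ /and3P[XZ dXZ dZd]].
    case/orP; rewrite flat_ltE => /andP[ZY dZY]; last by [].
    by move: dZY; rewrite dY ltnS leqNgt dXZ.
  split; last by rewrite (flat_ltE Z Y) YZ dYZ orbT.
  apply: (subsetP QS); rewrite inQ inP dZd (subv_trans XY YZ) (ltn_trans dXY dYZ) /=.
  apply/eqP => /(congr1 (fun K : flat A => \dim (val K))) /= eX.
  have := dim_cap_hyperplane (val Z) H; rewrite eX; move: dYZ; rewrite dY => /leq_trans h /h.
  by rewrite ltnn.
rewrite (_ : (d - _).-1.-1 = (d - \dim (val Y)).-1)%N; last by rewrite dY subnS.
by apply: IH; rewrite dY subnS; case: (d - _)%N d1 Xm.
Qed.
End Flats.

(** * Character of the cohomology of an interval *)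

Section Cohomology.

Variables (R : realType) (d : nat) (A : arrangement R d).
Local Notation lt := (@flat_lt R d A).
Implicit Types (X Y Z : flat A).

Lemma mul_coboundary X k (u : 'rV_#|simplices X k|) (f : {set flat A} -> R) j :
  (forall i, u 0 i = f (enum_val i)) ->
  (u *m coboundary X k) 0 j = coboundary_fun lt f (enum_val j).
Proof.
move=> uf; rewrite mxE /coboundary_fun.
have [tk tI ch] := chainsP _ _ _ _ (enum_valP j).
set t := enum_val j in tk tI ch *.
have face Y : Y \in t -> t :\ Y \in simplices X k.
  move=> tY; apply/chainsP; split; last exact: is_chainS (subD1set _ _) ch.
    by apply/eqP; rewrite -eqSS -tk (cardsD1 Y t) tY.
  exact: subset_trans (subD1set _ _) tI.
under eq_bigr do rewrite mxE /= -/t big_distrr /=.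
rewrite (exchange_big_dep (mem t)) /=; last by move=> i Y _ /andP[].
apply: eq_bigr => Y tY; rewrite (big_pred1 (enum_rank_in (face Y tY) (t :\ Y))) => [|i].
  by rewrite uf enum_rankK_in ?face // mulrC.
rewrite /= tY /= eq_sym -(inj_eq enum_val_inj).
by rewrite (enum_rankK_in _ (face Y tY)).
Qed.

Lemma cocycles_sub_coboundaries X k :
  acyclic R lt (Defs.interval X) k -> (cocycles X k <= coboundaries X k)%MS.
Proof.
move=> ac; apply/rV_subP => u /sub_kermxP u0.
pose f (s : {set flat A}) : R := \sum_(i | enum_val i == s) u 0 i.
have uf i : u 0 i = f (enum_val i).
  by rewrite /f (big_pred1 i) // => l; rewrite /= (inj_eq enum_val_inj).
have [t tc|g Hg] := ac f.
  have := mul_coboundary (enum_rank_in tc t) uf; rewrite u0 mxE enum_rankK_in //.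
case: k ac u u0 f uf Hg => [|k] ac u u0 f uf Hg.
  suff -> : u = 0 by apply: sub0mx.
  apply/rowP => i; rewrite uf Hg ?enum_valP // mxE.
  have /chainsP[/cards0_eq -> _ _] := enum_valP i.
  by rewrite /coboundary_fun big_set0.
rewrite genmxE; apply/submxP; exists (\row_i g (enum_val i)).
apply/rowP => j; rewrite (mul_coboundary (f := g)) => [|i]; last by rewrite mxE.
by rewrite uf Hg // enum_valP.
Qed.

Lemma chain_dim_inj (s : {set flat A}) : is_chain lt s ->
  {in s &, injective (fun Y : flat A => \dim (val Y))}.
Proof.
move=> /is_chainP ch Y Z sY sZ dYZ; have := ch _ _ sY sZ.
by case/or3P => [/eqP //|/flat_lt_dim|/flat_lt_dim]; rewrite dYZ ltnn.
Qed.

(** Dimensions along a chain are distinct integers strictly between that of X and d. *)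
Lemma chain_size X k s : s \in simplices X k -> (k <= (d - \dim (val X)).-1)%N.
Proof.
case/chainsP=> <- sI ch.
have -> : ((d - \dim (val X)).-1 = size (iota (\dim (val X)).+1 (d - (\dim (val X)).+1)))%N.
  by rewrite size_iota subnS.
have <- : size [seq \dim (val Y) | Y <- enum s] = #|s| by rewrite size_map -cardE.
apply: uniq_leq_size.
  rewrite map_inj_in_uniq ?enum_uniq // => Y Z; rewrite !mem_enum; exact: chain_dim_inj.
move=> _ /mapP[Y + ->]; rewrite mem_enum mem_iota => /(subsetP sI).
by rewrite in_interval => /and3P[_ h1 h2]; rewrite h1 /= subnKC // (leq_trans h1 (ltnW h2)).
Qed.

Section Group.

Variables (gT : finGroupType) (W : {group gT}) (rW : mx_representation R W d).
Hypothesis presA : preserves A rW.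

(** Below this degree Folkman's theorem applies, above it there are no chains. The truncated
    predecessor also covers X = V, where the empty simplex sits at index 0. *)
Lemma rdegree_cohomology X k : k != (d - \dim (val X)).-1 ->
  rdegree (cohomology_repr presA X k) = 0.
Proof.
move=> kX /=; apply/eqP; rewrite genmxE mxrank_eq0 in_factmod_eq0.
move: kX; rewrite neq_ltn => /orP[lt_k|gt_k].
  exact/cocycles_sub_coboundaries/interval_acyclic.
apply/row_subP => i; have /chain_size := enum_valP i.
by rewrite leqNgt gt_k.
Qed.

(** Simplices are oriented by the order, which the group preserves; a fixed simplex therefore
    contributes 1 to the trace on cochains, without an orientation sign. *)
Definition fixed_chains X k w := [set s in simplices X k | ((flat_action presA)^*)%act s w == s].

Definition boundary_trace X k w : R := \tr (submod_repr (coboundaries_mxmodule presA X k) w).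

Lemma coboundaries_sub_cocycles X k : (coboundaries X k <= cocycles X k)%MS.
Proof.
case: k => [|k]; first exact: sub0mx.
rewrite genmxE; apply/row_subP => i; apply/sub_kermxP/rowP => j.
pose f s : R := (s == enum_val i)%:R.
rewrite (mul_coboundary (f := coboundary_fun lt f)) => [|l].
  have /chainsP[_ _ ch] := enum_valP j.
  rewrite [RHS]mxE; apply: coboundary_coboundary ch; [exact: flat_lt_irr | exact: flat_lt_trans].
rewrite rowE; apply: mul_coboundary => m.
by rewrite mxE eqxx /f (inj_eq enum_val_inj).
Qed.

Lemma mxtrace_cohomology X k w : w \in stab presA X ->
  \tr (cohomology_repr presA X k w)
  = #|fixed_chains X k w|%:R - boundary_trace X k w - boundary_trace X k.+1 w.
Proof.
move=> Sw; have Sub := coboundaries_sub_cocycles X k.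
have sub := mxtrace_subquotient (coboundaries_mxmodule presA X k) (cocycles_mxmodule presA X k) Sub Sw.
have fix_k : \tr (cochain_repr presA X k w) = #|fixed_chains X k w|%:R :=
  mxtrace_perm_repr R (simplices_acts presA X k) w.
have ker := @mxtrace_kernel_image _ _ _ (Representation (cochain_repr presA X k))
  (Representation (cochain_repr presA X k.+1)) (coboundary X k)
  (cocycles_mxmodule presA X k) (coboundaries_mxmodule presA X k.+1) w
  (@coboundary_hom _ _ _ _ _ _ presA X k) Sw.
have {}ker : \tr (cochain_repr presA X k w)
  = \tr (submod_repr (cocycles_mxmodule presA X k) w) + boundary_trace X k.+1 w := ker.
by rewrite -fix_k ker sub -/(boundary_trace X k w) addrAC addrK addrC addKr.
Qed.

Definition chain_euler X w : R :=
  \sum_(k < #|{: flat A}|.+1) (-1) ^+ k * #|fixed_chains X k w|%:R.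

(** Only one degree contributes, so its sign may be inserted in all of them; the alternating sum of
    characters then telescopes to that of the cochains. *)
Lemma mxtrace_total_cohomology X w : w \in stab presA X ->
  \tr (total_cohomology presA X w) = (-1) ^+ (d - \dim (val X)).-1 * chain_euler X w.
Proof.
move=> Sw; rewrite mxtrace_bigdadd; set n := #|_|.+1; set top := (_ - _).-1.
have step k : \tr (cohomology_repr presA X k w)
    = (-1) ^+ top * ((-1) ^+ k * \tr (cohomology_repr presA X k w)).
  have [->|kt] := eqVneq k top; first by rewrite mulrA -expr2 sqrr_sign mul1r.
  suff -> : \tr (cohomology_repr presA X k w) = 0 by rewrite !mulr0.
  by rewrite /mxtrace big1 // => i _; have := ltn_ord i; rewrite {2}(rdegree_cohomology kt).
under eq_bigr do rewrite step mxtrace_cohomology //.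
rewrite -big_distrr /=; congr (_ * _).
have tele m : \sum_(k < m) (-1) ^+ k * (#|fixed_chains X k w|%:R - boundary_trace X k w
    - boundary_trace X k.+1 w)
  = \sum_(k < m) (-1) ^+ k * #|fixed_chains X k w|%:R + (-1) ^+ m * boundary_trace X m w
    - boundary_trace X 0 w.
  elim: m => [|m IH]; first by rewrite !big_ord0 expr0 mul1r add0r subrr.
  by rewrite !big_ord_recr /= IH exprS; ring.
rewrite tele /boundary_trace.
have z0 k : \rank (coboundaries X k) = 0%N ->
    \tr (submod_repr (coboundaries_mxmodule presA X k) w) = 0.
  by move=> rk0; rewrite /mxtrace big1 // => i _; have := ltn_ord i; rewrite {2}rk0.
rewrite !z0 ?mxrank0 ?mulr0 ?addr0 ?subr0 //.
(* The last boundary term vanishes because no set of flats has [#|{: flat A}|.+1] elements. *)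
apply/eqP; rewrite -leqn0; apply: leq_trans (rank_leq_row _) _.
rewrite leqn0 cards_eq0; apply/eqP/setP => s; rewrite [RHS]inE; apply/negbTE/negP.
by case/chainsP=> sn _ _; have := max_card (mem s); rewrite sn ltnn.
Qed.

End Group.
End Cohomology.

(** * Faces fixed by a group element *)

Section Cells.

Variables (R : realType) (d : nat) (A : arrangement R d).
Local Notation V := 'rV[R]_d.
Implicit Types (u v : V) (H K : A) (B : {set A}) (U : {vspace V}).
Local Notation sign_vector := {ffun A -> option bool}.

Definition eval_eq H v : R := (v *m equation H) 0 0.

Lemma mem_hyperplane H v : (v \in val H) = (eval_eq H v == 0).
Proof.
rewrite equationP /eval_eq; apply/eqP/eqP => [->|v0]; first by rewrite mxE.
by apply/matrixP => i j; rewrite !ord1 v0 mxE.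
Qed.

Lemma sideE H v : side H v = if eval_eq H v == 0 then None else Some (0 < eval_eq H v).
Proof. by rewrite /side mem_hyperplane. Qed.

Lemma side_None H v : (side H v == None) = (v \in val H).
Proof. by rewrite /side; case: ifP. Qed.

Lemma eval_eqD H u v : eval_eq H (u + v) = eval_eq H u + eval_eq H v.
Proof. by rewrite /eval_eq mulmxDl mxE. Qed.

Lemma eval_eqZ H a v : eval_eq H (a *: v) = a * eval_eq H v.
Proof. by rewrite /eval_eq -scalemxAl mxE. Qed.

Lemma sideZ H a v : 0 < a -> side H (a *: v) = side H v.
Proof. by move=> a0; rewrite !sideE eval_eqZ mulf_eq0 gt_eqF //= pmulr_rgt0. Qed.

Lemma sideD H u v : side H u = side H v -> side H (u + v) = side H u.
Proof.
rewrite !sideE eval_eqD; set a := eval_eq H u; set b := eval_eq H v.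
have [->|a0] := eqVneq a 0; have [->|b0] := eqVneq b 0; rewrite ?addr0 ?eqxx //.
case; have [a_gt|a_lt|aE] := ltgtP 0 a; have [b_gt|b_lt|bE] := ltgtP 0 b => // _.
- by rewrite gt_eqF addr_gt0.
- have ab : a + b < 0 by rewrite -oppr_gt0 opprD addr_gt0 // oppr_gt0.
  by rewrite lt_eqF // lt_gtF.
- by rewrite -bE eqxx in b0.
- by rewrite -aE eqxx in a0.
- by rewrite -aE eqxx in a0.
Qed.

(** The value [None] off B keeps sign vectors for different B in one type, so that forgetting a
    hyperplane is resetting one coordinate. *)
Definition sides_on B v : sign_vector := [ffun H => if H \in B then side H v else None].

Definition cells B U : {set sign_vector} :=
  [set s | `[< exists2 u, u \in U & s = sides_on B u >]].

Definition zero_space B (s : sign_vector) := (\bigcap_(H in B | s H == None) val H)%VS.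

Lemma cellsP B U s : reflect (exists2 u, u \in U & s = sides_on B u) (s \in cells B U).
Proof. by rewrite inE; apply: asboolP. Qed.

Lemma sides_onP B u v :
  sides_on B u = sides_on B v <-> {in B, forall H, side H u = side H v}.
Proof.
split=> [/ffunP h H BH|h]; first by have := h H; rewrite !ffunE BH.
by apply/ffunP => H; rewrite !ffunE; case: ifP => // /h.
Qed.

Lemma mem_zero_space B v : v \in zero_space B (sides_on B v).
Proof.
by apply/mem_bigcapv => H /andP[BH]; rewrite ffunE BH side_None.
Qed.

(* A cell is relatively open in its span. *)
Lemma sides_perturb B u v : v \in zero_space B (sides_on B u) ->
  exists2 e, 0 < e & {in B, forall H, side H (u + e *: v) = side H u}.
Proof.
move=> /mem_bigcapv v0.
have [e e0 /(_ e)] := small_pos (enum {: A}) (eval_eq^~ u) (eval_eq^~ v).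
rewrite e0 lexx => /(_ isT)/allP small; exists e => // H BH.
have /implyP := small H (mem_enum _ H).
have [uH|uH lt] := boolP (u \in val H).
  have vH : v \in val H by apply: v0; rewrite BH ffunE BH side_None.
  move=> _; have -> : side H u = None by apply/eqP; rewrite side_None.
  by apply/eqP; rewrite side_None memvD // memvZ.
rewrite mem_hyperplane in uH; have [h1 h2] := sgr_perturb uH e0 (lt uH).
by rewrite !sideE eval_eqD eval_eqZ (negPf h1) (negPf uH) h2.
Qed.

Lemma sum_option_bool (F : option bool -> R) :
  \sum_o F o = F None + F (Some true) + F (Some false).
Proof.
rewrite (bigD1 None) //= (bigD1 (Some true)) //= (bigD1 (Some false)) //= big1 ?addr0 ?addrA //.
by case=> [[]|].
Qed.

Definition extend_sign H (s : sign_vector) o : sign_vector := [ffun K => if K == H then o else s K].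

Lemma cells_extend B H U s o : H \notin B -> s \in cells B U ->
  (extend_sign H s o \in cells (H |: B) U)
  = `[< exists u, [/\ u \in U, sides_on B u = s & side H u = o] >].
Proof.
move=> BH sc; apply/cellsP/asboolP => [[u Uu e]|[u [Uu e1 e2]]]; exists u => //.
  split=> //; last by have /ffunP/(_ H) := e; rewrite !ffunE setU11 eqxx => ->.
  have /cellsP[u0 _ s0] := sc.
  apply/ffunP => K; have /ffunP/(_ K) := e; rewrite !ffunE !inE.
  have [->|KH] := eqVneq K H; last by move=> ->.
  by rewrite (negPf BH) s0 ffunE (negPf BH).
apply/ffunP => K; rewrite !ffunE !inE -e1 ffunE.
by have [->|] := eqVneq K H.
Qed.

Lemma zero_space_extend B H s o : H \notin B ->
  zero_space (H |: B) (extend_sign H s o)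
  = if o is None then (zero_space B s :&: val H)%VS else zero_space B s.
Proof.
move=> BH; apply/vspaceP => v; have ne K : K \in B -> (K == H) = false.
  by move=> BK; apply/negbTE; apply: contraNneq BH => <-.
have inB : v \in zero_space B s <-> forall K, K \in B -> s K = None -> v \in val K.
  split=> [/mem_bigcapv h K BK sK|h]; first by apply: h; rewrite BK sK eqxx.
  by apply/mem_bigcapv => K /andP[BK /eqP]; apply: h.
have inE' : v \in zero_space (H |: B) (extend_sign H s o)
    <-> v \in zero_space B s /\ (o = None -> v \in val H).
  split=> [/mem_bigcapv h|[/inB h1 h2]].
    split; [apply/inB => K BK sK | move=> oN]; apply: h.
      by rewrite setU1r // ffunE ne // sK eqxx.
    by rewrite setU11 ffunE eqxx oN eqxx.
  apply/mem_bigcapv => K /andP[/setU1P[->|BK]]; rewrite ffunE ?eqxx; first by move/eqP.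
  by rewrite ne // => /eqP; apply: h1.
case: o inE' => [o|] inE'.
  by apply/idP/idP => [/inE'[]//|h]; apply/inE'.
rewrite memv_cap; apply/idP/andP => [/inE'[? ?]|[? ?]]; first by split; auto.
by apply/inE'; split.
Qed.

(** The compactly supported Euler characteristic of U, by deletion of a hyperplane H. A cell whose
    span D lies in H is unchanged; otherwise H either misses it, and it survives on one side, or
    cuts it into two pieces of dimension dim D and a wall of one dimension less, whose signs add up
    to that of the cell. *)
Lemma euler_cells B U :
  \sum_(s in cells B U) (-1) ^+ \dim (U :&: zero_space B s)%VS = (-1) ^+ \dim U :> R.
Proof.
have [n] := ubnP #|B|; elim: n B => // n IH B; rewrite ltnS => Bn.
have [B0|/set0Pn[H BH]] := eqVneq B set0.
  rewrite (big_pred1 (sides_on B 0)) => [|s] /=.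
    by rewrite /zero_space big_pred0 ?capvf // => H; rewrite B0 inE.
  apply/cellsP/eqP => [[u _ ->]|->]; last by exists 0; rewrite ?mem0v.
  by apply/ffunP => H; rewrite !ffunE B0 inE.
rewrite -(setD1K BH); set B' := B :\ H.
have HB' : H \notin B' by rewrite !inE eqxx.
rewrite -(IH B'); last by move: Bn; rewrite (cardsD1 H B) BH.
pose restrict (s : sign_vector) := extend_sign H s None.
have restrictE u : restrict (sides_on (H |: B') u) = sides_on B' u.
  apply/ffunP => K; rewrite !ffunE in_setU1.
  by have [->|//] := eqVneq K H; rewrite (negPf HB').
rewrite (partition_big restrict (mem (cells B' U))) /=; last first.
  by move=> s /cellsP[u Uu ->]; apply/cellsP; exists u.
apply: eq_bigr => s sc; have /cellsP[u0 Uu0 s0] := sc.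
have sH : s H = None by rewrite s0 ffunE (negPf HB').
have restrict_ext o : restrict (extend_sign H s o) = s.
  by apply/ffunP => K; rewrite !ffunE; case: eqP => // ->.
rewrite (reindex_onto (extend_sign H s) (fun t : sign_vector => t H)) /=; last first.
  move=> t /andP[_ /eqP <-]; apply/ffunP => K; rewrite !ffunE.
  by case: eqP => // ->.
under eq_bigl => o do rewrite restrict_ext eqxx andbT ffunE eqxx eqxx andbT.
rewrite big_mkcond sum_option_bool !cells_extend // !zero_space_extend //.
set D := (U :&: zero_space B' s)%VS.
pose C u := u \in U /\ sides_on B' u = s.
have CD u : C u -> u \in D.
  by move=> [Uu us]; rewrite memv_cap Uu -us mem_zero_space.
have CU0 : C u0 by [].
have pert u v : C u -> v \in D -> exists2 e, 0 < e & C (u + e *: v).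
  move=> [Uu us]; rewrite memv_cap -{1}us => /andP[Uv /sides_perturb[e e0 se]].
  exists e => //; split; first by rewrite memvD // memvZ.
  by rewrite -us; apply/sides_onP.
have conv u v : C u -> C v -> forall a b, 0 < a -> 0 < b -> C (a *: u + b *: v).
  move=> [Uu us] [Uv vs] a b a0 b0; split; first by rewrite memvD // memvZ.
  rewrite -us; apply/sides_onP => K BK.
  have uv : side K u = side K v by move: K BK; apply/sides_onP; rewrite us vs.
  by rewrite sideD sideZ // sideZ.
have [DH|DH] := boolP (D <= val H)%VS.
  have CH u : C u -> side H u = None.
    by move=> Cu; apply/eqP; rewrite side_None (subvP DH) // CD.
  have -> : `[< exists u, [/\ u \in U, sides_on B' u = s & side H u = None] >].
    by apply/asboolP; exists u0; case: CU0 => ? ?; split=> //; apply: CH.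
  have no b : `[< exists u, [/\ u \in U, sides_on B' u = s & side H u = Some b] >] = false.
    by apply/asboolPn => -[u [Uu us]]; rewrite CH.
  rewrite !no !addr0 capvA -/D; congr (_ ^+ \dim _).
  exact/capv_idPl.
have dimD : \dim D = (\dim (D :&: val H)%VS).+1.
  apply/eqP; rewrite eqn_leq dim_cap_hyperplane ltn_neqAle dimvS ?capvSl // andbT.
  rewrite (eq_leqif (dimv_leqif_eq (capvSl _ _))).
  by apply: contra DH => /eqP <-; apply: capvSr.
have [v Dv vH] : exists2 v, v \in D & eval_eq H v != 0.
  by have /subvPn[v Dv] := DH; rewrite mem_hyperplane; exists v.
have sgn_side u : (side H u = Some true <-> 0 < eval_eq H u)
    /\ (side H u = Some false <-> eval_eq H u < 0).
  by rewrite sideE; case: (ltgtP 0 (eval_eq H u)).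
(* From a point on the wall, a small move along a direction of D that leaves H reaches either side
   within the cell. *)
have hasN : `[< exists u, [/\ u \in U, sides_on B' u = s & side H u = None] >] ->
    forall b, `[< exists u, [/\ u \in U, sides_on B' u = s & side H u = Some b] >].
  move=> /asboolP[u [Uu us /eqP uH]] b; apply/asboolP; rewrite side_None mem_hyperplane in uH.
  have [w Dw Hw] : exists2 w, w \in D & side H w = Some b.
    have [p|p|p] := ltgtP 0 (eval_eq H v); last by rewrite -p eqxx in vH.
      exists ((-1) ^+ (~~ b) *: v); first by rewrite memvZ.
      by case: b; apply sgn_side; rewrite eval_eqZ ?mul1r ?mulN1r ?oppr_lt0.
    exists ((-1) ^+ b *: v); first by rewrite memvZ.
    by case: b; apply sgn_side; rewrite eval_eqZ ?mul1r ?mulN1r ?oppr_gt0.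
  have [e e0 [Ue se]] := pert u w (conj Uu us) Dw.
  exists (u + e *: w); split=> //.
  by rewrite -Hw -(sideZ H w e0) !sideE eval_eqD (eqP uH) add0r.
(* The cell is convex: points on opposite sides, weighted by each other's distance to H, combine to
   a point of H. *)
have twoN : (forall b, `[< exists u, [/\ u \in U, sides_on B' u = s & side H u = Some b] >]) ->
    `[< exists u, [/\ u \in U, sides_on B' u = s & side H u = None] >].
  move=> h; have /asboolP[u [Uu us su]] := h true; have up := (sgn_side u).1.1 su.
  have /asboolP[w [Uw ws sw]] := h false; have wn := (sgn_side w).2.1 sw.
  rewrite -oppr_gt0 in wn; apply/asboolP.
  exists (- eval_eq H w *: u + eval_eq H u *: w).
  have [? ?] := conv u w (conj Uu us) (conj Uw ws) _ _ wn up.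
  split=> //; apply/eqP; rewrite side_None mem_hyperplane eval_eqD !eval_eqZ.
  by rewrite mulNr mulrC addNr.
rewrite capvA -/D dimD exprS mulN1r.
have [N|N] := boolP `[< exists u, [/\ u \in U, sides_on B' u = s & side H u = None] >].
  by rewrite !(hasN N) subrr add0r.
rewrite add0r; case Eu0: (side H u0) => [b|]; last first.
  by case/negP: N; apply/asboolP; exists u0; split=> //; case: CU0.
have pb : `[< exists u, [/\ u \in U, sides_on B' u = s & side H u = Some b] >].
  by apply/asboolP; exists u0; split=> //; case: CU0.
have pnb : `[< exists u, [/\ u \in U, sides_on B' u = s & side H u = Some (~~ b)] >] = false.
  by apply: contraNF N => pnb; apply: twoN => c; have [->//|cb] := eqVneq c b; rewrite (_ : c = ~~ b) //; case: (c) (b) cb => [] [].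
by case: (b) pb pnb => /= -> ->; rewrite ?addr0 ?add0r.
Qed.

End Cells.

(** * Philip Hall's alternating chain sums *)

Section ChainCount.

Variables (R : comNzRingType) (T : finType) (lt : rel T).
Hypotheses (lt_irr : irreflexive lt) (lt_trans : transitive lt).
Variable D : {set T}.
Implicit Types (s : {set T}) (x y z : T).

Definition chains_before z := [set s : {set T} | (s \subset [set y in D | lt y z]) && is_chain lt s].

(** The empty chain counts with sign +1. The value is minus the Moebius function, at z, of D with a
    new least element adjoined. *)
Definition chain_sum z : R := \sum_(s in chains_before z) (-1) ^+ #|s|.

(** The greatest element for [lt]; for [flat_lt] this is the smallest subspace in the chain. *)
Definition bottom s x := (x \in s) && [forall y in s, (y == x) || lt y x].

Lemma bottom_unique s x y : bottom s x -> bottom s y -> x = y.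
Proof.
move=> /andP[sx /forall_inP hx] /andP[sy /forall_inP hy].
have /orP[/eqP->//|yx] := hx y sy; have /orP[/eqP->//|xy] := hy x sx.
by have := lt_trans xy yx; rewrite lt_irr.
Qed.

Lemma bottom_exists s : is_chain lt s -> s != set0 -> exists x, bottom s x.
Proof.
move=> /is_chainP ch /set0Pn[x0 sx0].
case: (@arg_maxnP _ x0 (mem s) (position lt s)) => //= x sx maxx.
exists x; rewrite /bottom sx /=; apply/forall_inP => y sy.
have /or3P[/eqP->|->|xy] := ch y x sy sx; rewrite ?eqxx ?orbT //.
have := maxx y sy; rewrite leqNgt => /negP[]; apply: proper_card.
apply/properP; split.
  by apply/subsetP => z; rewrite !inE => /andP[->] /lt_trans; apply.
by exists x; rewrite !inE sx ?xy ?lt_irr.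
Qed.

(** Nonempty chains are sorted by their [lt]-greatest element x; deleting x leaves an arbitrary
    chain before x and flips the sign. *)
Lemma chain_sum_rec z : chain_sum z = 1 - \sum_(x in D | lt x z) chain_sum x.
Proof.
rewrite {1}/chain_sum (bigD1 set0) /=; last first.
  rewrite inE sub0set; apply/is_chainP => x y; by rewrite inE.
rewrite cards0 expr0 -sumrN; congr (_ + _).
transitivity (\sum_(s in chains_before z | s != set0) \sum_(x | bottom s x) ((-1) ^+ #|s| : R)).
  apply: eq_bigr => s /andP[]; rewrite inE => /andP[_ ch] s0.
  have [x bx] := bottom_exists ch s0; rewrite (big_pred1 x) // => y.
  by apply/idP/eqP => [by_|-> //]; apply: bottom_unique by_ bx.
rewrite (exchange_big_dep (fun x => (x \in D) && lt x z)) /=; last first.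
  move=> s x /andP[]; rewrite inE => /andP[/subsetP sz _] _ /andP[/sz].
  by rewrite inE.
apply: eq_bigr => x /andP[Dx xz].
rewrite (reindex_onto (fun s => x |: s) (fun s => s :\ x)) /=; last first.
  by move=> s /andP[_ /andP[sx _]]; rewrite setD1K.
rewrite /chain_sum -sumrN; apply: eq_big => [s|s].
  rewrite !inE; apply/andP/andP.
    move=> [/andP[/andP[/andP[sz ch] _] /andP[_ /forall_inP bx]] /eqP sxs].
    have sx : x \notin s by rewrite -sxs !inE eqxx.
    split; last by apply: is_chainS ch; apply: subsetU1.
    apply/subsetP => y sy; have yU : y \in x |: s by rewrite setU1r.
    have := subsetP sz y yU; rewrite !inE => /andP[-> _] /=.
    by have /orP[/eqP e|//] := bx y yU; rewrite e in sy; rewrite sy in sx.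
  move=> [/subsetP sx ch].
  have xs : x \notin s by apply/negP => /sx; rewrite inE lt_irr andbF.
  rewrite setU1K // eqxx; split=> //; apply/andP; split; first apply/andP; first split; first apply/andP; first split.
  - apply/subsetP => y /setU1P[->|/sx]; rewrite !inE ?Dx //.
    by case/andP=> -> /lt_trans; apply.
  - apply/is_chainP => y1 y2 /setU1P[->|s1] /setU1P[->|s2]; rewrite /comparable_elts ?eqxx //.
    + by have := sx _ s2; rewrite inE => /andP[_ ->]; rewrite !orbT.
    + by have := sx _ s1; rewrite inE => /andP[_ ->]; rewrite !orbT.
    + exact: (is_chainP _ _ ch).
  - by apply/set0Pn; exists x; rewrite setU11.
  rewrite /bottom setU11; apply/forall_inP => y /setU1P[->|/sx]; first by rewrite eqxx.
  by rewrite inE => /andP[_ ->]; rewrite orbT.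
move=> /andP[_ /eqP sxs]; rewrite cardsU1.
have -> : x \notin s by rewrite -sxs !inE eqxx.
by rewrite exprS mulN1r.
Qed.

End ChainCount.

Lemma chain_sum_imset (R : comNzRingType) (T : finType) (lt : rel T) (f : T -> T) (D : {set T}) z :
  injective f -> {mono f : x y / lt x y} ->
  chain_sum R lt (f @: D) (f z) = chain_sum R lt D z.
Proof.
move=> fI fM; have cmpE x y : comparable_elts lt (f x) (f y) = comparable_elts lt x y.
  by rewrite /comparable_elts (inj_eq fI) !fM.
have -> : chain_sum R lt (f @: D) (f z)
    = \sum_(s in [set f @: (s : {set T}) | s in chains_before lt D z]) (-1) ^+ #|s|.
  apply: eq_bigl => s; apply/idP/imsetP.
    rewrite inE => /andP[/subsetP sD /is_chainP ch].
    have sE : s = f @: (f @^-1: s).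
      apply/setP => y; apply/idP/imsetP => [sy|[x + ->]]; last by rewrite inE.
      have := sD _ sy; rewrite inE => /andP[/imsetP[x _ e] _].
      by exists x; rewrite // inE -e.
    exists (f @^-1: s) => //; rewrite inE; apply/andP; split.
      apply/subsetP => x h; have fxs : f x \in s by rewrite inE in h.
      by have := sD _ fxs; rewrite !inE fM (mem_imset _ _ fI).
    by apply/is_chainP => x y; rewrite !inE => sx sy; rewrite -cmpE; apply: ch.
  case=> t; rewrite inE => /andP[/subsetP tD /is_chainP ch] ->.
  rewrite inE; apply/andP; split.
    apply/subsetP => _ /imsetP[x tx ->]; have := tD _ tx.
    by rewrite !inE fM (mem_imset _ _ fI).
  by apply/is_chainP => _ _ /imsetP[x tx ->] /imsetP[y ty ->]; rewrite cmpE; apply: ch.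
rewrite big_imset /=; last by move=> s t _ _; apply: imset_inj.
by apply: eq_bigr => s _; rewrite card_imset.
Qed.

(** * The face semigroup and the action of W x Z_2 *)

Section Faces.

Variables (R : realType) (d : nat) (A : arrangement R d).
Local Notation V := 'rV[R]_d.
Implicit Types (x y z : face A) (X Y Z : flat A) (u v : V) (H K : A).

Definition face_in x X := `[< forall v, face_of A v = x -> v \in val X >].

Lemma face_ofE v H : face_of A v H = side H v.
Proof. by rewrite /= ffunE. Qed.

Lemma face_mulE x y H : face_mul x y H = if x H is Some s then Some s else y H.
Proof. by rewrite /= ffunE. Qed.

Lemma faceP x y : (forall H, x H = y H) <-> x = y.
Proof. by split=> [h|->//]; apply: val_inj; apply/ffunP. Qed.

Lemma face_pointE x H : side H (face_point x) = x H.
Proof. by rewrite -face_ofE face_pointK. Qed.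

Lemma face_mulA x y z : face_mul x (face_mul y z) = face_mul (face_mul x y) z.
Proof. by apply/faceP => H; rewrite !face_mulE; case: (x H). Qed.

Lemma mem_flat X v : (v \in val X) <-> (forall H, (val X <= val H)%VS -> v \in val H).
Proof.
split=> [Xv H /subvP|h]; first exact.
have [B eB] := flat_eqP X; rewrite eB; apply/mem_bigcapv => H BH; apply: h.
by rewrite eB; apply: bigcapv_inf BH _.
Qed.

Lemma face_inE x X : face_in x X <-> (forall H, (val X <= val H)%VS -> x H = None).
Proof.
split=> [/asboolP h H XH|h].
  by apply/eqP; rewrite -face_pointE side_None; apply: (subvP XH); apply: h; apply: face_pointK.
apply/asboolP => v vx; apply/mem_flat => H /h; rewrite -vx face_ofE => /eqP.
by rewrite side_None.
Qed.

Lemma face_in_point x X : face_in x X = (face_point x \in val X).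
Proof.
apply/idP/idP => [/asboolP h|/mem_flat h]; first by apply: h; apply: face_pointK.
by apply/face_inE => H XH; apply/eqP; rewrite -face_pointE side_None h.
Qed.

Lemma supp_mem x : (\bigcap_(H | x H == None) val H)%VS \in flats A.
Proof.
have := flat_of_set [set H | x H == None].
by under eq_bigl do rewrite inE.
Qed.

Definition supp x : flat A := SeqSub (supp_mem x).

Lemma mem_supp x v : v \in val (supp x) <-> (forall H, x H = None -> v \in val H).
Proof.
split=> [/mem_bigcapv h H xH|h]; first by apply: h; rewrite xH.
by apply/mem_bigcapv => H /eqP; apply: h.
Qed.

Lemma face_in_supp x X : face_in x X = (val (supp x) <= val X)%VS.
Proof.
apply/idP/subvP => [/face_inE h v /mem_supp vs|h].
  by apply/mem_flat => H /h; apply: vs.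
by rewrite face_in_point; apply: h; apply/mem_supp => H /eqP; rewrite -face_pointE side_None.
Qed.

Lemma face_in_mul x y X : face_in (face_mul x y) X = face_in x X && face_in y X.
Proof.
apply/idP/andP => [/face_inE h|[/face_inE h1 /face_inE h2]].
  split; apply/face_inE => H XH; have := h H XH; rewrite face_mulE; first by case: (x H).
  by case xH: (x H).
by apply/face_inE => H XH; rewrite face_mulE h1 ?h2.
Qed.

Lemma chamber_supp x : (x \in chambers A) = (supp x == flat_full A).
Proof.
rewrite inE -val_eqE /=; apply/forallP/eqP => [h|e H].
  by rewrite big_pred0 // => H; apply/negbTE/h.
apply/negP => xH; have : (fullv <= val H)%VS by rewrite -e; apply: (bigcapv_inf H xH (subvv _)).
have dH := hyperplanes_codim1 (valP H).
by move=> /dimvS; rewrite (@dim_flat_full R d A) -[X in (X <= _)%N]dH ltnn. 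
Qed.

Section Action.

Variables (gT : finGroupType) (W : {group gT}) (rW : mx_representation R W d).
Hypothesis presA : preserves A rW.
Local Notation WZ := (setX_group W [set: 'Z_2]%G).
Implicit Types (g : gT * 'Z_2).
Local Notation act := (wz_act rW).

Lemma WZ1 g : g \in WZ -> g.1 \in W. Proof. by rewrite inE => /andP[]. Qed.

(** Equations orient the hyperplanes arbitrarily, so g may exchange the two sides: b records the
    sign of the factor relating the equations of H and K. *)
Lemma wz_side g H : g \in WZ ->
  exists K b, forall v, side H (v *m wz_mx rW g) = omap (addb b) (side K v).
Proof.
move=> Wg; have [K [k [k0 E]]] := equation_image presA H Wg.
exists K, (k < 0) => v; rewrite !sideE.
have -> : eval_eq H (v *m wz_mx rW g) = k * eval_eq K v.
  by rewrite /eval_eq -mulmxA E -scalemxAr mxE.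
rewrite mulf_eq0 (negPf k0) /=; have [//|v0] := eqVneq (eval_eq K v) 0.
congr Some; have [kn|kp|k00] := ltgtP k 0; last by rewrite k00 eqxx in k0.
  by rewrite nmulr_rgt0 //; case: ltgtP v0 => // ->; rewrite eqxx.
by rewrite pmulr_rgt0.
Qed.

Lemma wz_act_side g x H v : g \in WZ -> face_of A v = x ->
  act x g H = side H (v *m wz_mx rW g).
Proof.
by move=> Wg <-; rewrite /wz_act Wg (face_image_of presA) // face_ofE.
Qed.

Lemma wz_act_face g H : g \in WZ ->
  exists K b, forall x, act x g H = omap (addb b) (x K).
Proof.
move=> Wg; have [K [b Kb]] := wz_side H Wg; exists K, b => x.
by rewrite (wz_act_side _ Wg (face_pointK x)) Kb face_pointE.
Qed.

Lemma wz_act_mul g x y : g \in WZ -> act (face_mul x y) g = face_mul (act x g) (act y g).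
Proof.
move=> Wg; apply/faceP => H; have [K [b Kb]] := wz_act_face H Wg.
by rewrite face_mulE !Kb face_mulE; case: (x K).
Qed.

Lemma wz_actM x g h : g \in WZ -> h \in WZ -> act x (g * h)%g = act (act x g) h.
Proof. by move=> Wg Wh; apply: (actMin (wz_action presA)). Qed.

Lemma wz_act1 x : act x 1%g = x.
Proof. exact: (act1 (wz_action presA)). Qed.

Lemma mem_flat_act g X v : g \in WZ ->
  (v *m wz_mx rW g \in val (flat_action presA X g.1)) = (v \in val X).
Proof.
move=> Wg; have W1 := WZ1 Wg; rewrite val_flat_act // /wz_mx -scalemxAr rpredZeq signr_eq0 /=.
by rewrite mem_subspace_image ?(repr_mx_unit rW).
Qed.

Lemma supp_act_sub g x : g \in WZ ->
  (val (flat_action presA (supp x) g.1) <= val (supp (act x g)))%VS.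
Proof.
move=> Wg; apply/subvP => u; pose v := u *m wz_mx rW g^-1%g.
have -> : u = v *m wz_mx rW g.
  by rewrite /v -mulmxA -(wz_mxM rW) ?groupV // mulVg wz_mx1 mulmx1.
rewrite mem_flat_act // => /mem_supp vs; apply/mem_supp => H; have [K [b Kb]] := wz_side H Wg.
rewrite (wz_act_side _ Wg (face_pointK x)) Kb => xK; apply/eqP.
rewrite -side_None Kb; have := vs K; rewrite -face_pointE; case: (side K _) xK => // _ /(_ erefl).
by rewrite -side_None => /eqP ->.
Qed.

Lemma supp_act g x : g \in WZ -> supp (act x g) = flat_action presA (supp x) g.1.
Proof.
move=> Wg; apply/val_inj/eqP; rewrite eqEsubv supp_act_sub // andbT.
have WV : g^-1%g \in WZ by rewrite groupV.
have := supp_act_sub (act x g) WV; rewrite -wz_actM // mulgV wz_act1.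
move/subvP => h; apply/subvP => v vs.
have := h (v *m wz_mx rW g^-1%g); rewrite mem_flat_act // => /(_ vs).
by rewrite -(mem_flat_act _ _ Wg) -mulmxA -(wz_mxM rW) // mulVg wz_mx1 mulmx1.
Qed.

Section FixedFaces.

Variable g : gT * 'Z_2.
Hypothesis Wg : g \in WZ.
Local Notation h := (wz_mx rW g).

Definition fixed_flat X := flat_action presA X g.1 == X.

Definition fixed_space : {vspace V} := lker (linfun (mulmxr h) - \1)%VF.

Lemma mem_fixed_space v : (v \in fixed_space) = (v *m h == v).
Proof. by rewrite memv_ker !lfunE /= !lfunE /= lfunE /= subr_eq0. Qed.

Variable x : face A.

(** Iterating y = (x y) g = (x g) (y g) gives y = (x g) (x g^2) ... (x g^k) (y g^k). With k the
    order of g, the product N of the translates of x is an initial factor of every fixed y, and N is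
    itself fixed. *)
Fixpoint orbit_prod k : face A :=
  if k is k'.+1 then face_mul (orbit_prod k') (act x (g ^+ k)%g) else face_of A 0.

Lemma face_of0 H : face_of A 0 H = None.
Proof. by apply/eqP; rewrite face_ofE side_None mem0v. Qed.

Lemma face_mul0 y : face_mul (face_of A 0) y = y.
Proof. by apply/faceP => H; rewrite face_mulE face_of0. Qed.

Lemma orbit_prod_None k H :
  orbit_prod k H = None <-> (forall i, (0 < i <= k)%N -> act x (g ^+ i)%g H = None).
Proof.
elim: k => [|k IH]; first by rewrite face_of0; split=> // _ [|i].
rewrite [orbit_prod _]/= face_mulE; split.
  case Nk: (orbit_prod k H) => [//|] e i /andP[i0]; rewrite leq_eqVlt => /orP[/eqP->//|ik].
  by apply: (IH.1 Nk); rewrite i0.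
move=> hi; have -> : orbit_prod k H = None.
  by apply/IH => i /andP[i0 ik]; apply: hi; rewrite i0 leqW.
by apply: hi; rewrite leqnn.
Qed.

Local Notation fixed y := (act (face_mul x y) g == y).
Local Notation N := (orbit_prod #[g]%g).

Lemma fixed_orbit_prod y k : fixed y -> y = face_mul (orbit_prod k) (act y (g ^+ k)%g).
Proof.
move=> /eqP fy; elim: k => [|k IH]; first by rewrite expg0 wz_act1 face_mul0.
rewrite {1}IH -{1}fy wz_act_mul // -/(orbit_prod k.+1) [orbit_prod _]/=.
rewrite wz_act_mul ?groupX // face_mulA -!wz_actM ?groupX //.
by rewrite -expgS.
Qed.

Lemma fixed_face_mul y : fixed y -> y = face_mul N y.
Proof. by move/(fixed_orbit_prod #[g]%g); rewrite expg_order wz_act1. Qed.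

Lemma orbit_prod_shift k :
  face_mul (act x g) (act (orbit_prod k) g) = orbit_prod k.+1.
Proof.
elim: k => [|k IH].
  rewrite /= face_mul0 expg1; apply/faceP => H; rewrite face_mulE.
  have [K [b ->]] := wz_act_face H Wg; case: (x K) => //=.
  by have [K' [b' ->]] := wz_act_face H Wg; rewrite face_of0.
rewrite [orbit_prod k.+1 in LHS]/= wz_act_mul // face_mulA IH -wz_actM ?groupX //.
by rewrite -expgSr.
Qed.

Lemma fixed_N : act (face_mul x N) g = N.
Proof.
(* The shift only appends the factor x g again, which N already contains. *)
rewrite wz_act_mul // orbit_prod_shift [orbit_prod _]/= expgS expg_order mulg1.
apply/faceP => H; rewrite face_mulE; case NH: (N H) => [//|].
by have /orbit_prod_None/(_ 1%N) := NH; rewrite order_gt0 expg1; apply.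
Qed.

(** The support of x y contains that of y, and g preserves dimensions; from (x y) g = y the two
    supports coincide, so this flat contains x and is fixed. *)
Lemma fixed_supp y : fixed y -> fixed_flat (supp y) && face_in x (supp y).
Proof.
move=> /eqP fy.
have sub : (val (supp y) <= val (supp (face_mul x y)))%VS.
  by have := face_in_mul x y (supp (face_mul x y)); rewrite -!face_in_supp face_in_supp subvv => /esym/andP[].
have e : supp (face_mul x y) = supp y.
  apply/val_inj/esym/eqP; rewrite -(eq_leqif (dimv_leqif_eq sub)); apply/eqP.
  rewrite -[in LHS]fy supp_act // val_flat_act ?WZ1 //.
  apply: limg_dim_eq; rewrite (_ : lker _ = 0%VS) ?capv0 //; apply/eqP/lker0P => u v.
  by rewrite !lfunE /=; apply: (can_inj (mulmxK (repr_mx_unit rW (WZ1 Wg)))).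
rewrite /fixed_flat -{1}e -supp_act // fy eqxx /= -e.
by have := face_in_mul x y (supp (face_mul x y)); rewrite face_in_supp subvv => /esym/andP[].
Qed.

End FixedFaces.
End Action.
End Faces.

(** * Counting the chambers c with (x c) g = c *)

Section FixedCount.

Variables (R : realType) (d : nat) (A : arrangement R d).
Local Notation V := 'rV[R]_d.
Variables (gT : finGroupType) (W : {group gT}) (rW : mx_representation R W d).
Hypothesis presA : preserves A rW.
Local Notation WZ := (setX_group W [set: 'Z_2]%G).
Local Notation act := (wz_act rW).
Implicit Types (y : face A) (X Y Z : flat A) (u v : V) (H K : A).

Section OneElement.

Variable g : gT * 'Z_2.
Hypothesis Wg : g \in WZ.
Local Notation U := (fixed_space rW g).

Section OneFace.

Variable x : face A.
Local Notation fixed y := (act (face_mul x y) g == y).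
Local Notation N := (orbit_prod rW g x #[g]%g).

Lemma mem_fixed_flat X v i : fixed_flat presA g X -> v \in val X ->
  v *m wz_mx rW (g ^+ i)%g \in val X.
Proof.
move=> /eqP fX; elim: i v => [|i IH] v vX; first by rewrite expg0 wz_mx1 mulmx1.
by rewrite expgS (wz_mxM rW) ?groupX // mulmxA; apply: IH; rewrite -fX mem_flat_act.
Qed.

Lemma face_in_act X y i : fixed_flat presA g X -> face_in y X -> face_in (act y (g ^+ i)%g) X.
Proof.
move=> fX yX; apply/face_inE => H XH; apply/eqP.
rewrite (wz_act_side presA H _ (face_pointK y)) ?groupX // side_None; apply: (subvP XH).
by apply: mem_fixed_flat fX _; rewrite -face_in_point.
Qed.

Lemma face_in_orbit_prod X : fixed_flat presA g X -> face_in x X -> face_in N X.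
Proof.
move=> fX xX; apply/face_inE => H XH; apply/(orbit_prod_None rW g x) => i _.
by move: H XH; apply/face_inE; apply: face_in_act.
Qed.

Lemma face_in_face_of u X : face_in (face_of A u) X = (u \in val X).
Proof.
apply/idP/idP => [/asboolP h|uX]; first exact: h.
apply/face_inE => H XH; apply/eqP; rewrite face_ofE side_None.
exact: (subvP XH).
Qed.

(* The faces y with (x y) g = y correspond to the fixed faces of the
   localization at the smallest fixed flat containing x. *)
Lemma euler_fixed_faces X : fixed_flat presA g X -> face_in x X ->
  \sum_(y | fixed y && face_in y X) (-1) ^+ \dim (val (supp y) :&: U)%VS
  = (-1) ^+ \dim (val X :&: U)%VS :> R.
Proof.
(* B consists of the hyperplanes containing every translate of x. Off B the sides of a fixed y are
   those of N, so y is determined by its sides on B. *)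
move=> fX xX; pose B := [set H | N H == None].
have NB H : N H = None <-> H \in B by rewrite inE; split=> [->|/eqP].
pose rho y : {ffun A -> option bool} := [ffun H => if H \in B then y H else None].
pose Y := [set y | fixed y && face_in y X].
have inY y : (y \in Y) = fixed y && face_in y X by rewrite in_set.
have face_of_U u : u \in (val X :&: U)%VS -> face_mul N (face_of A u) \in Y
    /\ rho (face_mul N (face_of A u)) = sides_on B u.
  rewrite memv_cap mem_fixed_space => /andP[uX /eqP uU]; split; last first.
    apply/ffunP => H; rewrite !ffunE; case: ifP => // HB.
    by rewrite ((NB H).2 HB).
  rewrite inY face_in_mul face_in_orbit_prod // face_in_face_of uX !andbT.
  rewrite face_mulA wz_act_mul // fixed_N //.
  by rewrite /wz_act Wg (face_image_of presA) // uU.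
have fixedY y : y \in Y -> fixed y /\ face_in y X by rewrite inY => /andP.
have invol y : y \in Y -> exists2 u, u \in (val X :&: U)%VS & rho y = sides_on B u.
  move=> /fixedY[fy yX]; pose v := face_point y.
  have vX : v \in val X by rewrite -face_in_point.
  have side_v H i : H \in B -> (i < #[g]%g)%N -> side H (v *m wz_mx rW (g ^+ i)%g) = side H v.
    move=> /NB /(orbit_prod_None rW g x) NH ig.
    have Ni : orbit_prod rW g x i H = None.
      by apply/(orbit_prod_None rW g x) => j /andP[j0 ji]; apply: NH; rewrite j0 (leq_trans ji (ltnW ig)).
    rewrite -(wz_act_side presA H _ (face_pointK y)) ?groupX // [in RHS]face_pointE.
    by rewrite [in RHS](fixed_orbit_prod presA Wg i fy) face_mulE Ni.
  (* Summing the g-orbit of a point of y gives a g-fixed vector; on B all the summands have the same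
     sides, hence so does the sum. *)
  pose S n := \sum_(i < n) v *m wz_mx rW (g ^+ i)%g.
  have sideS H n : H \in B -> (n < #[g]%g)%N -> side H (S n.+1) = side H v.
    move=> HB; elim: n => [|n IH] lt_n.
      by rewrite /S big_ord_recr big_ord0 /= add0r expg0 wz_mx1 mulmx1.
    rewrite /S big_ord_recr /= -/(S n.+1); have IHn := IH (ltnW lt_n).
    by rewrite sideD IHn // side_v.
  have o1 : (#[g]%g = #[g]%g.-1.+1)%N by rewrite prednK // order_gt0.
  exists (S #[g]%g).
    rewrite memv_cap; apply/andP; split.
      by apply: memv_suml => i _; apply: mem_fixed_flat fX vX.
    rewrite mem_fixed_space /S mulmx_suml o1 [in X in _ == X]big_ord_recl big_ord_recr /=.
    rewrite addrC -mulmxA -[X in _ *m X]wz_mxM ?groupX // -expgSr -o1 expg_order expg0.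
    apply/eqP; congr (_ + _); apply: eq_bigr => i _.
    by rewrite -mulmxA -[X in _ *m X]wz_mxM ?groupX // -expgSr.
  apply/ffunP => H; rewrite !ffunE; case: ifP => // HB.
  by rewrite -face_pointE -/v o1 sideS // -o1.
have rho_inj : {in Y &, injective rho}.
  move=> y z /fixedY[fy _] /fixedY[fz _] yz; apply/faceP => H.
  rewrite (fixed_face_mul presA Wg fy) (fixed_face_mul presA Wg fz) !face_mulE.
  case NH: (N H) => [//|]; have HB : H \in B by apply/NB.
  by have /ffunP/(_ H) := yz; rewrite !ffunE HB.
have rhoY : rho @: Y = cells B (val X :&: U).
  apply/setP => s; apply/imsetP/cellsP => [[y yY ->]|[u uXU ->]]; first exact: invol.
  by have [fY e] := face_of_U u uXU; exists (face_mul N (face_of A u)).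
rewrite -(euler_cells B) -rhoY big_imset //=.
apply: eq_big => [y|y]; first by rewrite inY.
move=> /andP[fy yX]; congr (_ ^+ \dim _).
have -> : zero_space B (rho y) = val (supp y).
  apply/vspaceP => v; apply/idP/idP.
    move=> /mem_bigcapv h; apply/mem_supp => H yH; apply: h.
    have HB : H \in B.
      by apply/NB; have := yH; rewrite (fixed_face_mul presA Wg fy) face_mulE; case: (N H).
    by rewrite HB ffunE HB yH eqxx.
  by move=> /mem_supp h; apply/mem_bigcapv => H /andP[HB]; rewrite ffunE HB => /eqP; apply: h.
by rewrite [(val X :&: U)%VS]capvC -capvA [RHS]capvC; congr (_ :&: _)%VS; rewrite capvC;
  apply/esym/capv_idPl; rewrite -face_in_supp.
Qed.

End OneFace.

Definition fixed_proper_flats := [set X | fixed_flat presA g X && (val X != fullv)].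

(* The Moebius function mu(X, V) of the poset of g-fixed flats, written by
   Philip Hall's theorem as an alternating sum over chains. *)
Definition fixed_mobius X : R :=
  if X == flat_full A then chain_euler presA X g.1 else - chain_euler presA X g.1.

(** A chain fixed as a set is fixed element by element, since g preserves dimensions and these are
    distinct along a chain. *)
Lemma chain_eulerE X : chain_euler presA X g.1 = chain_sum R (@flat_lt R d A) fixed_proper_flats X.
Proof.
have W1 := WZ1 Wg.
have fixedE k : fixed_chains presA X k g.1
    = [set s in chains_before (@flat_lt R d A) fixed_proper_flats X | #|s| == k].
  apply/setP => s; rewrite inE [in RHS]inE; apply/andP/andP.
    move=> [/chainsP[sk /subsetP sI ch] /eqP fs]; split; last exact/eqP.
    rewrite inE ch andbT; apply/subsetP => Z sZ.
    have := sI Z sZ; rewrite 3!inE => /andP[-> ->]; rewrite !andbT.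
    have sZw : flat_action presA Z g.1 \in s by rewrite -fs; apply: imset_f.
    apply/eqP/(chain_dim_inj ch sZw sZ); rewrite val_flat_act //.
    apply: limg_dim_eq; rewrite (_ : lker _ = 0%VS) ?capv0 //; apply/eqP/lker0P => u v.
    by rewrite !lfunE /=; apply: (can_inj (mulmxK (repr_mx_unit rW W1))).
  rewrite inE => -[/andP[/subsetP sD ch] /eqP sk]; split.
    apply/chainsP; split=> //; apply/subsetP => Z /sD; rewrite !inE.
    by case/andP=> /andP[_ ->] ->.
  have fs Z : Z \in s -> flat_action presA Z g.1 = Z.
    by move=> /sD; rewrite !inE => /andP[/andP[/eqP]].
  apply/eqP/setP => Z; apply/imsetP/idP => [[Z' sZ' ->]|sZ]; first by rewrite fs.
  by exists Z; rewrite ?fs.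
rewrite /chain_euler /chain_sum.
rewrite (partition_big (fun s : {set flat A} => inord #|s| : 'I_#|{: flat A}|.+1) xpredT) //=.
apply: eq_bigr => k _; rewrite fixedE mulr_natr -sumr_const.
apply: eq_big => [s|s].
  rewrite inE; congr (_ && _); rewrite -val_eqE /= inordK // ltnS.
  exact: max_card.
by rewrite inE => /andP[_ /eqP ->].
Qed.

Lemma fixed_mobius_sum Z : fixed_flat presA g Z ->
  \sum_(X | fixed_flat presA g X && (val Z <= val X)%VS) fixed_mobius X
  = (Z == flat_full A)%:R.
Proof.
move=> fZ; have fV : fixed_flat presA g (flat_full A).
  apply/eqP; apply: val_inj; rewrite val_flat_act ?WZ1 //=.
  apply: lker0_limgf; apply/lker0P => u v.
  by rewrite !lfunE /=; apply: (can_inj (mulmxK (repr_mx_unit rW (WZ1 Wg)))).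
have muV : fixed_mobius (flat_full A) = 1.
  rewrite /fixed_mobius eqxx chain_eulerE chain_sum_rec; [|exact: flat_lt_irr|exact: flat_lt_trans].
  rewrite big_pred0 ?subr0 // => X; rewrite flat_ltE dim_flat_full ltnNge dim_flat_le.
  by rewrite !andbF.
rewrite (bigD1 (flat_full A)) /=; last by rewrite fV subvf.
rewrite muV; have [->|ZV] := eqVneq Z (flat_full A).
  rewrite big_pred0 ?addr0 // => X; apply/negP => /andP[/andP[_ h] /eqP]; apply.
  by apply/val_inj/eqP; rewrite eqEsubv subvf.
rewrite (bigD1 Z) /=; last by rewrite fZ subvv.
rewrite {1}/fixed_mobius (negPf ZV) chain_eulerE chain_sum_rec; [|exact: flat_lt_irr|exact: flat_lt_trans].
rewrite opprB addrA addrCA subrr addr0 -[X in _ + X](opprK) -sumrN.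
apply/eqP; rewrite subr_eq0; apply/eqP; apply: eq_big => [X|X].
  have -> : (X \in fixed_proper_flats) = fixed_flat presA g X && (X != flat_full A).
    by rewrite inE -[X == _]val_eqE.
  by rewrite /flat_lt [Z == X]eq_sym -!andbA; congr (_ && _); rewrite andbCA.
by rewrite inE -andbA => /and3P[_ XV _]; rewrite /fixed_mobius ifN ?opprK ?chain_eulerE //.
Qed.

(** Among the faces y with (x y) g = y the chambers are singled out by the Moebius sum over the
    fixed flats above the support of y. After exchanging the sums, the sum over the y in X is
    [euler_fixed_faces]. *)
Lemma fixed_count x :
  #|[set c in chambers A | act (face_mul x c) g == c]|%:R
  = \sum_(X | fixed_flat presA g X && face_in x X)
      (-1) ^+ (\dim U + \dim (val X :&: U)%VS) * fixed_mobius X :> R.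
Proof.
under eq_bigr do rewrite exprD -mulrA.
rewrite -big_distrr /=; set S := \sum_(X | _) _.
suff -> : S = (-1) ^+ \dim U * #|[set c in chambers A | act (face_mul x c) g == c]|%:R.
  by rewrite mulrA -expr2 sqrr_sign mul1r.
transitivity (\sum_(X | fixed_flat presA g X && face_in x X)
    \sum_(y | (act (face_mul x y) g == y) && face_in y X)
      (-1) ^+ \dim (val (supp y) :&: U)%VS * fixed_mobius X).
  by apply: eq_bigr => X /andP[fX xX]; rewrite -big_distrl /= euler_fixed_faces.
rewrite (exchange_big_dep (fun y => act (face_mul x y) g == y)) /=; last by move=> X y _ /andP[].
transitivity (\sum_(y | act (face_mul x y) g == y)
   (-1) ^+ \dim (val (supp y) :&: U)%VS * (supp y == flat_full A)%:R : R).
  apply: eq_bigr => y fy; rewrite -big_distrr /=; congr (_ * _).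
  have /andP[fs xs] := fixed_supp presA Wg fy; rewrite -(fixed_mobius_sum fs).
  apply: eq_bigl => X; rewrite fy /= -face_in_supp; case: (fixed_flat presA g X) => //=.
  rewrite andbC; case yX: (face_in y X) => //=.
  by rewrite face_in_supp in xs; rewrite face_in_supp (subv_trans xs) // -face_in_supp.
rewrite -sum1_card natr_sum big_distrr [RHS](eq_bigl
  (fun y => (act (face_mul x y) g == y) && (supp y == flat_full A))) => [|y]; last first.
  by rewrite inE chamber_supp andbC.
rewrite big_mkcondr; apply: eq_bigr => y _; have [e|_] := eqVneq (supp y) (flat_full A); last by rewrite mulr0.
by rewrite e capfv.
Qed.

End OneElement.
End FixedCount.

(** * The face walk *)

Section PolynomialMatrix.

Variable F : fieldType.

(** [horner_mx] acts on sizes [n.+1], and the number of chambers is not of this shape; in size 0 all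
    matrices agree, so the value 0 is harmless. *)
Definition polymx n : 'M[F]_n -> {poly F} -> 'M[F]_n :=
  if n is n'.+1 then fun T f => horner_mx (T : 'M[F]_n'.+1) f else fun _ _ => 0.

Lemma polymxD n (T : 'M_n) f g : polymx T (f + g) = polymx T f + polymx T g.
Proof. by case: n T => [|n] T; [rewrite [LHS]flatmx0 [RHS]flatmx0 | apply: rmorphD]. Qed.

Lemma polymxM n (T : 'M_n) f g : polymx T (f * g) = polymx T f *m polymx T g.
Proof. by case: n T => [|n] T; [rewrite [LHS]flatmx0 [RHS]flatmx0 | apply: rmorphM]. Qed.

Lemma polymxC n (T : 'M_n) c : polymx T c%:P = c%:M.
Proof. by case: n T => [|n] T; [rewrite [LHS]flatmx0 [RHS]flatmx0 | apply: horner_mx_C]. Qed.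

Lemma polymxX n (T : 'M_n) : polymx T 'X = T.
Proof. by case: n T => [|n] T; [rewrite [LHS]flatmx0 [RHS]flatmx0 | apply: horner_mx_X]. Qed.

Lemma polymx_XsubC n (T : 'M_n) c : polymx T ('X - c%:P) = T - c%:M.
Proof. by rewrite -polyCN polymxD polymxX polymxC raddfN. Qed.

Lemma kermx_polymx n (T : 'M_n) f : kermx (polymx T f) = kermxpoly T f.
Proof. by case: n T => [|n] T //; rewrite [LHS]flatmx0 [RHS]flatmx0. Qed.

Lemma polymx_eigen m n (T : 'M_n) (v : 'M_(m, n)) mu f :
  v *m T = mu *: v -> v *m polymx T f = f.[mu] *: v.
Proof.
move=> vT; elim/poly_ind: f => [|f c IH].
  by rewrite horner0 scale0r -polyC0 polymxC raddf0 mulmx0.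
rewrite polymxD polymxM polymxX polymxC mulmxDr mulmxA IH -scalemxAl vT scalerA.
by rewrite mul_mx_scalar hornerMXaddC scalerDl.
Qed.

Lemma kermx_prod_XsubC n (T : 'M_n) (s : seq F) : uniq s ->
  (kermx (polymx T (\prod_(mu <- s) ('X - mu%:P))) :=: \sum_(mu <- s) eigenspace T mu)%MS.
Proof.
rewrite kermx_polymx; elim: s => [_|mu s IH /= /andP[mus us]].
  by rewrite !big_nil kermxpoly1.
rewrite !big_cons; apply: eqmx_trans (kermxpolyM _ _) _.
  by rewrite coprimep_sym coprimep_XsubC root_prod_XsubC.
by apply: adds_eqmx (IH us); rewrite eigenspace_poly.
Qed.

End PolynomialMatrix.

(** * Spectrum of the face walk *)

Section Walk.

Variables (R : realType) (d : nat) (A : arrangement R d).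
Implicit Types (x y z : face A) (X Y Z : flat A).
Local Notation n := #|chambers A|.

Definition face_mx x : 'M[R]_n :=
  \matrix_(i, j) (face_mul x (enum_val i) == enum_val j)%:R.

Lemma chamberP (c : face A) : reflect (forall H, c H != None) (c \in chambers A).
Proof. by rewrite inE; apply: forallP. Qed.

Lemma face_mul_chamber x (c : face A) : c \in chambers A -> face_mul x c \in chambers A.
Proof. by move=> /chamberP h; apply/chamberP => H; rewrite face_mulE; case: (x H). Qed.

Lemma mul_mx_chamber x m (M : 'M[R]_(n, m)) i j :
  (face_mx x *m M) i j
  = M (enum_rank_in (face_mul_chamber x (enum_valP i)) (face_mul x (enum_val i))) j.
Proof.
set k := enum_rank_in _ _.
have kE : enum_val k = face_mul x (enum_val i).
  by rewrite enum_rankK_in // face_mul_chamber // enum_valP.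
rewrite mxE (bigD1 k) //= big1 ?addr0 => [|l lk]; first by rewrite mxE kE eqxx mul1r.
by rewrite mxE -kE (inj_eq enum_val_inj) eq_sym (negPf lk) mul0r.
Qed.

(** Rows are acted on from the right: applying x and then y to c yields y (x c), whence the reversed
    product. *)
Lemma face_mxM x y : face_mx x *m face_mx y = face_mx (face_mul y x).
Proof.
apply/matrixP => i j; rewrite mul_mx_chamber !mxE enum_rankK_in ?face_mul_chamber ?enum_valP //.
by rewrite face_mulA.
Qed.

Lemma face_mx0 : face_mx (face_of A 0) = 1%:M.
Proof. by apply/matrixP => i j; rewrite !mxE face_mul0 (inj_eq enum_val_inj). Qed.

Variable p : face A -> R.
Hypothesis p_ge0 : forall x, 0 <= p x.
Local Notation T := (walk_mx p).
Local Notation lam X := (walk_eigenvalue p X).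

Lemma walk_mxE : T = \sum_x p x *: face_mx x.
Proof.
apply/matrixP => i j; rewrite summxE mxE big_mkcond /=.
by apply: eq_bigr => x _; rewrite !mxE mulr_natr mulrb.
Qed.

Lemma walk_eigenvalueE X : lam X = \sum_(x | face_in x X) p x.
Proof. by []. Qed.

Lemma le_walk_eigenvalue X Y : (val X <= val Y)%VS -> lam X <= lam Y.
Proof.
move=> XY; rewrite !walk_eigenvalueE big_mkcond [leRHS]big_mkcond /=; apply: ler_sum => x _.
rewrite !face_in_supp; case E: (val (supp x) <= val X)%VS; first by rewrite (subv_trans E).
by case: ifP.
Qed.

Lemma walk_mulE y : T *m face_mx y = \sum_x p x *: face_mx (face_mul y x).
Proof.
by rewrite walk_mxE mulmx_suml; apply: eq_bigr => x _; rewrite -scalemxAl face_mxM.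
Qed.

Lemma walk_mul_face y : T *m face_mx y - lam (supp y) *: face_mx y
  = \sum_(x | ~~ face_in x (supp y)) p x *: face_mx (face_mul y x).
Proof.
rewrite walk_mulE (bigID (fun x => face_in x (supp y))) /= walk_eigenvalueE scaler_suml.
rewrite addrAC -sumrB big1 ?add0r // => x xy.
rewrite (_ : face_mul y x = y) ?subrr //; apply/faceP => H.
rewrite face_mulE; case yH: (y H) => [//|]; move/face_inE: xy; apply.
by apply/subvP => v /mem_supp; apply.
Qed.

Lemma supp_mul_l x y : (val (supp x) <= val (supp (face_mul x y)))%VS.
Proof.
have := face_in_mul x y (supp (face_mul x y)); rewrite -!face_in_supp.
by rewrite face_in_supp subvv => /esym/andP[].
Qed.

Lemma supp_mul_r x y : face_in y (supp (face_mul x y)).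
Proof.
have := face_in_mul x y (supp (face_mul x y)).
by rewrite face_in_supp subvv => /esym/andP[].
Qed.

(** The face x lies in the support of [y x] but not in that of y, and has positive weight. *)
Lemma lt_walk_eigenvalue x y : ~~ face_in x (supp y) -> p x != 0 ->
  lam (supp y) < lam (supp (face_mul y x)).
Proof.
move=> xy px; have := supp_mul_l y x => sub.
rewrite !walk_eigenvalueE [ltRHS](bigD1 x) ?supp_mul_r //=.
rewrite -[ltLHS]add0r; apply: ltr_leD; first by rewrite lt_def px p_ge0.
rewrite big_mkcond [leRHS]big_mkcond /=; apply: ler_sum => z _.
have [zx|zx] := eqVneq z x; first by rewrite zx (negPf xy) andbF.
rewrite andbT !face_in_supp; case E: (val (supp z) <= val (supp y))%VS; first by rewrite (subv_trans E).
by case: ifP.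
Qed.

Definition killed_above c m (M : 'M[R]_(m, n)) :=
  forall y, c < lam (supp y) -> M *m face_mx y = 0.

(** T followed by y is a combination of faces [y x], whose supports contain that of y and so have
    eigenvalues at least as large. *)
Lemma killed_above_polymx c m (M : 'M[R]_(m, n)) f :
  killed_above c M -> killed_above c (M *m polymx T f).
Proof.
move=> Mc; elim/poly_ind: f => [|f a IH] y cy.
  by rewrite -polyC0 polymxC raddf0 mulmx0 mul0mx.
rewrite polymxD polymxM polymxX polymxC mulmxDr mulmxDl mul_mx_scalar -scalemxAl Mc // scaler0 addr0.
rewrite mulmxA -mulmxA walk_mulE mulmx_sumr big1 // => x _.
rewrite -scalemxAr IH ?scaler0 //.
by apply: lt_le_trans cy _; apply/le_walk_eigenvalue/supp_mul_l.
Qed.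

Definition eigenvalues := undup [seq lam X | X : flat A].

Lemma mem_eigenvalues X : lam X \in eigenvalues.
Proof. by rewrite mem_undup; apply: image_f. Qed.

(* y (T - lam_Y) is a combination of faces y x with larger support. *)
Lemma killed_above_prod c m (M : 'M[R]_(m, n)) y : killed_above c M ->
  M *m polymx T (\prod_(mu <- eigenvalues | lam (supp y) <= mu <= c) ('X - mu%:P)) *m face_mx y = 0.
Proof.
have [k] := ubnP (count (fun mu => lam (supp y) < mu) eigenvalues).
elim: k m M y => // k IH m M y; rewrite ltnS => ck Mc.
have [cy|yc] := ltP c (lam (supp y)).
  by rewrite -mulmxA; rewrite mulmxA; apply: (killed_above_polymx _ Mc).
pose P t := \prod_(mu <- eigenvalues | t < mu <= c) ('X - mu%:P).
rewrite -big_filter (bigD1_seq (lam (supp y))) ?filter_uniq ?undup_uniq //=; last first.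
  by rewrite mem_filter lexx yc mem_eigenvalues.
rewrite big_filter_cond (eq_bigl (fun mu => lam (supp y) < mu <= c)) => [|mu]; last first.
  by rewrite [in RHS]lt_def [LHS]andbC [LHS]andbA.
rewrite -/(P _) mulrC polymxM polymx_XsubC mulmxA -!mulmxA mulmxBl mul_scalar_mx walk_mul_face.
rewrite !mulmx_sumr big1 // => x xy; rewrite -!scalemxAr.
have [->|px] := eqVneq (p x) 0; first by rewrite scale0r.
have lt_yx := lt_walk_eigenvalue xy px.
(* The factors with mu below the eigenvalue of [y x] are absorbed into M, which stays killed above
   c; the others form the product in the induction hypothesis for [y x], above which fewer
   eigenvalues remain. *)
have -> : P (lam (supp y)) =
   \prod_(mu <- eigenvalues | (lam (supp y) < mu <= c) && ~~ (lam (supp (face_mul y x)) <= mu)) ('X - mu%:P)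
   * \prod_(mu <- eigenvalues | lam (supp (face_mul y x)) <= mu <= c) ('X - mu%:P).
  rewrite /P (bigID (fun mu => lam (supp (face_mul y x)) <= mu)) /= mulrC; congr (_ * _).
  apply: eq_bigl => mu; rewrite andbC andbA; case E: (_ <= mu) => //=.
  by rewrite (lt_le_trans lt_yx E).
rewrite polymxM !mulmxA -[X in _ *: X]mulmxA mulmxA IH ?scaler0 //.
  apply: leq_trans ck; rewrite -!size_filter.
  apply: (@leq_trans (size (lam (supp (face_mul y x)) :: filter (fun mu => lam (supp (face_mul y x)) < mu) eigenvalues))) => //.
  apply: uniq_leq_size; first by rewrite /= mem_filter ltxx /= filter_uniq ?undup_uniq.
  move=> mu; rewrite inE !mem_filter => /orP[/eqP ->|/andP[h ->]]; first by rewrite lt_yx mem_eigenvalues.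
  by rewrite (lt_trans lt_yx h).
exact: killed_above_polymx.
Qed.

Definition walk_kernel (c : R) := (\bigcap_(y | (c < lam (supp y))%R) kermx (face_mx y))%MS.

Lemma walk_kernelP c m (M : 'M[R]_(m, n)) :
  reflect (killed_above c M) (M <= walk_kernel c)%MS.
Proof.
apply: (iffP sub_bigcapmxP) => h y cy; first exact/sub_kermxP/h.
exact/sub_kermxP/h.
Qed.

(** The case of [killed_above_prod] where c is the eigenvalue of V: no face has a larger one, so the
    identity matrix is killed above c. *)
Lemma prod_ge_mul_face y :
  polymx T (\prod_(mu <- eigenvalues | lam (supp y) <= mu) ('X - mu%:P)) *m face_mx y = 0.
Proof.
have h : killed_above (lam (flat_full A)) (1%:M : 'M[R]_n).
  by move=> z; rewrite ltNge le_walk_eigenvalue // subvf.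
have := killed_above_prod y h; rewrite mul1mx => <-; congr (polymx _ _ *m _).
rewrite big_seq_cond [RHS]big_seq_cond; apply: eq_bigl => mu.
case mu_ev: (mu \in _) => //=; move: mu_ev; rewrite mem_undup => /mapP[X _ ->].
by rewrite [lam X <= lam (flat_full A)]le_walk_eigenvalue ?subvf ?andbT.
Qed.

(** The case where y is the face of 0: it acts as the identity, and its eigenvalue is the smallest
    one. *)
Lemma killed_above_prod_le c m (M : 'M[R]_(m, n)) : killed_above c M ->
  M *m polymx T (\prod_(mu <- eigenvalues | mu <= c) ('X - mu%:P)) = 0.
Proof.
move=> /(killed_above_prod (face_of A 0)); rewrite face_mx0 mulmx1 => <-.
congr (_ *m polymx _ _); rewrite big_seq_cond [RHS]big_seq_cond; apply: eq_bigl => mu.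
case mu_ev: (mu \in _) => //=; move: mu_ev; rewrite mem_undup => /mapP[X _ ->].
rewrite le_walk_eigenvalue // -face_in_supp; apply/face_inE => H _; exact: face_of0.
Qed.

(** On an eigenvector the polynomial of [prod_ge_mul_face] is a scalar, nonzero since mu lies below
    all its roots; so the face itself kills the eigenvector. *)
Lemma eigenspace_sub_kernel c mu : mu <= c -> (eigenspace T mu <= walk_kernel c)%MS.
Proof.
move=> mu_c; apply/walk_kernelP => y cy.
have vT : eigenspace T mu *m T = mu *: eigenspace T mu by apply/eigenspaceP.
have := congr1 (mulmx (eigenspace T mu)) (prod_ge_mul_face y).
rewrite mulmx0 mulmxA (polymx_eigen _ vT) -scalemxAl => /eqP; rewrite scaler_eq0.
case/orP => [|/eqP //]; rewrite horner_prod prodf_seq_eq0 => /hasP[nu _ /andP[y_nu]].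
by rewrite hornerXsubC subr_eq0 => /eqP e; move: (lt_le_trans (le_lt_trans mu_c cy) y_nu); rewrite e ltxx.
Qed.

(** For the inclusion of the right side, the product of the distinct factors with mu up to c kills
    [walk_kernel c], and the kernel of such a product is a sum of eigenspaces. This is where
    diagonalizability comes from. *)
Lemma walk_leE c : (walk_le p c :=: walk_kernel c)%MS.
Proof.
apply/eqmxP/andP; split.
  rewrite /walk_le; elim/big_ind: _ => [|M N hM hN|mu mu_c]; first exact: sub0mx.
    by rewrite addsmx_sub hM.
  exact: eigenspace_sub_kernel.
have K0 := killed_above_prod_le ((walk_kernelP c _) (submx_refl (walk_kernel c))).
pose s := [seq mu <- eigenvalues | mu <= c]; rewrite -big_filter -/s in K0.
have : (walk_kernel c <= kermx (polymx T (\prod_(mu <- s) ('X - mu%:P))))%MS.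
  by apply/sub_kermxP.
rewrite kermx_prod_XsubC ?filter_uniq ?undup_uniq // => /submx_trans; apply.
rewrite big_filter; elim/big_ind: _ => [|M N hM hN|mu mu_c]; first exact: sub0mx.
  by rewrite addsmx_sub hM.
(* A value attached to a flat need not be an eigenvalue of T; then its eigenspace is 0 and it may be
   missing from the roots. *)
have [->|ev] := eqVneq (eigenspace T mu) 0; first exact: sub0mx.
have mu_r : mu \in rootsR (char_poly T).
  rewrite -roots_on_rootsR ?monic_neq0 ?char_poly_monic //=.
  by rewrite -eigenvalue_root_char.
by rewrite /walk_le (big_rem mu) //= mu_c addsmxSl.
Qed.

(** With u P1 + v P2 = 1, where P1 has the roots up to c and P2 the others, f is v P2: it vanishes
    at the roots of P2 and is 1 at those of P1. *)
Lemma walk_projector c : exists f : {poly R},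
  [/\ (polymx T f <= walk_kernel c)%MS, walk_kernel c *m polymx T f = walk_kernel c
    & forall X, f.[lam X] = (lam X <= c)%R%:R].
Proof.
pose P1 := \prod_(mu <- eigenvalues | mu <= c) ('X - mu%:P).
pose P2 := \prod_(mu <- eigenvalues | ~~ (mu <= c)) ('X - mu%:P).
have cop : coprimep P1 P2.
  rewrite /P2; elim/big_ind: _ => [|f g|nu nu_c]; first exact: coprimep1.
    by rewrite coprimepMr => ->.
  rewrite coprimep_XsubC rootE horner_prod prodf_seq_eq0; apply/hasPn => mu _.
  by rewrite hornerXsubC subr_eq0 negb_and; case: eqP => [<-|]; rewrite ?nu_c ?orbT.
have root0 X (Q : pred R) : Q (lam X) ->
    (\prod_(mu <- eigenvalues | Q mu) ('X - mu%:P)).[lam X] = 0.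
  move=> QX; apply/eqP; rewrite horner_prod prodf_seq_eq0; apply/hasP.
  by exists (lam X); rewrite ?mem_eigenvalues ?QX //= hornerXsubC subrr eqxx.
have /Bezout_eq1_coprimepP[[u v] /= uv] := cop.
exists (v * P2); split.
- apply/walk_kernelP => y cy.
  have -> : P2 = \prod_(mu <- eigenvalues | ~~ (mu <= c) && ~~ (lam (supp y) <= mu)) ('X - mu%:P)
      * \prod_(mu <- eigenvalues | lam (supp y) <= mu) ('X - mu%:P).
    rewrite /P2 (bigID (fun mu => lam (supp y) <= mu)) /= mulrC; congr (_ * _).
    apply: eq_bigl => mu; rewrite andbC; case E: (_ <= mu) => //=.
    by rewrite -ltNge (lt_le_trans cy E).
  by rewrite !polymxM -!mulmxA prod_ge_mul_face !mulmx0.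
- have KP1 := killed_above_prod_le ((walk_kernelP c _) (submx_refl (walk_kernel c))).
  rewrite -/P1 in KP1; have := congr1 (fun M => walk_kernel c *m polymx T M) uv.
  rewrite /= -[1]/(1%:P) polymxC mulmx1 [u * P1]mulrC polymxD mulmxDr [polymx T (P1 * u)]polymxM mulmxA. by rewrite KP1 mul0mx add0r.
move=> X; have := congr1 (horner^~ (lam X)) uv; rewrite /= hornerD !hornerM hornerC.
have [Xc|Xc] := boolP (lam X <= c).
  by rewrite (root0 X (fun mu => mu <= c)) // mulr0 add0r.
by rewrite (root0 X (fun mu => ~~ (mu <= c))) // mulr0.
Qed.

(** Containment in X is multiplicative on faces, by [face_in_mul], so summing coefficients over the
    faces in X is an algebra homomorphism to R; it sends T to its eigenvalue at X. *)
Lemma polymx_faces f : exists q : face A -> R,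
  polymx T f = \sum_x q x *: face_mx x
  /\ forall X, \sum_(x | face_in x X) q x = f.[lam X].
Proof.
elim/poly_ind: f => [|f c [q [qT qX]]].
  exists (fun=> 0); split; first by rewrite -polyC0 polymxC raddf0 big1 // => x _; rewrite scale0r.
  by move=> X; rewrite horner0 big1.
pose pr (xy : face A * face A) := face_mul xy.2 xy.1.
exists (fun z => \sum_(xy | pr xy == z) q xy.1 * p xy.2 + c *+ (z == face_of A 0)); split.
  rewrite polymxD polymxM polymxX polymxC qT [in LHS]walk_mxE.
  under [RHS]eq_bigr do rewrite scalerDl scaler_suml.
  rewrite big_split /=; congr (_ + _); last first.
    rewrite (bigD1 (face_of A 0)) //= eqxx mulr1n face_mx0 scalemx1 big1 ?addr0 // => x x0.
    by rewrite (negPf x0) mulr0n scale0r.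
  rewrite mulmx_suml (eq_bigr (fun x => \sum_y (q x * p y) *: face_mx (face_mul y x))) => [|x _].
    rewrite pair_big (partition_big pr xpredT) //=; apply: eq_bigr => z _.
    by apply: eq_bigr => xy /eqP <-.
  rewrite mulmx_sumr; apply: eq_bigr => y _.
  by rewrite -scalemxAl -scalemxAr scalerA face_mxM.
move=> X; rewrite hornerMXaddC -qX walk_eigenvalueE big_split /=; congr (_ + _); last first.
  rewrite (bigD1 (face_of A 0)) /= ?eqxx ?mulr1n ?big1 ?addr0 // => [x /andP[_ /negPf->] //|].
  by apply/face_inE => H _; apply: face_of0.
rewrite big_distrl /=; under [RHS]eq_bigr do rewrite big_distrr /=.
rewrite [RHS]pair_big_dep /= [RHS](partition_big pr (fun z => face_in z X)) /=.
  apply: eq_bigr => z zX; apply: eq_bigl => xy; case: eqP => [e|]; rewrite ?andbF // andbT.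
  by rewrite andbC -face_in_mul -/(pr xy) e zX.
by move=> xy /andP[xX yX]; rewrite face_in_mul yX.
Qed.

Section Action.

Variables (gT : finGroupType) (W : {group gT}) (rW : mx_representation R W d).
Hypothesis presA : preserves A rW.
Hypothesis p_invariant : forall w x, w \in W -> p (face_image (rW w) x) = p x.
Local Notation WZ := (setX_group W [set: 'Z_2]%G).
Local Notation act := (wz_act rW).

Lemma face_in_act_iff g y X : g \in WZ ->
  face_in (act y g) (flat_action presA X g.1) = face_in y X.
Proof.
move=> Wg; rewrite !face_in_supp (supp_act presA) //.
have inj : lker (linfun (mulmxr (rW g.1)) : 'End('rV[R]_d)) == 0%VS.
  apply/lker0P => u v; rewrite !lfunE /=.
  exact: (can_inj (mulmxK (repr_mx_unit rW (WZ1 Wg)))).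
by rewrite !val_flat_act ?(WZ1 Wg) // limg_ker0.
Qed.

Lemma walk_eigenvalue_act X w : w \in W -> lam (flat_action presA X w) = lam X.
Proof.
move=> Ww; have Wg : (w, 1%g) \in WZ by rewrite inE Ww inE.
rewrite !walk_eigenvalueE (reindex_inj (act_inj (wz_action presA) (w, 1%g))) /=.
apply: eq_big => [x|x _]; first exact: (face_in_act_iff x X Wg).
rewrite /wz_act Wg -[RHS](p_invariant x Ww); congr (p (face_image _ x)).
by rewrite /wz_mx expr0 scale1r.
Qed.

Lemma chamber_repr_face_mx g x : g \in WZ ->
  face_mx x *m chamber_repr presA g = chamber_repr presA g *m face_mx (act x g).
Proof.
move=> Wg; apply/matrixP => i j; rewrite mul_mx_chamber !mxE /=.
rewrite enum_rankK_in ?face_mul_chamber ?enum_valP //.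
have cg : act (enum_val i) g \in chambers A.
  by have := acts_act (chambers_acts presA) Wg (enum_val i); rewrite enum_valP => /= ->.
rewrite (bigD1 (enum_rank_in cg (act (enum_val i) g))) //= big1 ?addr0 => [|l nl].
  rewrite !mxE enum_rankK_in // eqxx mul1r (wz_act_mul presA) //.
  by rewrite eq_sym.
rewrite mxE; case: eqP => [e|_]; last by rewrite mul0r.
by case/eqP: nl; apply: enum_val_inj; rewrite enum_rankK_in.
Qed.

(** Being killed by y is transported by g to being killed by y g, whose support differs only by the
    W-component of g and so has the same eigenvalue. *)
Lemma walk_le_module c : mxmodule (chamber_repr presA) (walk_le p c).
Proof.
apply/mxmoduleP => g Wg; rewrite (eqmxMr _ (walk_leE c)) walk_leE.
apply/walk_kernelP => y cy; have WV : g^-1%g \in WZ by rewrite groupV.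
have -> : y = act (act y g^-1%g) g by rewrite -(wz_actM presA) // mulVg (wz_act1 presA).
rewrite -mulmxA -chamber_repr_face_mx // mulmxA ((walk_kernelP c _) (submx_refl _)) ?mul0mx //.
by rewrite (supp_act presA) // walk_eigenvalue_act ?groupV ?(WZ1 Wg).
Qed.

Lemma mxtrace_face_mx g x : g \in WZ ->
  \tr (face_mx x *m chamber_repr presA g)
  = #|[set c in chambers A | act (face_mul x c) g == c]|%:R.
Proof.
move=> Wg; rewrite /mxtrace.
transitivity (\sum_(c in chambers A) (act (face_mul x c) g == c)%:R : R).
  rewrite [RHS]big_enum_val; apply: eq_bigr => i _; rewrite mul_mx_chamber mxE.
  by rewrite enum_rankK_in ?face_mul_chamber ?enum_valP // eq_sym.
rewrite -sum1_card natr_sum; under [LHS]eq_bigr do rewrite mulrb.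
by rewrite -big_mkcondr /=; apply: eq_bigl => c; rewrite [RHS]inE.
Qed.

Lemma mxtrace_walk_le c (mod_le : mxmodule (chamber_repr presA) (walk_le p c)) g : g \in WZ ->
  \tr (submod_repr mod_le g) = \sum_(X | fixed_flat presA g X && (lam X <= c))
    (-1) ^+ (\dim (fixed_space rW g) + \dim (val X :&: fixed_space rW g)%VS)
    * fixed_mobius presA g X.
Proof.
move=> Wg; have [f [fK Kf fX]] := walk_projector c.
have [q [qT qX]] := polymx_faces f.
rewrite (@mxtrace_submod _ _ _ _ _ _ (polymx T f)) ?walk_leE //; last first.
  have /submxP[D ->] : (walk_le p c <= walk_kernel c)%MS by rewrite walk_leE.
  by rewrite -mulmxA Kf.
rewrite qT mulmx_suml raddf_sum /=.
under eq_bigr => x _ do rewrite -scalemxAl mxtraceZ mxtrace_face_mx // (fixed_count presA Wg) big_distrr /=.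
rewrite (exchange_big_dep (fixed_flat presA g)) /=; last by move=> x X _ /andP[].
rewrite [RHS]big_mkcondr; apply: eq_bigr => X fixX.
rewrite -big_distrl /= (eq_bigl (fun x => face_in x X)) => [|x]; last by rewrite fixX.
by rewrite qX fX; case: ifP; rewrite ?mul1r ?mul0r.
Qed.

End Action.
End Walk.

(** * Traces of the summands *)

Section DeterminantSigns.

Variables (R : realType) (gT : finGroupType) (G : {group gT}).

Lemma scale_repr_expr n (rG : mx_representation R G n) a g i : g \in G ->
  (a *: rG g) ^+ i = a ^+ i *: rG (g ^+ i)%g.
Proof.
move=> Gg; elim: i => [|i IH]; first by rewrite !expr0 repr_mx1 scale1r.
rewrite exprS IH expgS repr_mxM ?groupX // exprS.
by rewrite -[LHS]/(_ *m _) -scalemxAl -scalemxAr scalerA.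
Qed.

(** The factor 2 disposes of a, which is 1 or -1, whatever the parity of the order of g. *)
Lemma scale_repr_order n (rG : mx_representation R G n) a g : g \in G -> a ^+ 2 = 1 ->
  (a *: rG g) ^+ (2 * #[g]%g) = 1.
Proof.
move=> Gg a2; rewrite scale_repr_expr // exprM a2 expr1n mulnC expgM expg_order expg1n.
by rewrite repr_mx1 scale1r.
Qed.

(** Fixed dimensions are averages of traces over the powers, hence additive. *)
Lemma mxrank_fixed_factmod n (rG : mx_representation R G n) (U : 'M_n)
    (modU : mxmodule rG U) a g : g \in G -> a ^+ 2 = 1 ->
  (\rank (kermx (a *: submod_repr modU g - 1)) + \rank (kermx (a *: factmod_repr modU g - 1)))%N
  = \rank (kermx (a *: rG g - 1)).
Proof.
move=> Gg a2; have N0 : (0 < 2 * #[g]%g)%N by rewrite muln_gt0 order_gt0.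
apply/eqP; rewrite -(eqr_nat R) natrD; apply/eqP.
rewrite !(mxrank_fixed N0) ?scale_repr_order // -mulrDr -big_split /=; congr (_ * _).
apply: eq_bigr => i _; rewrite !scale_repr_expr // !mxtraceZ -mulrDr.
by rewrite mxtrace_sub_fact_mod.
Qed.

Lemma mxrank_fixed_submod n (rG : mx_representation R G n) (U : 'M_n)
    (modU : mxmodule rG U) a g : g \in G ->
  \rank (kermx (a *: submod_repr modU g - 1)) = \rank (U :&: kermx (a *: rG g - 1))%MS.
Proof.
move=> Gg; set K := kermx _.
have freeU : row_free (val_submod (1%:M : 'M_(\rank U))) by rewrite /row_free val_submod1.
rewrite -(mxrankMfree K freeU) -val_submodE; apply: eqmx_rank.
have valJ m (W : 'M_(m, \rank U)) :
    val_submod (W *m (a *: submod_repr modU g - 1)) = val_submod W *m (a *: rG g - 1).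
  rewrite !mulmxBr !mulmx1 -!scalemxAr raddfB /= linearZ /= val_submodJ //.
apply/andP; split.
  rewrite sub_capmx val_submodP; apply/sub_kermxP.
  by rewrite -valJ mulmx_ker linear0.
have /andP[capU capK] : ((U :&: kermx (a *: rG g - 1) <= U) && (U :&: kermx (a *: rG g - 1) <= kermx (a *: rG g - 1)))%MS.
  by rewrite capmxSl capmxSr.
rewrite -(in_submodK capU) val_submodS; apply/sub_kermxP.
apply/eqP; rewrite -val_submod_eq0 valJ in_submodK //; apply/eqP/sub_kermxP.
exact: capK.
Qed.

Lemma dim_subspace_rank d (Y : {vspace 'rV[R]_d}) m (M : 'M[R]_(m, d)) :
  (forall v, (v \in Y) = (v <= M)%MS) -> \dim Y = \rank M.
Proof.
move=> YM; rewrite -mxrank_subspace_mx; apply/eqmx_rank/andP.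
by split; apply/rV_subP => v; rewrite -mem_subspace_mx YM.
Qed.

End DeterminantSigns.

Section SummandTrace.

Variables (R : realType) (d : nat) (A : arrangement R d).
Variables (gT : finGroupType) (W : {group gT}) (rW : mx_representation R W d).
Hypothesis presA : preserves A rW.
Local Notation WZ := (setX_group W [set: 'Z_2]%G).
Implicit Types (X Y Z : flat A) (g : gT * 'Z_2).

Definition flat_term g X : R :=
  (-1) ^+ (\dim (fixed_space rW g) + \dim (val X :&: fixed_space rW g)%VS)
  * fixed_mobius presA g X.

Lemma mem_fixed_space_ker g v :
  (v \in fixed_space rW g) = (v <= kermx (((-1) ^+ g.2 : R) *: rW g.1 - 1))%MS.
Proof.
rewrite mem_fixed_space; apply/eqP/sub_kermxP.
  by rewrite mulmxBr mulmx1 /wz_mx => ->; rewrite subrr.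
by rewrite mulmxBr mulmx1 => /eqP; rewrite subr_eq0 => /eqP.
Qed.

(** The formula for det (- h) with h = (-1)^z w on V/X. Its fixed space has dimension dim U - dim (X
    :&: U), of the same parity as the sum. *)
Lemma det_factmod_sign X w (z : 'Z_2) : w \in stab presA X ->
  (-1) ^+ (d - \dim (val X)) * ((-1) ^+ z) ^+ (d - \dim (val X))
    * \det (factmod_repr (subspace_mx_mxmodule presA X) w)
  = (-1) ^+ (\dim (fixed_space rW (w, z)) + \dim (val X :&: fixed_space rW (w, z))%VS) :> R.
Proof.
move=> Sw; have a2 : ((-1) ^+ z : R) ^+ 2 = 1 by rewrite sqrr_sign.
have N0 : (0 < 2 * #[w]%g)%N by rewrite muln_gt0 order_gt0.
have rkQ : \rank (cokermx (subspace_mx (val X))) = (d - \dim (val X))%N.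
  by rewrite mxrank_coker mxrank_subspace_mx.
have := det_opp_finite_order N0 (scale_repr_order (factmod_repr (subspace_mx_mxmodule presA X)) Sw a2).
rewrite -scaleN1r !detZ mulrA -!rkQ => ->.
have := mxrank_fixed_factmod (subspace_mx_mxmodule presA X) Sw a2.
rewrite mxrank_fixed_submod //.
have -> : \rank (kermx ((-1) ^+ z *: subg_repr rW (stab_sub presA X) w - 1)) = \dim (fixed_space rW (w, z)).
  by apply/esym/dim_subspace_rank => v; apply: mem_fixed_space_ker.
have -> : \rank (subspace_mx (val X) :&: kermx ((-1) ^+ z *: subg_repr rW (stab_sub presA X) w - 1))%MS
    = \dim (val X :&: fixed_space rW (w, z))%VS.
  apply/esym/dim_subspace_rank => v; rewrite memv_cap sub_capmx mem_subspace_mx.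
  by rewrite mem_fixed_space_ker.
by move=> <-; rewrite addnAC addnn -mul2n mulnC exprD exprM sqrr_sign mul1r.
Qed.

Lemma flat_term_stab X w (z : 'Z_2) : w \in stab presA X ->
  \tr (total_cohomology presA X w) * \tr (det_quotient presA X w)
    * ((-1) ^+ z) ^+ (d - \dim (val X))
  = flat_term (w, z) X.
Proof.
move=> Sw; rewrite mxtrace_total_cohomology // mxtrace_scalar mulr1n.
rewrite /flat_term -det_factmod_sign // /fixed_mobius /=.
set D := \det _; set e := chain_euler _ _ _; set k := (d - _)%N; set s := ((-1) ^+ z) ^+ k.
(* The top index is one less than the codimension, which gives the minus sign of [fixed_mobius]; for
   X = V the predecessor is truncated and there is none. *)
have -> : (-1) ^+ k.-1 * e = (-1) ^+ k * (if X == flat_full A then e else - e).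
  have [X0|XV] := eqVneq X (flat_full A); first by rewrite /k X0 dim_flat_full subnn.
  have k0 : (0 < k)%N.
    rewrite subn_gt0 ltn_neqAle dim_flat_le andbT; apply: contra XV => /eqP dX.
    by rewrite -val_eqE eqEdim subvf dim_flat_full dX leqnn.
  by rewrite -{2}(prednK k0) exprS mulN1r mulrNN.
by rewrite -!mulrA; congr (_ * _); rewrite mulrA mulrC; congr (_ * _); apply: mulrC.
Qed.

End SummandTrace.

Section OrbitSum.

Variables (R : realType) (d : nat) (A : arrangement R d).
Local Notation V := 'rV[R]_d.
Variables (gT : finGroupType) (W : {group gT}) (rW : mx_representation R W d).
Hypothesis presA : preserves A rW.
Local Notation WZ := (setX_group W [set: 'Z_2]%G).
Implicit Types (X Y Z : flat A) (g : gT * 'Z_2).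
Local Notation fact := (flat_action presA).

Lemma dim_image_unit (M : 'M[R]_d) (Y Y' : {vspace V}) : M \in unitmx ->
  (forall v, (v *m M \in Y') = (v \in Y)) -> \dim Y' = \dim Y.
Proof.
move=> uM YY'; rewrite (_ : Y' = linfun (mulmxr M) @: Y)%VS.
  apply: limg_dim_eq; rewrite (_ : lker _ = 0%VS) ?capv0 //; apply/eqP/lker0P => u v.
  by rewrite !lfunE /=; apply: (can_inj (mulmxK uM)).
apply/vspaceP => v; rewrite -[v](mulmxKV uM) YY'.
have -> : v *m invmx M *m M = linfun (mulmxr M) (v *m invmx M) by rewrite lfunE.
apply/idP/memv_imgP => [h|[u Yu]]; first by exists (v *m invmx M).
by rewrite !lfunE /= => /(can_inj (mulmxK uM)) ->.
Qed.

Lemma dim_flat_act X w : w \in W -> \dim (val (fact X w)) = \dim (val X).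
Proof.
move=> Ww; apply: (dim_image_unit (repr_mx_unit rW Ww)) => v.
by rewrite val_flat_act // mem_subspace_image ?(repr_mx_unit rW).
Qed.

Lemma flat_act_full w : w \in W -> fact (flat_full A) w = flat_full A.
Proof. by move=> Ww; apply/val_inj/eqP; rewrite eqEdim dim_flat_act // leqnn andbT subvf. Qed.

Lemma val_flat_full X : (val X == fullv) = (X == flat_full A).
Proof. by rewrite -[X == _]val_eqE. Qed.

Lemma fixed_flat_conj w r (z : 'Z_2) X : w \in W -> r \in W ->
  fixed_flat presA (w, z) (fact X r) = fixed_flat presA ((r * w * r^-1)%g, z) X.
Proof.
move=> Ww Wr; have actM a b Y : a \in W -> b \in W -> fact (fact Y a) b = fact Y (a * b)%g.
  by move=> Wa Wb; rewrite (actMin fact Y Wa Wb).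
have Wc : (r * w * r^-1)%g \in W by rewrite !groupM ?groupV.
transitivity (fact (fact X r) w == fact X r); first by [].
transitivity (fact X (r * w * r^-1)%g == X); last by [].
rewrite (actM r w X Wr Ww).
have e := actM _ r X Wc Wr; rewrite mulgKV in e; rewrite -e.
exact: (inj_eq (act_inj fact r)).
Qed.

Lemma in_fixed_proper_flats g X :
  (X \in fixed_proper_flats presA g) = fixed_flat presA g X && (X != flat_full A).
Proof. by rewrite inE val_flat_full. Qed.

Lemma flat_term_conj w r (z : 'Z_2) X : w \in W -> r \in W ->
  flat_term presA ((r * w * r^-1)%g, z) X = flat_term presA (w, z) (fact X r).
Proof.
move=> Ww Wr; have uM := repr_mx_unit rW Wr.
have Wz u : u \in W -> (u, z) \in WZ by move=> Wu; rewrite inE Wu inE.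
have Wc : (r * w * r^-1)%g \in W by rewrite !groupM ?groupV.
have fixE v : (v *m rW r \in fixed_space rW (w, z)) = (v \in fixed_space rW ((r * w * r^-1)%g, z)).
  rewrite !mem_fixed_space /wz_mx /= !repr_mxM ?groupM ?groupV // repr_mxV //.
  rewrite -[RHS](inj_eq (can_inj (mulmxK uM))) -!scalemxAr -!scalemxAl !mulmxA.
  by rewrite mulmxKV.
have dimU : \dim (fixed_space rW (w, z)) = \dim (fixed_space rW ((r * w * r^-1)%g, z)).
  exact: (dim_image_unit uM).
have dimXU : \dim (val (fact X r) :&: fixed_space rW (w, z))%VS
    = \dim (val X :&: fixed_space rW ((r * w * r^-1)%g, z))%VS.
  apply: (dim_image_unit uM) => v; rewrite !memv_cap fixE val_flat_act //.
  by rewrite mem_subspace_image.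
rewrite /flat_term dimU dimXU; congr (_ * _).
have fullE : (fact X r == flat_full A) = (X == flat_full A).
  by rewrite -{1}(flat_act_full Wr); apply: (inj_eq (act_inj fact r)).
rewrite /fixed_mobius fullE.
suff -> : chain_euler presA X (r * w * r^-1)%g = chain_euler presA (fact X r) w by [].
rewrite (chain_eulerE presA (Wz _ Wc)) (chain_eulerE presA (Wz _ Ww)) /=.
pose f Y := flat_act rW Y r; have fI : injective f := act_inj fact r.
have fD : f @: fixed_proper_flats presA ((r * w * r^-1)%g, z) = fixed_proper_flats presA (w, z).
  apply/setP => Y; have -> : Y = f (fact Y r^-1%g) by rewrite -[LHS](actKVin fact Wr).
  set Y' := fact Y r^-1%g; rewrite (mem_imset _ _ fI) !in_fixed_proper_flats.
  have -> : fixed_flat presA (w, z) (f Y') = fixed_flat presA ((r * w * r^-1)%g, z) Y'.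
    exact: fixed_flat_conj.
  have fV : f (flat_full A) = flat_full A := flat_act_full Wr.
  by rewrite -[in RHS]fV [in RHS](inj_eq fI).
rewrite -fD; apply/esym; apply: (chain_sum_imset _ _ _ fI) => Y Z.
exact: flat_lt_act.
Qed.

Lemma mem_stab X w : (w \in stab presA X) = (w \in W) && (fact X w == X).
Proof.
rewrite inE; case Ww: (w \in W) => //=.
by rewrite inE Ww inE sub1set inE.
Qed.

(** A coset of the stabilizer amounts to the flat to which it moves X. The component 0 in Z_2 is
    arbitrary, as signs act trivially on flats. *)
Lemma rcoset_fixed X C w : w \in W -> C \in rcosets (stab presA X) W ->
  [/\ repr C \in W, (C == (C :* w)%g) = fixed_flat presA (w, 0) (fact X (repr C))
    & C == (C :* w)%g -> (repr C * w * (repr C)^-1)%g \in stab presA X].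
Proof.
move=> Ww CW; have [CE Wr] : C = (stab presA X :* repr C)%g /\ repr C \in W.
  case/rcosetsP: CW => x Wx ->; split; first by rewrite rcoset_repr.
  by case/rcosetP: (mem_repr_rcoset (stab presA X) x) => s /(subsetP (stab_sub presA X)) Ws ->; rewrite groupM.
have stabE : (C == (C :* w)%g) = ((repr C * w * (repr C)^-1)%g \in stab presA X).
  apply/eqP/idP => [e|s].
    rewrite -mem_rcoset -CE {2}e; apply/rcosetP; exists (repr C) => //.
    by rewrite CE mem_repr_rcoset.
  by rewrite {2}CE -rcosetM -[(repr C * w)%g](mulgKV (repr C)) rcosetM rcoset_id // -CE.
split=> //; last by rewrite stabE.
by rewrite stabE (fixed_flat_conj 0 X Ww Wr) mem_stab !groupM ?groupV.
Qed.

End OrbitSum.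

Section Assembly.

Variables (R : realType) (d : nat) (A : arrangement R d).
Variables (gT : finGroupType) (W : {group gT}) (rW : mx_representation R W d).
Hypothesis presA : preserves A rW.
Local Notation WZ := (setX_group W [set: 'Z_2]%G).
Implicit Types (X Y Z : flat A) (g : gT * 'Z_2).
Local Notation fact := (flat_action presA).

(** Only the cosets fixed by w contribute to the induced character, that is the g-fixed flats in the
    orbit; conjugation by the representative turns the term at X into the term at the moved flat. *)
Lemma mxtrace_flat_summand X g : g \in WZ ->
  \tr (flat_summand presA X g)
  = \sum_(Y in orbit fact W X | fixed_flat presA g Y) flat_term presA g Y.
Proof.
case: g => w z Wg; have Ww : w \in W := WZ1 Wg.
have -> : \tr (flat_summand presA X (w, z))
    = \tr (ind_grepr (stab_sub presA X) (tensor_grepr (total_cohomology presA X) (det_quotient presA X)) w)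
      * \tr (tensor_power (chi_minus R) (d - \dim (val X)) z) by apply: mxtrace_prod.
rewrite mxtrace_ind_grepr mxtrace_tensor_power mxtrace_scalar mulr1n big_distrl /=.
have inj : {in rcosets (stab presA X) W &, injective (fun C => fact X (repr C))}.
  move=> C D CW DW e; have K := @act_reprK _ _ _ fact W X (subxx W).
  by rewrite -(K C CW) -(K D DW); apply: (congr1 (amove fact W X) e).
have -> : orbit fact W X = [set fact X (repr C) | C in rcosets (stab presA X) W].
  exact: (orbit_stabilizer fact X (subxx W)).
rewrite [RHS]big_mkcondr big_imset //= -big_mkcondr /=.
have sumE C : C \in rcosets (stab presA X) W ->
    (C == (C :* w)%g) = fixed_flat presA (w, z) (fact X (repr C)).
  by move=> CW; have [_ -> _] := rcoset_fixed Ww CW.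
apply: eq_big => [C|C /andP[CW Cw]].
  by case CW: (C \in _) => //=; apply: sumE.
have [Wr _ /(_ Cw) st] := rcoset_fixed Ww CW.
rewrite -(flat_term_conj presA z X Ww Wr) -(flat_term_stab z st); congr (_ * _).
exact: mxtrace_prod.
Qed.

Lemma sum_orbit_transversal (F : flat A -> R) :
  \sum_(X in orbit_transversal fact W [set: flat A]) \sum_(Y in orbit fact W X) F Y = \sum_Y F Y.
Proof.
have actT : [acts W, on [set: flat A] | fact].
  by apply/subsetP => w Ww; rewrite inE Ww inE; apply/subsetP => X _; rewrite !inE.
have [_ _ tr1 tr2] := orbit_transversalP actT.
rewrite (exchange_big_dep xpredT) //=; apply: eq_bigr => Y _.
have [a Wa Ya] := tr2 Y (in_setT Y).
have YO : Y \in orbit fact W (fact Y a).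
  by rewrite (@orbit_in_sym _ _ _ fact W (subxx W)) mem_orbit.
rewrite (big_pred1 (fact Y a)) // => X; apply/andP/eqP => [[XT XY]|->]; last by [].
apply/eqP; rewrite -(tr1 _ _ XT Ya).
by rewrite (orbit_in_trans (to := fact) (subxx W) (mem_orbit _ _ Wa) XY).
Qed.

End Assembly.

Theorem theorem4p11 (R : realType) (d : nat) (A : arrangement R d)
  (A_essential : essential A)
  (gT : finGroupType) (W : {group gT}) (rW : mx_representation R W d)
  (W_faithful : mx_faithful rW) (W_preserves : preserves A rW)
  (p : face A -> R) (p_ge0 : forall x, 0 <= p x)
  (p_invariant : forall w x, w \in W -> p (face_image (rW w) x) = p x)
  (lam : R) :
  stablemx (walk_le p lam) (tau_mx A) /\
  exists mod_le : mxmodule (chamber_repr W_preserves) (walk_le p lam),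
    gclass (Representation (submod_repr mod_le)) =
    \sum_(X in orbit_transversal (flat_action W_preserves) W [set: flat A]
          | walk_eigenvalue p X <= lam)
      gclass (flat_summand W_preserves X).
Proof.
have mod_le := walk_le_module p_ge0 W_preserves p_invariant lam; split.
  have tauWZ : (1%g, (1%R : 'Z_2)) \in setX_group W [set: 'Z_2]%G by rewrite inE group1 inE.
  (* The pair (1, tau) acts on V as -1, so stability under tau is a case of stability under W x
     Z_2. *)
  have <- : chamber_repr W_preserves (1%g, (1%R : 'Z_2)) = tau_mx A.
    apply/matrixP => i j; rewrite !mxE /= /wz_act tauWZ; congr (_ == _)%:R.
    by rewrite /face_image /face_opp /wz_mx /= repr_mx1 expr1 scaleN1r mulmxN mulmx1.
  exact: (mxmoduleP mod_le).
exists mod_le; rewrite -gclass_bigdadd; apply: gclass_eq_mxtrace => g Wg.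
rewrite mxtrace_walk_le // mxtrace_bigdadd.
under [RHS]eq_bigr do rewrite mxtrace_flat_summand //.
(* The eigenvalue condition is constant on orbits, so it can be tested on each flat instead of on
   the representative. *)
pose F Y := if fixed_flat W_preserves g Y && (walk_eigenvalue p Y <= lam)
  then flat_term W_preserves g Y else 0.
rewrite big_mkcond /= -[LHS](sum_orbit_transversal W_preserves F).
rewrite [RHS]big_mkcondr /=; apply: eq_bigr => X _; rewrite /F.
case: ifP => Xlam.
  rewrite [RHS]big_mkcondr; apply: eq_bigr => Y /orbitP[a Wa <-].
  by rewrite walk_eigenvalue_act // Xlam andbT.
by rewrite big1 // => Y /orbitP[a Wa <-]; rewrite walk_eigenvalue_act // Xlam andbF.
Qed.
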